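(* Consider the TAR(1) model with $\gamma=\delta=0$, i.e. $Y_t=\alpha Y_{t-1}+\varepsilon_t$ if $Y_{t-1}>r$ and $Y_t=\beta Y_{t-1}+\varepsilon_t$ if $Y_{t-1}\le r$, $t\ge1$, and assume $\mathbb{E}Y_0^2<\infty$. Suppose that either (i) $\alpha=1$, $\beta<1$ and $r\le 0$; or (ii) $\alpha=1$, $\beta=-1$ and $r\in\mathbb{R}$ is arbitrary. Then, as $n\to\infty$, $$ n(\hat\alpha_n-1)\Rightarrow \frac{B^2(1)-1}{2\int_0^1 B^2(t)\,\mathrm{d}t},$$ where $B$ is a standard Brownian motion.
   Context: Standing assumptions: $\{\varepsilon_t\}_{t\ge1}$ is an i.i.d. sequence of real random variables with $\mathbb{E}\varepsilon_1=0$ and $\mathbb{E}\varepsilon_1^2=\sigma^2\in(0,\infty)$; the initial value $Y_0$ is a random variable independent of $\{\varepsilon_t\}_{t\ge1}$ (and of $n$). The general TAR(1) model is $Y_t=\gamma+\alpha Y_{t-1}+\varepsilon_t$ if $Y_{t-1}>r$ and $Y_t=\delta+\beta Y_{t-1}+\varepsilon_t$ if $Y_{t-1}\le r$, with real parameters $\gamma,\delta,\alpha,\beta$ and threshold $r\in\mathbb{R}$. The least-squares estimator of $\alpha$ (with $\gamma=0$) is $$\hat\alpha_n=\frac{\sum_{t=1}^{n-1}I(Y_t>r)Y_tY_{t+1}}{\sum_{t=1}^{n-1}I(Y_t>r)Y_t^2}$$ (defined when the denominator is nonzero). $\Rightarrow$ denotes convergence in distribution. *)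

(* Defs.v *)
From HB Require Import structures.
From mathcomp Require Import all_boot all_order all_algebra.
From mathcomp Require Import all_classical all_reals all_analysis.
Set Implicit Arguments. Unset Strict Implicit. Unset Printing Implicit Defensive.
Import Order.TTheory GRing.Theory Num.Theory.
Import numFieldNormedType.Exports.
Local Open Scope classical_set_scope.
Local Open Scope ring_scope.

Definition mutually_independent {d} {T : measurableType d} {R : realType}
  (P : probability T R) (I : eqType) (X : I -> T -> R) : Prop :=
  (forall i, measurable_fun setT (X i)) /\
  forall (J : seq I) (A : I -> set R), uniq J ->
    (forall j, measurable (A j)) ->
    P (\bigcap_(j in [set` J]) (X j @^-1` A j)) =
    (\prod_(j <- J) P (X j @^-1` A j))%E.

Definition standard_brownian_motion {d} {O : measurableType d} {R : realType}
  (Q : probability O R) (B : R -> O -> R) : Prop :=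
  [/\ (forall t, 0 <= t -> measurable_fun setT (B t)),
      (forall w, B 0 w = 0),
      (forall w, {within `[0, +oo[, continuous (fun t => B t w)}),
      (forall s t, 0 <= s -> s < t -> forall A, measurable A ->
          Q ((fun w => B t w - B s w) @^-1` A) = normal_prob 0 (Num.sqrt (t - s)) A) &
      (forall (k : nat) (ts : nat -> R), 0 <= ts 0%N ->
          (forall i, (i < k)%N -> ts i < ts i.+1) ->
          mutually_independent Q (fun i : 'I_k => fun w => B (ts i.+1) w - B (ts i) w))].

Definition conv_in_distribution {d1 d2} {T : measurableType d1}
  {O : measurableType d2} {R : realType} (P : probability T R) (X : nat -> T -> R)
  (Q : probability O R) (Z : O -> R) : Prop :=
  forall f : R -> R, continuous f -> (exists M : R, forall x, `|f x| <= M) ->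
    (fun n => (\int[P]_x (f (X n x))%:E)%E) @ \oo --> (\int[Q]_w (f (Z w))%:E)%E.

Fixpoint tar1 {T : Type} {R : realType} (alpha beta r : R) (Y0 : T -> R)
  (eps : nat -> T -> R) (t : nat) (x : T) : R :=
  match t with
  | 0%N => Y0 x
  | t'.+1 => let y := tar1 alpha beta r Y0 eps t' x in
             (if r < y then alpha * y else beta * y) + eps t'.+1 x
  end.

Definition lse_num {T : Type} {R : realType} (r : R) (Y : nat -> T -> R) (n : nat) (x : T) : R :=
  \sum_(1 <= t < n) (if r < Y t x then Y t x * Y t.+1 x else 0).
Definition lse_den {T : Type} {R : realType} (r : R) (Y : nat -> T -> R) (n : nat) (x : T) : R :=
  \sum_(1 <= t < n) (if r < Y t x then Y t x ^+ 2 else 0).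

(* Main.v *)
Require Import Defs.
From HB Require Import structures.
From mathcomp Require Import all_boot all_order all_algebra.
From mathcomp Require Import all_classical all_reals all_analysis.
From mathcomp Require Import measurable_realfun ring lra.
Set Implicit Arguments. Unset Strict Implicit. Unset Printing Implicit Defensive.
Import Order.TTheory GRing.Theory Num.Theory.
Import numFieldNormedType.Exports.
Local Open Scope classical_set_scope.
Local Open Scope ring_scope.

(** The Laplace functional of the pair (Y_n^2 / (n s2), sum_i Y_i^2 / (n^2 s2)) is
    computed backwards in time.  Integrating out one innovation turns
    exp (- a y^2) into exp (- a' y^2) times a factor 1 - a' / n, up to errors controlled
    by Lindeberg's condition, where a' follows a discrete Riccati recursion.  The same
    recursion, run on the grid increments of Brownian motion, produces the functional
    of (B(1)^2, int B^2), so both sides have the same limit and no functional central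
    limit theorem is needed.  Below the threshold the chain multiplies by beta instead
    of 1, which costs (beta^2 - 1) Y_t^2; either beta^2 = 1, or a drift argument shows
    that the expected energy spent below the threshold is sublinear.  Finally,
    convergence of the joint Laplace transforms at integer arguments gives, by
    Bernstein approximation, convergence of the expectations of continuous functions
    of the ratio, because int B^2 > 0 almost surely. *)

(** * Expectations *)

(** Two squares carry the whole statistic because squaring the recursion and summing writes twice
    the martingale in the numerator, the sum of I(Y_t > r) Y_t eps_{t+1}, as Y_n^2 - n s2 plus terms
    that are o(n) in mean. So n (hat alpha_n - 1) is a perturbation of (u - 1) / (2 v) with u =
    Y_n^2 / (n s2) and v = sum Y_i^2 / (n^2 s2), and the signs of the Y_t, in which chain and
    Brownian motion may differ, never enter. The limit of the Laplace functional is not evaluated: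
    chain and Brownian grid are both compared with the same product of factors 1 - a_j / n. The
    delicate point in case (i) is that the energy below the threshold must be o(n), while bounding
    each term only gives O(n). Contraction or reflection below r reduces this to the time spent
    under a level K being o(n) in mean. For that, the increasing convex function 2 y + sqrt (1 +
    y^2) serves: at time t its expectation along the chain gains at least a fixed multiple of P(Y_t
    <= K), yet after n steps it is only O(sqrt n). *)

Definition L1 {d} {T : measurableType d} {R : realType} (P : probability T R)
  (X : T -> R) : Prop := P.-integrable setT (EFin \o X).

Definition Ex {d} {T : measurableType d} {R : realType} (P : probability T R)
  (X : T -> R) : R := Rintegral P setT X.

Section expectation.
Context {d : measure_display} {T : measurableType d} {R : realType}
  (P : probability T R).
Implicit Types X Y Z : T -> R.

Lemma L1_meas X : L1 P X -> measurable_fun setT X.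
Proof. by move=> /measurable_int /measurable_EFinP. Qed.

Lemma L1_le X Y : measurable_fun setT X -> (forall x, `|X x| <= Y x) ->
  L1 P Y -> L1 P X.
Proof.
move=> mX XY iY; apply: (le_integrable _ _ _ iY) => //; first exact/measurable_EFinP.
by move=> x _ /=; rewrite lee_fin (le_trans (XY x))// ler_norm.
Qed.

Lemma L1_cst c : L1 P (fun=> c).
Proof. exact: (finite_measure_integrable_cst P c measurableT). Qed.

Lemma L1_bnd M X : measurable_fun setT X -> (forall x, `|X x| <= M) -> L1 P X.
Proof. by move=> mX XM; apply: (L1_le mX XM); exact: L1_cst. Qed.

Lemma L1_ge0 X : measurable_fun setT X -> (forall x, 0 <= X x) ->
  (\int[P]_x (X x)%:E < +oo)%E -> L1 P X.
Proof.
move=> mX X0 iX; apply/integrableP; split; first exact/measurable_EFinP.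
by under eq_integral do rewrite /= ger0_norm//.
Qed.

Lemma L1D X Y : L1 P X -> L1 P Y -> L1 P (fun x => X x + Y x).
Proof. by move=> iX iY; have := integrableD measurableT iX iY. Qed.

Lemma L1N X : L1 P X -> L1 P (fun x => - X x).
Proof. by move=> iX; have := integrableN iX. Qed.

Lemma L1B X Y : L1 P X -> L1 P Y -> L1 P (fun x => X x - Y x).
Proof. by move=> iX iY; apply: L1D => //; exact: L1N. Qed.

Lemma L1Z c X : L1 P X -> L1 P (fun x => c * X x).
Proof. by move=> iX; have := integrableZl measurableT c iX. Qed.

Lemma L1Zr c X : L1 P X -> L1 P (fun x => X x * c).
Proof.
by move=> iX; rewrite (_ : (fun _ => _) = fun x => c * X x); [exact: L1Z|
  apply/funext => x; rewrite mulrC].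
Qed.

Lemma L1_norm X : L1 P X -> L1 P (fun x => `|X x|).
Proof. by move=> /integrable_norm. Qed.

Lemma L1_sum (I : Type) (s : seq I) (p : pred I) (X : I -> T -> R) :
  (forall i, p i -> L1 P (X i)) -> L1 P (fun x => \sum_(i <- s | p i) X i x).
Proof.
move=> iX; elim: s => [|i s ih].
  by under eq_fun do rewrite big_nil; exact: L1_cst.
under eq_fun do rewrite big_cons.
by have [pi|_] := boolP (p i); [apply: L1D => //; exact: iX|].
Qed.

Lemma L1_sum_nat m n (X : nat -> T -> R) :
  (forall i, (m <= i < n)%N -> L1 P (X i)) ->
  L1 P (fun x => \sum_(m <= i < n) X i x).
Proof.
move=> iX; under eq_fun do rewrite big_nat_cond.
by apply: L1_sum => i /andP[/iX].
Qed.

Lemma L1_ext X Y : L1 P X -> X =1 Y -> L1 P Y.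
Proof. by move=> iX /funext <-. Qed.

Lemma Ex_ext X Y : X =1 Y -> Ex P X = Ex P Y.
Proof. by move=> /funext <-. Qed.

Lemma ExD X Y : L1 P X -> L1 P Y -> Ex P (fun x => X x + Y x) = Ex P X + Ex P Y.
Proof. exact: RintegralD. Qed.

Lemma ExB X Y : L1 P X -> L1 P Y -> Ex P (fun x => X x - Y x) = Ex P X - Ex P Y.
Proof. exact: RintegralB. Qed.

Lemma ExZ c X : L1 P X -> Ex P (fun x => c * X x) = c * Ex P X.
Proof. exact: RintegralZl. Qed.

Lemma Ex_cst c : Ex P (fun=> c) = c.
Proof.
by rewrite /Ex /Rintegral integral_cst//= (@probability_setT _ _ _ P) mule1.
Qed.

Lemma Ex_le X Y : L1 P X -> L1 P Y -> (forall x, X x <= Y x) -> Ex P X <= Ex P Y.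
Proof. by move=> iX iY XY; exact: le_Rintegral. Qed.

Lemma Ex_ge0 X : (forall x, 0 <= X x) -> 0 <= Ex P X.
Proof. by move=> X0; apply: Rintegral_ge0. Qed.

Lemma Ex_norm X : L1 P X -> `|Ex P X| <= Ex P (fun x => `|X x|).
Proof. by move=> iX; apply: le_normr_Rintegral. Qed.

Lemma Ex_bnd M X : L1 P X -> (forall x, `|X x| <= M) -> `|Ex P X| <= M.
Proof.
move=> iX XM; apply: le_trans (Ex_norm iX) _.
by rewrite -[leRHS]Ex_cst; apply: Ex_le => //; [exact: L1_norm|exact: L1_cst].
Qed.

Lemma Ex_sum (I : Type) (s : seq I) (p : pred I) (X : I -> T -> R) :
  (forall i, p i -> L1 P (X i)) ->
  Ex P (fun x => \sum_(i <- s | p i) X i x) = \sum_(i <- s | p i) Ex P (X i).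
Proof.
move=> iX; elim: s => [|i s ih].
  by under [LHS]Ex_ext do rewrite big_nil; rewrite Ex_cst big_nil.
rewrite big_cons; case: ifPn => pi; last first.
  by rewrite -ih; apply: Ex_ext => x; rewrite big_cons (negbTE pi).
rewrite -ih -ExD; [|exact: iX|exact: L1_sum].
by apply: Ex_ext => x; rewrite big_cons pi.
Qed.

Lemma Ex_sum_nat m n (X : nat -> T -> R) :
  (forall i, (m <= i < n)%N -> L1 P (X i)) ->
  Ex P (fun x => \sum_(m <= i < n) X i x) = \sum_(m <= i < n) Ex P (X i).
Proof.
move=> iX; rewrite big_nat_cond.
under [LHS]Ex_ext do rewrite big_nat_cond.
by apply: Ex_sum => i /andP[/iX].
Qed.

Lemma L2_mul X Y : measurable_fun setT X -> measurable_fun setT Y ->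
  L1 P (fun x => X x ^+ 2) -> L1 P (fun x => Y x ^+ 2) ->
  L1 P (fun x => X x * Y x).
Proof.
move=> mX mY iX iY; apply: (L1_le _ _ (L1D iX iY)); first exact: measurable_funM.
move=> x; rewrite normrM -(real_normK (num_real (X x))) -(real_normK (num_real (Y x))).
have := sqr_ge0 (`|X x| - `|Y x|); have := normr_ge0 (X x); have := normr_ge0 (Y x).
by nra.
Qed.

Lemma L2_L1 X : measurable_fun setT X -> L1 P (fun x => X x ^+ 2) -> L1 P X.
Proof.
move=> mX iX; apply: (L1_ext (X := fun x => X x * 1)); last by move=> x; rewrite mulr1.
by apply: L2_mul => //; exact: L1_cst.
Qed.

Lemma L2_D X Y : measurable_fun setT X -> measurable_fun setT Y ->
  L1 P (fun x => X x ^+ 2) -> L1 P (fun x => Y x ^+ 2) ->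
  L1 P (fun x => (X x + Y x) ^+ 2).
Proof.
move=> mX mY iX iY; apply: (L1_ext (X := fun x => X x ^+ 2 + Y x ^+ 2 + 2 * (X x * Y x))).
  by apply: L1D; [exact: L1D|apply: L1Z; exact: L2_mul].
by move=> x /=; ring.
Qed.

End expectation.

Lemma Ex_cvg_dom {d} {T : measurableType d} {R : realType} (P : probability T R)
    (X : nat -> T -> R) (Y G : T -> R) :
  (forall n, measurable_fun setT (X n)) -> (forall n x, `|X n x| <= G x) ->
  L1 P G -> measurable_fun setT Y ->
  (exists N : set T, [/\ measurable N, P N = 0%E & forall x, ~ N x -> X ^~ x @ \oo --> Y x]) ->
  (fun n => Ex P (X n)) @ \oo --> Ex P Y.
Proof.
move=> mX XG iG mY [N [mN N0 XY]].
have := @dominated_convergence _ _ _ P setT measurableT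
  (fun n x => (X n x)%:E) (fun x => (Y x)%:E) (EFin \o G).
case.
- by move=> n; exact/measurable_EFinP.
- exact/measurable_EFinP.
- exists N; split => // x /= h; apply: contrapT => nN; apply: h => _.
  by apply: cvg_EFin; [exact: nearW|exact: XY].
- exact: iG.
- by apply: aeW => x n _; rewrite lee_fin.
move=> iY _ c; apply: fine_cvg; apply: cvg_trans c _.
by rewrite /Ex /Rintegral fineK ?integrable_fin_num.
Qed.

(** * Independence of the past *)

(** Rectangles in the coordinates 0..t form a pi-system generating the sigma-algebra of the past;
    stability under intersection is what the uniqueness theorem for measures asks for. *)
Definition past {T : Type} {R : realType} (xi : nat -> T -> R) (t : nat) :
    set (set T) :=
  [set C | exists2 A : nat -> set R, (forall j, measurable (A j)) &
     C = \bigcap_(j in [set j | (j <= t)%N]) (xi j @^-1` A j)].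

(** Measurability is stated on the type carrying the generated sigma-algebra, so that the closure
    lemmas for measurable functions apply to adapted ones unchanged. *)
Definition adapted {d} {T : measurableType d} {R : realType}
    (xi : nat -> T -> R) (t : nat) (X : T -> R) : Prop :=
  measurable_fun setT (X : g_sigma_algebraType (past xi t) -> R).

Definition indep_seq {d} {T : measurableType d} {R : realType}
    (P : probability T R) (xi : nat -> T -> R) : Prop :=
  (forall j, measurable_fun setT (xi j)) /\
  forall t (A : nat -> set R), (forall j, measurable (A j)) ->
  P (\bigcap_(j in [set j | (j <= t)%N]) (xi j @^-1` A j)) =
  (\prod_(0 <= j < t.+1) P (xi j @^-1` A j))%E.

Lemma mutually_independent_indep_seq {d} {T : measurableType d} {R : realType}
    (P : probability T R) (xi : nat -> T -> R) :
  mutually_independent P xi -> indep_seq P xi.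
Proof.
move=> [mxi indep]; split => // t A mA.
have <- := indep (index_iota 0 t.+1) A (iota_uniq _ _) mA.
have -> // : [set j | (j <= t)%N] = [set` index_iota 0 t.+1].
by apply/seteqP; split => j; rewrite /mkset/= mem_index_iota.
Qed.

Section independence.
Context {d : measure_display} {T : measurableType d} {R : realType}
  (P : probability T R) (xi : nat -> T -> R).

Lemma past_setI t : setI_closed (past xi t).
Proof.
move=> _ _ [A mA ->] [B mB ->]; exists (fun j => A j `&` B j).
  by move=> j; exact: measurableI.
by rewrite -bigcapI; apply: eq_bigcapr.
Qed.

Lemma adapted_xi t j : (j <= t)%N -> adapted xi t (xi j).
Proof.
move=> jt _ A mA; rewrite setTI; apply: sub_sigma_algebra.
exists (fun i => if i == j then A else setT).
  by move=> i; case: ifP.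
apply/seteqP; split => [x Ax i _ /=|x /(_ j)]; first by case: eqP => [->|].
by rewrite /= eqxx; apply.
Qed.

Lemma adapted_le s t X : (s <= t)%N -> adapted xi s X -> adapted xi t X.
Proof.
move=> st aX _ A mA; have := aX measurableT A mA.
apply: smallest_sub; first exact: smallest_sigma_algebra.
move=> _ [C mC ->]; apply: sub_sigma_algebra.
exists (fun i => if (i <= s)%N then C i else setT).
  by move=> i; case: ifP.
apply/seteqP; split => x /= Cx i /= ij.
  by case: ifPn => // is_; apply: Cx.
by have := Cx i; rewrite /= ij; apply; exact: leq_trans st.
Qed.

Hypothesis indep : indep_seq P xi.

Let mxi j : measurable_fun setT (xi j).
Proof. by case: indep. Qed.

Lemma past_measurable t : past xi t `<=` measurable.
Proof.
move=> _ [A mA ->]; apply: bigcap_measurable; first by exists 0%N.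
by move=> k _; rewrite -[X in measurable X]setTI; exact: mxi.
Qed.

Lemma adapted_measurable t X : adapted xi t X -> measurable_fun setT X.
Proof.
move=> aX _ A mA; have := aX measurableT A mA.
apply: smallest_sub; first exact: sigma_algebra_measurable.
exact: past_measurable.
Qed.

(** In C, both sides are finite measures; they agree on rectangles, hence on the sigma-algebra that
    rectangles generate. *)
Lemma past_indep t C B : <<s past xi t >> C -> measurable B ->
  P (C `&` xi t.+1 @^-1` B) = (P C * P (xi t.+1 @^-1` B))%E.
Proof.
move=> sC mB; pose E := xi t.+1 @^-1` B.
have mE : measurable E by rewrite -[E]setTI; exact: mxi.
have PE : 0 <= fine (P E) by apply: fine_ge0.
pose m1 := mrestr P mE; pose m2 := mscale (NngNum PE) P.
have EP : (fine (P E))%:E = P E by rewrite fineK// fin_num_measure.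
have m2E A : m2 A = (P A * P E)%E by rewrite -EP muleC.
suff H : m1 C = m2 C by exact: (etrans H (m2E C)).
apply: (@g_sigma_algebra_measure_unique _ _ _ (past xi t) _ (fun=> setT)) => //.
- exact: past_measurable.
- move=> _; exists (fun=> setT) => //.
  by apply/seteqP; split => // x _ j _.
- by rewrite bigcup_const//; exists 0%N.
- exact: past_setI.
- move=> _ [A mA ->]; apply: etrans (esym (m2E _)); rewrite /m1 /mrestr /=.
  (* Prescribing B at coordinate t+1 makes the intersection a rectangle in the coordinates 0..t+1,
     to which the product formula applies. *)
  pose A' j := if (j <= t)%N then A j else B.
  have mA' j : measurable (A' j) by rewrite /A'; case: ifP.
  transitivity (P (\bigcap_(j in [set j | (j <= t.+1)%N]) xi j @^-1` A' j)).
    congr (P _); apply/seteqP; split => x.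
      move=> [H Ex] j /=; rewrite leq_eqVlt /A' => /predU1P[->|jt].
        by rewrite ltnn.
      by rewrite ltnS in jt; rewrite jt; exact: H.
    move=> H; split.
      move=> j /= jt.
      by have := H j; rewrite /= /A' jt; apply; rewrite leqW.
    by have := H t.+1; rewrite /= /A' ltnn; apply.
  rewrite !(proj2 indep)// big_nat_recr//= {2}/A' ltnn; congr (_ * _)%E.
  by apply: eq_big_nat => j; rewrite ltnS /A' => /andP[_ ->].
- by move=> _; rewrite /m1 /mrestr (le_lt_trans (probability_le1 _ _))// ?ltry//; exact: measurableI.
Qed.

End independence.

(** The joint law of (X, Z) is the product of the marginals, by uniqueness of product measures;
    Tonelli then gives integrability of the product and Fubini its expectation. *)
Lemma Ex_mul_indep {d} {T : measurableType d} {R : realType}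
    (P : probability T R) (X Z : T -> R) :
  (forall A B, measurable A -> measurable B ->
    P (X @^-1` A `&` Z @^-1` B) = (P (X @^-1` A) * P (Z @^-1` B))%E) ->
  L1 P X -> L1 P Z ->
  L1 P (fun x => X x * Z x) /\ Ex P (fun x => X x * Z x) = Ex P X * Ex P Z.
Proof.
move=> XZ iX iZ; have mX := L1_meas iX; have mZ := L1_meas iZ.
have mXZ : measurable_fun setT (fun x => (X x, Z x)) by exact: measurable_fun_pair.
pose X' : {RV P >-> R} := HB.pack X (isMeasurableFun.Build _ _ _ _ X mX).
pose Z' : {RV P >-> R} := HB.pack Z (isMeasurableFun.Build _ _ _ _ Z mZ).
pose W' : {RV P >-> (R * R)%type} :=
  HB.pack (fun x => (X x, Z x)) (isMeasurableFun.Build _ _ _ _ _ mXZ).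
pose mu := distribution P X'; pose nu := distribution P Z'.
pose f (z : R * R) := (z.1 * z.2)%:E.
have mf : measurable_fun setT f.
  by apply/measurable_EFinP; apply: measurable_funM; [exact: measurable_fst|exact: measurable_snd].
have law A : measurable A -> (mu \x nu)%E A = distribution P W' A.
  apply: product_measure_unique => B C mB mC.
  exact: XZ.
have mabs : measurable_fun setT (fun x : R => `|x|%:E).
  by apply/measurable_EFinP; exact: normr_measurable.
have Nf : (\int[mu \x nu]_z `|f z| =
    (\int[P]_x `|X x|%:E) * (\int[P]_x `|Z x|%:E))%E.
  rewrite fubini_tonelli1; last 2 first.
    exact: measurableT_comp.
    by move=> z; rewrite abse_ge0.
  under eq_integral => x _.
    rewrite /fubini_F /f/=; under eq_integral do rewrite normrM EFinM.
    rewrite ge0_integralZl//; over.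
  rewrite ge0_integralZr//; last exact: integral_ge0.
  by rewrite !ge0_integral_distribution.
have iXn : (\int[P]_x `|X x|%:E < +oo)%E by case/integrableP : iX.
have iZn : (\int[P]_x `|Z x|%:E < +oo)%E by case/integrableP : iZ.
have if_ : (mu \x nu)%E.-integrable setT f.
  apply/integrableP; split => //; rewrite Nf.
  by rewrite lte_mul_pinfty// ?integral_ge0// ge0_fin_numE// integral_ge0.
have ifW : (distribution P W').-integrable setT f.
  apply/integrableP; split => //; case/integrableP : if_ => _.
  by rewrite (@eq_measure_integral _ _ _ _ (distribution P W'))// => A mA _; exact: law.
have iXZ : L1 P (fun x => X x * Z x).
  apply/integrableP; split; first exact/measurable_EFinP/measurable_funM.
  case/integrableP : ifW => _; rewrite ge0_integral_distribution//.
  exact: measurableT_comp.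
split => //.
have idmu : mu.-integrable setT EFin.
  apply/integrableP; split; first exact/measurable_EFinP.
  by rewrite ge0_integral_distribution.
have idnu : nu.-integrable setT EFin.
  apply/integrableP; split; first exact/measurable_EFinP.
  by rewrite ge0_integral_distribution.
rewrite /Ex /Rintegral -fineM ?integrable_fin_num//; congr fine.
transitivity (\int[distribution P W']_z f z)%E.
  by rewrite integral_distribution//.
rewrite (@eq_measure_integral _ _ _ _ (mu \x nu)%E); last first.
  by move=> A mA _; apply/esym; exact: law.
rewrite -integral12_prod_meas1//.
transitivity (\int[mu]_x (x%:E * \int[nu]_y y%:E))%E.
  by apply: eq_integral => x _; rewrite -integralZl.
rewrite /= -(fineK (integrable_fin_num measurableT idnu)) integralZr//.
rewrite (fineK (integrable_fin_num measurableT idnu)).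
by rewrite !integral_distribution.
Qed.

Section adapted_product.
Context {d : measure_display} {T : measurableType d} {R : realType}
  (P : probability T R) (xi : nat -> T -> R).
Hypothesis indep : indep_seq P xi.

(** This stands in for conditioning on the past: all later arguments use independence through this
    factorisation. *)
Lemma adapted_mul_indep t X (h : R -> R) : adapted xi t X -> measurable_fun setT h ->
  L1 P X -> L1 P (h \o xi t.+1) ->
  L1 P (fun x => X x * h (xi t.+1 x)) /\
  Ex P (fun x => X x * h (xi t.+1 x)) = Ex P X * Ex P (h \o xi t.+1).
Proof.
move=> aX mh iX ih; apply: (Ex_mul_indep (Z := h \o xi t.+1)) => // A B mA mB.
have mhB : measurable (h @^-1` B) by rewrite -[X in measurable X]setTI; exact: mh.
rewrite comp_preimage; apply: past_indep => //.
by have := aX measurableT A mA; rewrite setTI.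
Qed.

End adapted_product.

(** * One step of the recursion *)

Section gauss_taylor.
Context {R : realType}.

Lemma mean_value_bound (g g' : R -> R) (K s : R) :
  (forall x : R, is_derive x 1 g (g' x)) ->
  0 <= s <= 1 -> (forall x, 0 <= x <= s -> `|g' x| <= K) ->
  `|g s - g 0| <= K.
Proof.
move=> dg /andP[s0 s1] bg.
have K0 : 0 <= K by apply: le_trans (bg 0 _) => //; rewrite lexx s0.
have [->|sn0] := eqVneq s 0; first by rewrite subrr normr0.
have s_gt0 : 0 < s by rewrite lt_def sn0.
have cg : {within `[0, s], continuous g}.
  apply: continuous_subspaceT => x; apply: differentiable_continuous.
  by apply/derivable1_diffP; case: (dg x).
have [c c0s ->] := MVT s_gt0 (fun x _ => dg x) cg.
rewrite in_itv /= in c0s; case/andP: c0s => c0 cs.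
rewrite subr0 normrM (ger0_norm s0) -[leRHS]mulr1 ler_pM// bg//.
by rewrite !ltW.
Qed.

Lemma is_derive_affine (f f' : R -> R) (x h t : R) :
  (forall x : R, is_derive x 1 f (f' x)) ->
  is_derive t 1 (fun s => f (x + s * h)) (f' (x + t * h) * h).
Proof.
move=> df; apply: is_derive1_comp.
by apply: is_derive_eq; rewrite /GRing.scale /=; ring.
Qed.

(** The mean value bound is used three times along the segment s -> x + s h, s in [0, 1]; no factor
    1/k is gained on the way, whence C instead of C / 6. *)
Lemma taylor2_bound (f f1 f2 f3 : R -> R) (C : R) :
  (forall x : R, is_derive x 1 f (f1 x)) ->
  (forall x : R, is_derive x 1 f1 (f2 x)) ->
  (forall x : R, is_derive x 1 f2 (f3 x)) ->
  (forall x, `|f3 x| <= C) -> forall x h,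
  `|f (x + h) - f x - f1 x * h - f2 x * h ^+ 2 / 2| <= C * `|h| ^+ 3.
Proof.
move=> d0 d1 d2 bC x h.
have B2 s : 0 <= s <= 1 -> `|h * (f2 (x + s * h) - f2 x)| <= C * `|h| ^+ 2.
  move=> s01; have := @mean_value_bound (fun s => h * f2 (x + s * h))
    (fun s => h * (f3 (x + s * h) * h)) (C * `|h| ^+ 2) s _ s01 _.
  rewrite mul0r addr0 mulrBr; apply.
    move=> t; apply: is_deriveZ => /=.
    exact: is_derive_affine.
  move=> t _; rewrite !normrM mulrCA -expr2 ler_wpM2r// sqr_ge0//.
have B1 s : 0 <= s <= 1 ->
    `|h * (f1 (x + s * h) - f1 x - f2 x * (s * h))| <= C * `|h| ^+ 3.
  move=> s01.
  pose G s := h * (f1 (x + s * h) - f2 x * (s * h)).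
  have -> : h * (f1 (x + s * h) - f1 x - f2 x * (s * h)) = G s - G 0.
    by rewrite /G mul0r addr0 mulr0 subr0 -mulrBr; congr (_ * _); rewrite addrAC.
  apply: (@mean_value_bound G (fun s => h * (h * (f2 (x + s * h) - f2 x)))) => //.
    move=> t; apply: is_deriveZ => /=.
    have -> : h * (f2 (x + t * h) - f2 x) = f2 (x + t * h) * h - f2 x * h.
      by ring.
    apply: is_deriveB.
      exact: is_derive_affine.
    apply: is_derive_eq.
    by rewrite /GRing.scale /=; ring.
  move=> t /andP[t0 ts]; rewrite normrM exprS mulrCA ler_wpM2l//.
  by apply: B2; rewrite t0 (le_trans ts)//; case/andP: s01.
pose G s := f (x + s * h) - f1 x * (s * h) - f2 x * (s * h) ^+ 2 / 2.
have -> : f (x + h) - f x - f1 x * h - f2 x * h ^+ 2 / 2 = G 1 - G 0.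
  by rewrite /G !mul1r !mul0r addr0 expr0n /= mulr0 !mulr0 mul0r !subr0; ring.
apply: (@mean_value_bound G
  (fun s => h * (f1 (x + s * h) - f1 x - f2 x * (s * h)))); last 2 first.
- by rewrite ler01 lexx.
- by move=> t ?; exact: B1.
move=> t; rewrite /G.
have -> : h * (f1 (x + t * h) - f1 x - f2 x * (t * h)) =
   (f1 (x + t * h) * h - f1 x * h) - (f2 x * (2 * (t * h) * h)) / 2.
  by field.
apply: is_deriveB.
  apply: is_deriveB.
    exact: is_derive_affine.
  apply: is_derive_eq.
  by rewrite /GRing.scale /=; ring.
apply: is_derive_eq.
by rewrite /GRing.scale /=; ring.
Qed.

Lemma sqr_expRN_le (x : R) : 0 <= x -> x * expR (- x) <= 1.
Proof.
move=> x0; rewrite expRN ler_pdivrMr ?expR_gt0// mul1r.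
by apply: le_trans (expR_ge1Dx x); rewrite lerDr.
Qed.

Lemma sqr2_expRN_le (x : R) : 0 <= x -> x ^+ 2 * expR (- x) <= 4.
Proof.
move=> x0; have x20 : 0 <= x / 2 by rewrite divr_ge0.
have := sqr_expRN_le x20; set e := expR (- (x / 2)) => xe.
have e0 : 0 <= e by exact: expR_ge0.
have -> : expR (- x) = e ^+ 2.
  by rewrite /e -expRM_natl; congr expR; field.
have -> : x ^+ 2 * e ^+ 2 = 4 * (x / 2 * e) ^+ 2 by field.
rewrite -[leRHS]mulr1 ler_wpM2l// expr_le1//.
exact: mulr_ge0.
Qed.

(** The remainder is cubic for small h and quadratic for large h, so that its mean is controlled by
    a second moment and Lindeberg's condition. The constant is the bound of the third derivative: 6
    + 10 + 4 * 4, from x^2 exp (- x^2) <= 1 and x^4 exp (- x^2) <= 4. *)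
Lemma gauss_expand (z h : R) :
  `|expR (- (z + h) ^+ 2) - expR (- z ^+ 2) * (1 - 2 * z * h + (2 * z ^+ 2 - 1) * h ^+ 2)|
  <= 32 * (h ^+ 2 * Num.min 1 `|h|).
Proof.
pose f (x : R) := expR (- x ^+ 2).
pose f1 x := - (2 * x) * f x.
pose f2 x := (4 * x ^+ 2 - 2) * f x.
pose f3 x := (12 * x - 8 * x ^+ 3) * f x.
have f0 x : 0 <= f x by exact: expR_ge0.
have f1le x : f x <= 1 by rewrite /f -[leRHS]expR0 ler_expR oppr_le0 sqr_ge0.
have b2 x : x ^+ 2 * f x <= 1 by apply: sqr_expRN_le; exact: sqr_ge0.
have b4 x : (x ^+ 2) ^+ 2 * f x <= 4 by apply: sqr2_expRN_le; exact: sqr_ge0.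
have d0 (x : R) : is_derive x 1 f (f1 x).
  rewrite /f1 mulrC; apply: is_derive1_comp.
  by apply: is_derive_eq; rewrite /GRing.scale /=; ring.
have d1 (x : R) : is_derive x 1 f1 (f2 x).
  have -> : f2 x = - (2 * x) * f1 x + f x * (- 2) by rewrite /f2 /f1; ring.
  apply: is_deriveM.
  by apply: is_derive_eq; rewrite /GRing.scale /=; ring.
have d2 (x : R) : is_derive x 1 f2 (f3 x).
  have -> : f3 x = (4 * x ^+ 2 - 2) * f1 x + f x * (8 * x) by rewrite /f3 /f1; ring.
  apply: is_deriveM.
  by apply: is_derive_eq; rewrite /GRing.scale /=; ring.
have b3 x : `|f3 x| <= 32.
  rewrite /f3 normrM (ger0_norm (f0 x)).
  have : `|12 * x - 8 * x ^+ 3| <= 6 + 10 * x ^+ 2 + 4 * (x ^+ 2) ^+ 2.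
    have := sqr_ge0 (x - 1); have := sqr_ge0 (x + 1).
    have := sqr_ge0 (x * (x - 1)); have := sqr_ge0 (x * (x + 1)).
    by rewrite ler_norml => *; apply/andP; split; nra.
  move=> /(ler_wpM2r (f0 x))/le_trans; apply.
  have := f1le x; have := b2 x; have := b4 x; have := f0 x.
  by rewrite !mulrDl; lra.
have T := taylor2_bound d0 d1 d2 b3 z h.
have -> : expR (- (z + h) ^+ 2) - expR (- z ^+ 2) * (1 - 2 * z * h + (2 * z ^+ 2 - 1) * h ^+ 2)
  = f (z + h) - f z - f1 z * h - f2 z * h ^+ 2 / 2 by rewrite /f2 /f1 /f; field.
have [h1|h1] := leP 1 `|h|; last first.
  have -> // : h ^+ 2 * `|h| = `|h| ^+ 3.
  by rewrite -(real_normK (num_real h)); ring.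
rewrite mulr1.
have h2 : 1 <= h ^+ 2 by rewrite -(real_normK (num_real h)) expr_ge1.
have hh : `|h| <= h ^+ 2.
  by rewrite -(real_normK (num_real h)) expr2 ler_peMl.
have zf : `|f1 z| <= 2.
  rewrite /f1 normrM normrN (ger0_norm (f0 z)).
  have : `|2 * z| <= 1 + z ^+ 2.
    have := sqr_ge0 (z - 1); have := sqr_ge0 (z + 1).
    by rewrite ler_norml => *; apply/andP; split; nra.
  move=> /(ler_wpM2r (f0 z))/le_trans; apply.
  by have := f1le z; have := b2 z; rewrite mulrDl; lra.
have zf2 : `|f2 z| <= 6.
  rewrite /f2 normrM (ger0_norm (f0 z)).
  have : `|4 * z ^+ 2 - 2| <= 2 + 4 * z ^+ 2.
    by have := sqr_ge0 z; rewrite ler_norml => *; apply/andP; split; lra.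
  move=> /(ler_wpM2r (f0 z))/le_trans; apply.
  by have := f1le z; have := b2 z; rewrite mulrDl; lra.
have zfh : `|f1 z * h| <= 2 * h ^+ 2 by rewrite normrM ler_pM.
have zf2h : `|f2 z * h ^+ 2| <= 6 * h ^+ 2.
  by rewrite normrM (ger0_norm (sqr_ge0 h)) ler_wpM2r// sqr_ge0.
have := f0 z; have := f0 (z + h); have := f1le z; have := f1le (z + h).
move: zfh zf2h; rewrite !ler_norml => /andP[? ?] /andP[? ?] *.
by apply/andP; split; lra.
Qed.

(** This is [gauss_expand] at z = sqrt a * g and h = sqrt a * e; sqrt a <= A because A >= 1. *)
Lemma step_expand (a A g e : R) : 0 <= a <= A -> 1 <= A ->
  `|expR (- (a * (g + e) ^+ 2)) -
    expR (- (a * g ^+ 2)) * (1 - 2 * a * g * e + (2 * a ^+ 2 * g ^+ 2 - a) * e ^+ 2)|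
  <= 32 * A ^+ 2 * (e ^+ 2 * Num.min 1 `|e|).
Proof.
move=> /andP[a0 aA] A1; have s2 : Num.sqrt a ^+ 2 = a by rewrite sqr_sqrtr.
set s := Num.sqrt a in s2 *; have s0 : 0 <= s by exact: sqrtr_ge0.
have sA : s <= A.
  rewrite -(@ler_pXn2r _ 2)// ?nnegrE//; last exact: le_trans A1.
  rewrite s2 (le_trans aA)// expr2 ler_peMl// (le_trans _ A1)//.
have := gauss_expand (s * g) (s * e).
have -> : (s * g + s * e) ^+ 2 = a * (g + e) ^+ 2 by rewrite -s2; ring.
have -> : (s * g) ^+ 2 = a * g ^+ 2 by rewrite -s2; ring.
have -> : 1 - 2 * (s * g) * (s * e) + (2 * (a * g ^+ 2) - 1) * (s * e) ^+ 2 =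
  1 - 2 * a * g * e + (2 * a ^+ 2 * g ^+ 2 - a) * e ^+ 2 by rewrite -s2; ring.
move=> /le_trans; apply; rewrite -mulrA ler_wpM2l//.
have -> : (s * e) ^+ 2 = a * e ^+ 2 by rewrite -s2; ring.
have -> : A ^+ 2 * (e ^+ 2 * Num.min 1 `|e|) = (A * e ^+ 2) * (A * Num.min 1 `|e|) by ring.
have m0 (x : R) : 0 <= Num.min 1 `|x| by rewrite le_min ler01 normr_ge0.
have A0 : 0 <= A by exact: le_trans A1.
apply: ler_pM => //.
- by rewrite mulr_ge0 ?sqr_ge0.
- by rewrite ler_wpM2r// sqr_ge0.
rewrite normrM (ger0_norm s0).
have [h1|h1] := leP 1 `|e|; first by rewrite mulr1 ge_min A1.
by rewrite ge_min ler_wpM2r ?orbT.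
Qed.

(** With x = a g^2, the averaged second-order expansion is turned back into an exponential,
    uniformly in x: as 4 A <= N, the factor exp (2 a x / N) is at most exp (x / 2), which exp (- x)
    absorbs. The constant is 2 + 4 * 16, where x^2 exp (- x / 2) <= 16. *)
Lemma drift_expand (a A x N : R) : 0 <= a <= A -> 1 <= A -> 4 * A <= N -> 0 <= x ->
  `|expR (- x) * (1 - a / N + 2 * a / N * x) -
    (1 - a / N) * expR (- (x - 2 * a / N * x))| <= 66 * A ^+ 2 / N ^+ 2.
Proof.
move=> /andP[a0 aA] A1 AN x0.
have N0 : 0 < N by lra.
set k := 2 * a / N; set b := a / N.
have b0 : 0 <= b by rewrite divr_ge0// ltW.
have bA : b <= A / N by rewrite ler_pM2r// invr_gt0.
have AN4 : A / N <= 1 / 4 by rewrite ler_pdivrMr//; lra.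
have kb : k = 2 * b by rewrite /k /b mulrA.
set u := k * x; have u0 : 0 <= u by rewrite mulr_ge0// kb; lra.
have -> : expR (- (x - u)) = expR (- x) * expR u by rewrite -expRD; congr expR; ring.
have e1 : expR u - 1 <= u * expR u.
  have := expR_ge1Dx (- u); rewrite expRN => /(ler_wpM2r (expR_ge0 u)).
  by rewrite mulVf ?gt_eqF ?expR_gt0//; lra.
have e2 : 0 <= expR u - 1 - u <= u ^+ 2 * expR u.
  have := expR_ge1Dx u; move=> ?; apply/andP; split; first lra.
  by have := ler_wpM2l u0 e1; rewrite mulrBr mulr1 expr2; nra.
have e3 : x ^+ 2 * (expR (- x) * expR u) <= 16.
  have x20 : 0 <= x / 2 by lra.
  have := sqr2_expRN_le x20.
  have : expR (- x) * expR u <= expR (- (x / 2)).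
    by rewrite -expRD ler_expR /u kb; nra.
  move=> /(ler_wpM2l (sqr_ge0 x)) h1 h2; apply: le_trans h1 _.
  by rewrite expr_div_n in h2; lra.
have e4 : x * expR (- x) <= 1 by exact: sqr_expRN_le.
have e0 := expR_ge0 (- x).
have -> : expR (- x) * (1 - b + u) - (1 - b) * (expR (- x) * expR u) =
  b * k * (x * expR (- x)) - (1 - b) * (expR (- x) * (expR u - 1 - u)) by rewrite /u; ring.
have t1 : 0 <= b * k * (x * expR (- x)) <= 2 * (A / N) ^+ 2.
  have bb : 0 <= b * (2 * b) by apply: mulr_ge0 => //; lra.
  rewrite kb; apply/andP; split.
    by apply: mulr_ge0 => //; exact: mulr_ge0.
  apply: le_trans (_ : b * (2 * b) * 1 <= _).
    by rewrite ler_wpM2l.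
  by rewrite mulr1; nra.
have t2 : 0 <= (1 - b) * (expR (- x) * (expR u - 1 - u)) <= 64 * (A / N) ^+ 2.
  case/andP: e2 => e20 e21.
  have q0 : 0 <= expR (- x) * (expR u - 1 - u) by rewrite mulr_ge0.
  apply/andP; split; first by rewrite mulr_ge0//; lra.
  apply: le_trans (_ : expR (- x) * (expR u - 1 - u) <= _).
    by rewrite ler_piMl//; lra.
  apply: le_trans (ler_wpM2l e0 e21) _.
  have -> : expR (- x) * (u ^+ 2 * expR u) = k ^+ 2 * (x ^+ 2 * (expR (- x) * expR u)).
    by rewrite /u; ring.
  apply: le_trans (_ : k ^+ 2 * 16 <= _); first by rewrite ler_wpM2l// sqr_ge0.
  by rewrite kb; nra.
have -> : 66 * A ^+ 2 / N ^+ 2 = 66 * (A / N) ^+ 2 by field; rewrite gt_eqF.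
move: t1 t2 => /andP[? ?] /andP[? ?]; rewrite ler_norml; apply/andP; split; lra.
Qed.

Lemma expRN_lip (p q : R) : 0 <= p -> 0 <= q -> `|expR (- p) - expR (- q)| <= `|p - q|.
Proof.
have wl (s t : R) : 0 <= s -> s <= t -> `|expR (- s) - expR (- t)| <= `|s - t|.
  move=> s0 st; have e : expR (- t) <= expR (- s) by rewrite ler_expR lerN2.
  rewrite ger0_norm ?subr_ge0// distrC ger0_norm ?subr_ge0//.
  have -> : expR (- t) = expR (- s) * expR (- (t - s)).
    by rewrite -expRD; congr expR; ring.
  have := expR_ge1Dx (- (t - s)); have := expR_gt0 (- s).
  have : expR (- s) <= 1 by rewrite -[leRHS]expR0 ler_expR oppr_le0.
  have := expR_ge0 (- (t - s)); nra.
move=> p0 q0; have [pq|/ltW qp] := leP p q; first exact: wl.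
by rewrite distrC (distrC p); exact: wl.
Qed.

End gauss_taylor.

(** * The Riccati recursion for the Laplace functional *)

(** Euler scheme of step 1 / N for the Riccati equation a' = mu - 2 a^2 with a(0) = lam; k counts
    the innovations already integrated out, so it runs against the time of the chain. *)
Definition ric {R : realType} (lam mu N : R) (k : nat) : R :=
  iter k (fun a => a + (mu - 2 * a ^+ 2) / N) lam.

(** The constant A is a supersolution because mu <= 2 A^2, and 4 A <= N makes the Euler step
    monotone: A - a is multiplied by at least 1 - 2 (A + a) / N >= 0. *)
Lemma ric_bound {R : realType} (lam mu N A : R) k : 0 <= lam <= A -> 0 <= mu ->
  mu <= 2 * A ^+ 2 -> 0 < N -> 4 * A <= N -> 0 <= ric lam mu N k <= A.
Proof.
move=> lamA mu0 muA N0 AN; elim: k => [//|k /= /andP[]].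
rewrite -/(ric lam mu N k); set a := ric _ _ _ _ => a0 aA.
have i0 : 0 < N^-1 by rewrite invr_gt0.
have aN : a / N <= 1 / 4 by rewrite ler_pdivrMr//; lra.
have AN' : A / N <= 1 / 4 by rewrite ler_pdivrMr//; lra.
have muN : 0 <= mu / N by rewrite divr_ge0// ltW.
have muAN : mu / N <= 2 * A * (A / N).
  by rewrite mulrA ler_pM2r//; apply: le_trans muA _; rewrite expr2 mulrA.
have -> : (mu - 2 * a ^+ 2) / N = mu / N - 2 * a * (a / N) by ring.
have aAN : a / N <= A / N by rewrite ler_pM2r.
have aN0 : 0 <= a / N by rewrite divr_ge0// ltW.
apply/andP; split; first by nra.
have -> : A = a + (A - a) by ring.
rewrite lerD2l; apply: le_trans (_ : 2 * A * (A / N) - 2 * a * (a / N) <= _).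
  by rewrite lerD2r.
have -> : 2 * A * (A / N) - 2 * a * (a / N) = 2 * (A - a) * (A / N + a / N) by ring.
by nra.
Qed.

Lemma adapted_sum {d} {T : measurableType d} {R : realType} (xi : nat -> T -> R)
    j k (X : nat -> T -> R) : (forall i, (i < k)%N -> adapted xi j (X i)) ->
  adapted xi j (fun x => \sum_(0 <= i < k) X i x).
Proof.
elim: k => [_|k ih aX]; rewrite /adapted.
  by under eq_fun do rewrite big_nil; exact: measurable_cst.
under eq_fun do rewrite big_nat_recr//=.
apply: measurable_funD; last exact: aX.
by apply: ih => i ik; apply: aX; exact: ltnW.
Qed.

Section riccati.
Context {d : measure_display} {T : measurableType d} {R : realType}
  (P : probability T R) (xi : nat -> T -> R) (g : R -> R) (y : nat -> T -> R).
Hypothesis indep : indep_seq P xi.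
Hypothesis mg : measurable_fun setT g.
Hypothesis y0E : adapted xi 0 (y 0%N).
Hypothesis ySE : forall j x, y j.+1 x = g (y j x) + xi j.+1 x.

Lemma adapted_chain j : adapted xi j (y j).
Proof.
elim: j => [//|j ih]; rewrite /adapted (_ : y j.+1 = fun x => g (y j x) + xi j.+1 x); last first.
  by apply/funext => x.
apply: measurable_funD; last exact: adapted_xi.
by apply: (measurableT_comp mg); exact: (adapted_le _ ih).
Qed.

(** Three replacements give the three errors: Taylor expansion in the innovation ([F1] by [F2]),
    return to an exponential ([F2] by [F3]), and g(y)^2 by y^2 ([F3] by [F4]). The weight [W] holds
    what is known at time j and will be the exponential of the accumulated energy. *)
Lemma riccati_step j (A a N kappa : R) (W : T -> R) :
  0 <= a <= A -> 1 <= A -> 4 * A <= N ->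
  adapted xi j W -> (forall x, 0 <= W x <= 1) ->
  L1 P (fun x => xi j.+1 x ^+ 2) -> Ex P (xi j.+1) = 0 ->
  Ex P (fun x => xi j.+1 x ^+ 2) = N^-1 ->
  Ex P (fun x => xi j.+1 x ^+ 2 * Num.min 1 `|xi j.+1 x|) <= kappa ->
  L1 P (fun x => `|g (y j x) ^+ 2 - y j x ^+ 2|) ->
  `|Ex P (fun x => W x * expR (- (a * y j.+1 x ^+ 2))) -
    (1 - a / N) * Ex P (fun x => W x * expR (- ((a - 2 * a ^+ 2 / N) * y j x ^+ 2)))|
  <= 32 * A ^+ 2 * kappa + 66 * A ^+ 2 / N ^+ 2 +
     A * Ex P (fun x => `|g (y j x) ^+ 2 - y j x ^+ 2|).
Proof.
move=> /andP[a0 aA] A1 AN aW W01 iE2 E0 E2 Ek iD.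
have N0 : 0 < N by lra.
have W0 x : 0 <= W x by case/andP: (W01 x).
have W1 x : W x <= 1 by case/andP: (W01 x).
pose G x := g (y j x); pose e x := xi j.+1 x.
have aG : adapted xi j G by apply: (measurableT_comp mg); exact: adapted_chain.
have mG := adapted_measurable indep aG.
have mW := adapted_measurable indep aW.
have me : measurable_fun setT e by exact: (proj1 indep).
have my i := adapted_measurable indep (@adapted_chain i).
have iE : L1 P e by exact: L2_L1.
pose p x := expR (- (a * G x ^+ 2)).
have p0 x : 0 <= p x by exact: expR_ge0.
have p1 x : p x <= 1 by rewrite /p -[leRHS]expR0 ler_expR oppr_le0 mulr_ge0// sqr_ge0.
have bp x : a * G x ^+ 2 * p x <= 1 by apply: sqr_expRN_le; rewrite mulr_ge0// sqr_ge0.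
have ap : adapted xi j p.
  apply: measurableT_comp => //; apply: measurable_funN; apply: measurable_funM => //.
  exact: measurable_funX.
(* Coefficients of 1, e and e^2 in the expansion, known at time j. The Gaussian factor [p] dominates
   the powers of G that occur, so they are bounded whatever the moments of the chain. *)
pose K1 x := W x * p x.
pose K2 x := W x * p x * (- (2 * a * G x)).
pose K3 x := W x * p x * (2 * a ^+ 2 * G x ^+ 2 - a).
have aK1 : adapted xi j K1 by exact: measurable_funM.
have aK2 : adapted xi j K2.
  apply: measurable_funM => //; apply: measurable_funN; exact: measurable_funM.
have aK3 : adapted xi j K3.
  apply: measurable_funM => //; apply: measurable_funB => //.
  by apply: measurable_funM => //; exact: measurable_funX.
have wb (w q c : R) : 0 <= w <= 1 -> `|q| <= c -> `|w * q| <= c.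
  move=> /andP[w0 w1] qc; rewrite normrM (ger0_norm w0) -[leRHS]mul1r.
  by rewrite ler_pM.
have iK1 : L1 P K1.
  apply: (L1_bnd P (M := 1)); first exact: (adapted_measurable indep) aK1.
  by move=> x; apply: wb => //; rewrite ger0_norm.
have iK2 : L1 P K2.
  apply: (L1_bnd P (M := A + 1)); first exact: (adapted_measurable indep) aK2.
  move=> x; rewrite /K2 -mulrA; apply: wb => //.
  rewrite normrM (ger0_norm (p0 x)) normrN.
  have : `|2 * a * G x| <= a + a * G x ^+ 2.
    rewrite ler_norml; have := mulr_ge0 a0 (sqr_ge0 (G x - 1)).
    by have := mulr_ge0 a0 (sqr_ge0 (G x + 1)) => *; apply/andP; split; nra.
  move=> /(ler_wpM2l (p0 x))/le_trans; apply; rewrite mulrDr (mulrC (p x) (a * _)).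
  by rewrite lerD// -[leRHS]mul1r ler_pM.
have iK3 : L1 P K3.
  apply: (L1_bnd P (M := A * 2 + A)); first exact: (adapted_measurable indep) aK3.
  move=> x; rewrite /K3 -mulrA; apply: wb => //.
  rewrite normrM (ger0_norm (p0 x)).
  have : `|2 * a ^+ 2 * G x ^+ 2 - a| <= a * 2 * (a * G x ^+ 2) + a.
    have := mulr_ge0 a0 (mulr_ge0 a0 (sqr_ge0 (G x))).
    by rewrite ler_norml => *; apply/andP; split; nra.
  move=> /(ler_wpM2l (p0 x))/le_trans; apply; rewrite mulrDr.
  have -> : p x * (a * 2 * (a * G x ^+ 2)) = a * 2 * (a * G x ^+ 2 * p x) by ring.
  rewrite lerD//.
    by have := bp x; move: (a * G x ^+ 2 * p x) => t t1; nra.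
  by rewrite -[leRHS]mul1r ler_pM.
have [i2 e2] := adapted_mul_indep indep aK2 (h := id) (@measurable_id _ _ _) iK2 iE.
have mX2 : measurable_fun setT (fun x : R => x ^+ 2) by exact: exprn_measurable.
have [i3 e3] := adapted_mul_indep indep aK3 mX2 iK3 iE2.
rewrite /= in i2 e2 i3 e3.
rewrite (_ : Ex P (id \o xi j.+1) = 0) ?mulr0 in e2 => //.
rewrite (_ : Ex P ((fun x => x ^+ 2) \o xi j.+1) = N^-1) in e3 => //.
pose F1 x := W x * expR (- (a * (G x + e x) ^+ 2)).
have yE : (fun x => W x * expR (- (a * y j.+1 x ^+ 2))) = F1.
  by apply/funext => x; rewrite /F1 ySE.
pose F2 x := K1 x + K2 x * e x + K3 x * e x ^+ 2.
have iF2 : L1 P F2 by apply: L1D => //; exact: L1D.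
(* The linear term vanishes because the innovation is centred, and the quadratic one picks up the
   variance 1 / N. *)
have EF2 : Ex P F2 = Ex P K1 + Ex P K3 / N.
  by rewrite /F2 ExD//; [rewrite ExD// e2 e3 addr0|exact: L1D].
have iF1 : L1 P F1.
  apply: (L1_bnd P (M := 1)).
    apply: measurable_funM => //; apply: measurableT_comp => //.
    apply: measurable_funN; apply: measurable_funM => //.
    by apply: measurable_funX; exact: measurable_funD.
  move=> x; apply: wb => //; rewrite ger0_norm ?expR_ge0//.
  by rewrite -[leRHS]expR0 ler_expR oppr_le0 mulr_ge0// sqr_ge0.
pose m x := e x ^+ 2 * Num.min 1 `|e x|.
have m0 x : 0 <= m x by rewrite mulr_ge0 ?sqr_ge0// le_min ler01 normr_ge0.
have im : L1 P m.
  apply: (L1_le _ _ iE2).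
    apply: measurable_funM; first exact: measurable_funX.
    by apply: measurable_minr => //; exact: measurableT_comp.
  by move=> x; rewrite ger0_norm// -[leRHS]mulr1 ler_wpM2l ?sqr_ge0// ge_min lexx.
have B1 : `|Ex P F1 - Ex P F2| <= 32 * A ^+ 2 * kappa.
  rewrite -ExB//; apply: le_trans (Ex_norm (L1B iF1 iF2)) _.
  apply: le_trans (_ : 32 * A ^+ 2 * Ex P m <= _); last first.
    by rewrite ler_wpM2l// mulr_ge0// sqr_ge0.
  rewrite -ExZ//; apply: Ex_le; [by apply: L1_norm; exact: L1B|exact: L1Z|].
  move=> x; rewrite /F1 /F2 /K1 /K2 /K3.
  have -> : W x * expR (- (a * (G x + e x) ^+ 2)) -
     (W x * p x + W x * p x * - (2 * a * G x) * e x +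
      W x * p x * (2 * a ^+ 2 * G x ^+ 2 - a) * e x ^+ 2) =
     W x * (expR (- (a * (G x + e x) ^+ 2)) -
       p x * (1 - 2 * a * G x * e x + (2 * a ^+ 2 * G x ^+ 2 - a) * e x ^+ 2)) by ring.
  by apply: wb => //; apply: step_expand => //; rewrite a0.
pose F3 x := W x * expR (- ((a - 2 * a ^+ 2 / N) * G x ^+ 2)).
pose F4 x := W x * expR (- ((a - 2 * a ^+ 2 / N) * y j x ^+ 2)).
have c0 : 0 <= a - 2 * a ^+ 2 / N.
  have : a / N <= 1 / 4 by rewrite ler_pdivrMr//; lra.
  have -> : 2 * a ^+ 2 / N = 2 * a * (a / N) by ring.
  by nra.
have cA : a - 2 * a ^+ 2 / N <= A.
  have : 0 <= 2 * a ^+ 2 / N by rewrite divr_ge0 ?(ltW N0)// mulr_ge0// sqr_ge0.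
  by lra.
have iF3 : L1 P F3.
  apply: (L1_bnd P (M := 1)).
    apply: measurable_funM => //; apply: measurableT_comp => //.
    apply: measurable_funN; apply: measurable_funM => //.
    exact: measurable_funX.
  move=> x; apply: wb => //; rewrite ger0_norm ?expR_ge0//.
  by rewrite -[leRHS]expR0 ler_expR oppr_le0 mulr_ge0// sqr_ge0.
have iF4 : L1 P F4.
  apply: (L1_bnd P (M := 1)).
    apply: measurable_funM => //; apply: measurableT_comp => //.
    apply: measurable_funN; apply: measurable_funM => //.
    exact: measurable_funX.
  move=> x; apply: wb => //; rewrite ger0_norm ?expR_ge0//.
  by rewrite -[leRHS]expR0 ler_expR oppr_le0 mulr_ge0// sqr_ge0.
have B2 : `|Ex P F2 - (1 - a / N) * Ex P F3| <= 66 * A ^+ 2 / N ^+ 2.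
  have -> : Ex P F2 - (1 - a / N) * Ex P F3 =
      Ex P (fun x => K1 x + N^-1 * K3 x - (1 - a / N) * F3 x).
    rewrite EF2 (ExB (L1D iK1 (L1Z N^-1 iK3)) (L1Z (1 - a / N) iF3)).
    by rewrite (ExD iK1 (L1Z N^-1 iK3)) !ExZ// (mulrC _ N^-1).
  apply: Ex_bnd; first by apply: L1B; [apply: L1D => //; exact: L1Z|exact: L1Z].
  move=> x; rewrite /K1 /K3 /F3.
  have -> : W x * p x + N^-1 * (W x * p x * (2 * a ^+ 2 * G x ^+ 2 - a)) -
     (1 - a / N) * (W x * expR (- ((a - 2 * a ^+ 2 / N) * G x ^+ 2))) =
     W x * (p x * (1 - a / N + 2 * a / N * (a * G x ^+ 2)) -
       (1 - a / N) * expR (- (a * G x ^+ 2 - 2 * a / N * (a * G x ^+ 2)))).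
    have -> : (a - 2 * a ^+ 2 / N) * G x ^+ 2 = a * G x ^+ 2 - 2 * a / N * (a * G x ^+ 2).
      by ring.
    by ring.
  apply: wb => //; apply: drift_expand => //; first by rewrite a0.
  by rewrite mulr_ge0// sqr_ge0.
have q01 : 0 <= 1 - a / N <= 1.
  have : a / N <= 1 / 4 by rewrite ler_pdivrMr//; lra.
  have : 0 <= a / N by rewrite divr_ge0// ltW.
  by move=> *; apply/andP; split; lra.
have B3 : `|(1 - a / N) * Ex P F3 - (1 - a / N) * Ex P F4| <=
    A * Ex P (fun x => `|g (y j x) ^+ 2 - y j x ^+ 2|).
  rewrite -mulrBr -ExB//; apply: (wb) => //.
  apply: le_trans (Ex_norm (L1B iF3 iF4)) _; rewrite -ExZ//.
  apply: Ex_le; [by apply: L1_norm; exact: L1B|exact: L1Z|].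
  move=> x; rewrite /F3 /F4 -mulrBr; apply: wb => //.
  apply: le_trans (expRN_lip (mulr_ge0 c0 (sqr_ge0 _)) (mulr_ge0 c0 (sqr_ge0 _))) _.
  by rewrite -mulrBr normrM (ger0_norm c0) ler_wpM2r.
rewrite yE -/F4.
have -> : Ex P F1 - (1 - a / N) * Ex P F4 = (Ex P F1 - Ex P F2) +
  (Ex P F2 - (1 - a / N) * Ex P F3) +
  ((1 - a / N) * Ex P F3 - (1 - a / N) * Ex P F4) by ring.
by rewrite (le_trans (ler_normD _ _))// lerD// (le_trans (ler_normD _ _))// lerD.
Qed.

(** Innovations are removed from the last one backwards. The factors 1 - a_k / n lie in [0, 1], so
    the n one-step errors simply add up, which yields n * kappa and 66 A^2 / n. The term in y_0^2 is
    the cost of replacing the fully reduced functional by 1. *)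
Lemma laplace_riccati (lam mu A kappa : R) (n : nat) :
  0 <= lam <= A -> 0 <= mu -> mu <= 2 * A ^+ 2 -> 1 <= A -> 4 * A <= n%:R ->
  (forall j, (j < n)%N -> L1 P (fun x => xi j.+1 x ^+ 2)) ->
  (forall j, (j < n)%N -> Ex P (xi j.+1) = 0) ->
  (forall j, (j < n)%N -> Ex P (fun x => xi j.+1 x ^+ 2) = n%:R^-1) ->
  (forall j, (j < n)%N ->
    Ex P (fun x => xi j.+1 x ^+ 2 * Num.min 1 `|xi j.+1 x|) <= kappa) ->
  (forall j, (j < n)%N -> L1 P (fun x => `|g (y j x) ^+ 2 - y j x ^+ 2|)) ->
  L1 P (fun x => y 0%N x ^+ 2) ->
  `|Ex P (fun x => expR (- (lam * y n x ^+ 2 + mu * (n%:R^-1 * \sum_(0 <= i < n) y i x ^+ 2)))) -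
    \prod_(0 <= j < n) (1 - ric lam mu n%:R j / n%:R)|
  <= 32 * A ^+ 2 * (n%:R * kappa) + 66 * A ^+ 2 / n%:R +
     A * \sum_(0 <= j < n) Ex P (fun x => `|g (y j x) ^+ 2 - y j x ^+ 2|) +
     A * Ex P (fun x => y 0%N x ^+ 2).
Proof.
move=> lamA mu0 muA A1 AN iE2 E0 E2 Ek iD iy0.
have N0 : 0 < n%:R :> R by lra.
pose a k := ric lam mu n%:R k.
have ab k : 0 <= a k <= A by exact: ric_bound.
pose S j x := n%:R^-1 * \sum_(0 <= i < j) y i x ^+ 2.
(* The functional after k reductions: [F 0] is the target and [F n] sees only y_0. *)
pose F k := Ex P (fun x => expR (- (a k * y (n - k)%N x ^+ 2 + mu * S (n - k)%N x))).
pose err j := 32 * A ^+ 2 * kappa + 66 * A ^+ 2 / n%:R ^+ 2 +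
  A * Ex P (fun x => `|g (y j x) ^+ 2 - y j x ^+ 2|).
have my i := adapted_measurable indep (@adapted_chain i).
have aS j : adapted xi j (S j.+1).
  apply: measurable_funM => //.
  apply: (adapted_sum (X := fun i x => y i x ^+ 2)) => i; rewrite ltnS => ij.
  by apply: measurable_funX; exact: (adapted_le ij (@adapted_chain i)).
have S0 j x : 0 <= S j x.
  by rewrite mulr_ge0 ?invr_ge0// sumr_ge0// => i _; exact: sqr_ge0.
have step k : (k < n)%N -> `|F k - (1 - a k / n%:R) * F k.+1| <= err (n - k.+1)%N.
  move=> kn; pose j := (n - k.+1)%N.
  have jn : (j < n)%N by rewrite /j ltn_subrL (leq_ltn_trans _ kn).
  have nk : (n - k)%N = j.+1 by rewrite /j subnSK.
  have := @riccati_step j A (a k) n%:R kappa (fun x => expR (- (mu * S j.+1 x)))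
    (ab k) A1 AN.
  have -> : F k = Ex P (fun x => expR (- (mu * S j.+1 x)) * expR (- (a k * y j.+1 x ^+ 2))).
    by apply: Ex_ext => x; rewrite nk -expRD -opprD addrC.
  (* The last term mu y_j^2 / n of the energy joins the quadratic exponent, which turns a - 2 a^2 /
     n into the next value of [ric]. *)
  have -> : F k.+1 = Ex P (fun x => expR (- (mu * S j.+1 x)) *
      expR (- ((a k - 2 * a k ^+ 2 / n%:R) * y j x ^+ 2))).
    apply: Ex_ext => x; rewrite -/j -expRD; congr expR.
    rewrite /S big_nat_recr//= -/(a k); move: (\sum_(_ <= _ < _) _) => s.
    by rewrite -/(ric lam mu n%:R k) -/(a k); ring.
  apply; [| |exact: iE2|exact: E0|exact: E2|exact: Ek|exact: iD].
    apply: measurableT_comp => //; apply: measurable_funN; apply: measurable_funM => //.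
    exact: aS.
  by move=> x; rewrite expR_ge0 -[leRHS]expR0 ler_expR oppr_le0 mulr_ge0.
have main k : (k <= n)%N ->
    `|F 0%N - (\prod_(0 <= j < k) (1 - a j / n%:R)) * F k| <=
    \sum_(0 <= j < k) err (n - j.+1)%N /\
    0 <= \prod_(0 <= j < k) (1 - a j / n%:R) <= 1.
  elim: k => [_|k ih kn]; first by rewrite !big_nil mul1r subrr normr0; split; rewrite ?ler01 ?lexx.
  have [ih1 /andP[ih2 ih3]] := ih (ltnW kn).
  have q01 : 0 <= 1 - a k / n%:R <= 1.
    have /andP[ak0 akA] := ab k.
    have : a k / n%:R <= 1 / 4 by rewrite ler_pdivrMr//; lra.
    have : 0 <= a k / n%:R by rewrite divr_ge0// ltW.
    by move=> *; apply/andP; split; lra.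
  have /andP[q0 q1] := q01.
  rewrite !big_nat_recr//=; split; last first.
    by apply/andP; split; [exact: mulr_ge0|exact: mulr_ile1].
  set p := \prod_(_ <= _ < _) _ in ih1 ih2 ih3 *.
  have -> : F 0%N - p * (1 - a k / n%:R) * F k.+1 =
    (F 0%N - p * F k) + p * (F k - (1 - a k / n%:R) * F k.+1) by ring.
  rewrite (le_trans (ler_normD _ _))// lerD// normrM (ger0_norm ih2) -[leRHS]mul1r.
  by rewrite ler_pM// step.
have [M /andP[p0 p1]] := main n (leqnn n).
set p := \prod_(_ <= _ < _) _ in M p0 p1.
have iexp : L1 P (fun x => expR (- (a n * y 0%N x ^+ 2))).
  have /andP[an0 _] := ab n.
  apply: (L1_bnd P (M := 1)).
    apply: measurableT_comp => //; apply: measurable_funN; apply: measurable_funM => //.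
    exact: measurable_funX.
  move=> x; rewrite ger0_norm ?expR_ge0//.
  by rewrite -[leRHS]expR0 ler_expR oppr_le0 mulr_ge0// sqr_ge0.
have Fn : `|F n - 1| <= A * Ex P (fun x => y 0%N x ^+ 2).
  have -> : F n = Ex P (fun x => expR (- (a n * y 0%N x ^+ 2))).
    by apply: Ex_ext => x; rewrite subnn /S big_nil !mulr0 addr0.
  rewrite -[in X in `|_ - X|](Ex_cst P 1) -ExB//; last exact: L1_cst.
  apply: le_trans (Ex_norm (L1B iexp (L1_cst P 1))) _; rewrite -ExZ//.
  apply: Ex_le; [by apply: L1_norm; apply: L1B => //; exact: L1_cst|exact: L1Z|].
  have /andP[an0 anA] := ab n.
  move=> x; have -> : 1 = expR (- 0) :> R by rewrite oppr0 expR0.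
  apply: le_trans (expRN_lip (mulr_ge0 an0 (sqr_ge0 _)) (lexx 0)) _.
  rewrite subr0 (ger0_norm (mulr_ge0 an0 (sqr_ge0 _))).
  by apply: ler_wpM2r => //; exact: sqr_ge0.
have -> : Ex P (fun x => expR (- (lam * y n x ^+ 2 +
    mu * (n%:R^-1 * \sum_(0 <= i < n) y i x ^+ 2)))) = F 0%N.
  by apply: Ex_ext => x; rewrite subn0.
have -> : F 0%N - p = (F 0%N - p * F n) + p * (F n - 1) by ring.
rewrite (le_trans (ler_normD _ _))// lerD//; last first.
  by rewrite normrM (ger0_norm p0) -[leRHS]mul1r ler_pM.
apply: le_trans M _.
have -> : \sum_(0 <= j < n) err (n - j.+1)%N = \sum_(0 <= j < n) err j.
  by rewrite [RHS]big_nat_rev /= add0n.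
rewrite /err big_split/= -mulr_sumr lerD2r sumr_const_nat subn0 -[leLHS]mulr_natr.
suff -> // : (32 * A ^+ 2 * kappa + 66 * A ^+ 2 / n%:R ^+ 2) * n%:R =
  32 * A ^+ 2 * (n%:R * kappa) + 66 * A ^+ 2 / n%:R by [].
by field; rewrite gt_eqF.
Qed.

End riccati.

(** * From Laplace transforms to convergence in distribution *)

(** Counterexamples at the scales 1 / (k+1) would have, by Bolzano-Weierstrass, a subsequence along
    which both points tend to the same limit, against continuity there. *)
Lemma heine {R : realType} (f : R -> R) (L e : R) : continuous f -> 0 < e ->
  exists2 d : R, 0 < d & forall x y : R, `|x| <= L -> `|y| <= L -> `|x - y| <= d ->
    `|f x - f y| <= e.
Proof.
move=> cf e0; apply: contrapT => H.
have Hk k : exists z : R * R, [/\ `|z.1| <= L, `|z.2| <= L,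
    `|z.1 - z.2| <= k.+1%:R^-1 & e < `|f z.1 - f z.2|].
  apply: contrapT => Hk; apply: H; exists k.+1%:R^-1; first by rewrite invr_gt0 ltr0n.
  move=> x y xL yL xy; rewrite leNgt; apply/negP => fe; apply: Hk.
  by exists (x, y).
have [z zP] := choice Hk.
have bz : bounded_fun (fun k => (z k).1).
  exists L; split; first exact: num_real.
  by move=> M LM k _; have [zL _ _ _] := zP k; rewrite /= (le_trans zL)// ltW.
have [s sinc /cvg_ex[l zl]] := bolzano_weierstrass bz.
have ks k : (k <= s k)%N.
  elim: k => [//|k ih]; apply: leq_ltn_trans ih _.
  have E : (s k.+1 <= s k)%N = (k.+1 <= k)%N by exact: sinc.
  by rewrite ltnNge E ltnn.
have zl2 : (fun k => (z (s k)).2) @ \oo --> l.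
  apply/cvgrPdist_le => eps eps0.
  have e20 : 0 < eps / 2 by rewrite divr_gt0.
  move/cvgrPdist_le : (zl) => /(_ _ e20) h1.
  have h2 := near_infty_natSinv_lt (PosNum e20).
  near=> k.
  have z1 : `|l - (z (s k)).1| <= eps / 2 by near: k.
  have z2 : k.+1%:R^-1 < eps / 2 by near: k.
  have [_ _ z3 _] := zP (s k).
  have z4 : (s k).+1%:R^-1 <= k.+1%:R^-1 :> R.
    by rewrite lef_pV2 ?posrE ?ltr0n// ler_nat ltnS.
  have -> : l - (z (s k)).2 = (l - (z (s k)).1) + ((z (s k)).1 - (z (s k)).2) by ring.
  rewrite (le_trans (ler_normD _ _))// [leRHS]splitr lerD//.
  exact: le_trans z3 (le_trans z4 (ltW z2)).
have fl1 : (fun k => f (z (s k)).1) @ \oo --> f l by apply: cvg_comp zl _; exact: cf.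
have fl2 : (fun k => f (z (s k)).2) @ \oo --> f l by apply: cvg_comp zl2 _; exact: cf.
have e20 : 0 < e / 2 by rewrite divr_gt0.
move/cvgrPdist_le : fl1 => /(_ _ e20) h1.
move/cvgrPdist_le : fl2 => /(_ _ e20) h2.
near \oo => k.
have z1 : `|f l - f (z (s k)).1| <= e / 2 by near: k.
have z2 : `|f l - f (z (s k)).2| <= e / 2 by near: k.
have [_ _ _] := zP (s k); apply/negP; rewrite -leNgt.
have -> : f (z (s k)).1 - f (z (s k)).2 = (f l - f (z (s k)).2) - (f l - f (z (s k)).1) by ring.
by rewrite (le_trans (ler_normB _ _))//; lra.
Unshelve. all: by end_near.
Qed.

(* [bern m phi p] is the expectation of [phi] under the binomial law (m, p). *)
Fixpoint bern {R : realType} (m : nat) (phi : nat -> R) (p : R) : R :=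
  match m with
  | 0%N => phi 0%N
  | k.+1 => (1 - p) * bern k phi p + p * bern k (fun i => phi i.+1) p
  end.

(** * Bernstein approximation in two variables *)

Section bernstein.
Context {R : realType}.
Implicit Types (m : nat) (p q : R) (phi psi : nat -> R).

Lemma bern_ext m phi psi p : (forall i, (i <= m)%N -> phi i = psi i) ->
  bern m phi p = bern m psi p.
Proof.
elim: m phi psi => [|m ih] phi psi E /=; first exact: E.
by congr (_ * _ + _ * _); apply: ih => i im; apply: E => //; exact: leqW.
Qed.

Lemma bernD m phi psi p :
  bern m (fun i => phi i + psi i) p = bern m phi p + bern m psi p.
Proof.
elim: m phi psi => [//|m ih] phi psi /=.
by rewrite (ih phi psi) (ih (fun i => phi i.+1) (fun i => psi i.+1)); ring.
Qed.

Lemma bernZ m c phi p : bern m (fun i => c * phi i) p = c * bern m phi p.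
Proof.
elim: m phi => [//|m ih] phi /=.
by rewrite (ih phi) (ih (fun i => phi i.+1)); ring.
Qed.

Lemma bern_cst m c p : bern m (fun=> c) p = c.
Proof. by elim: m => [//|m ih] /=; rewrite ih; ring. Qed.

Lemma bern_le m phi psi p : 0 <= p <= 1 -> (forall i, (i <= m)%N -> phi i <= psi i) ->
  bern m phi p <= bern m psi p.
Proof.
move=> /andP[p0 p1]; elim: m phi psi => [|m ih] phi psi E /=; first exact: E.
apply: lerD; apply: ler_wpM2l => //; [by rewrite subr_ge0|apply: ih|apply: ih].
- by move=> i im; apply: E; exact: leqW.
- by move=> i im; exact: E.
Qed.

(** The shift c is there for the induction: a success in one trial replaces c by 1 + c. Taking c = -
    m p gives the binomial variance. *)
Lemma bern_sqr m p c : bern m (fun i => (i%:R + c) ^+ 2) p =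
  (m%:R * p + c) ^+ 2 + m%:R * (p * (1 - p)).
Proof.
elim: m c => [|m ih] c /=; first by rewrite !mul0r addr0.
rewrite ih.
have -> : bern m (fun i => (i.+1%:R + c) ^+ 2) p = bern m (fun i => (i%:R + (1 + c)) ^+ 2) p.
  by apply: bern_ext => i _; rewrite -natr1; congr (_ ^+ 2); ring.
by rewrite ih -natr1; ring.
Qed.

Lemma bern_norm m phi p : 0 <= p <= 1 ->
  `|bern m phi p| <= bern m (fun i => `|phi i|) p.
Proof.
move=> p01; rewrite ler_norml; apply/andP; split; last first.
  by apply: bern_le => // i _; exact: ler_norm.
rewrite -mulN1r -bernZ; apply: bern_le => // i _.
by rewrite mulN1r lerNl -normrN ler_norm.
Qed.

Lemma bern_var m p : (0 < m)%N -> 0 <= p <= 1 ->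
  bern m (fun i => (i%:R / m%:R - p) ^+ 2) p <= m%:R^-1.
Proof.
move=> m0 /andP[p0 p1]; have mR : 0 < m%:R :> R by rewrite ltr0n.
have -> : bern m (fun i => (i%:R / m%:R - p) ^+ 2) p =
    (m%:R ^+ 2)^-1 * bern m (fun i => (i%:R + (- (m%:R * p))) ^+ 2) p.
  rewrite -bernZ; apply: bern_ext => i _.
  by field; rewrite gt_eqF.
rewrite bern_sqr subrr expr0n /= add0r.
have -> : (m%:R ^+ 2)^-1 * (m%:R * (p * (1 - p))) = m%:R^-1 * (p * (1 - p)) :> R.
  by field; rewrite gt_eqF.
by rewrite -[leRHS]mulr1 ler_wpM2l ?invr_ge0 ?ltW//; nra.
Qed.

Definition bern2 m (H : R -> R -> R) p q : R :=
  bern m (fun i => bern m (fun j => H (i%:R / m%:R) (j%:R / m%:R)) q) p.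

(** Chebyshev's argument: the quadratic majorant e + (2 M / dl^2) ((s - p)^2 + (t - q)^2) bounds the
    difference near (p, q) and far from it, and each square averages to at most 1 / m. *)
Lemma bern2_approx (H : R -> R -> R) (M e dl : R) m p q : (0 < m)%N -> 0 < dl ->
  0 <= p <= 1 -> 0 <= q <= 1 ->
  (forall s t : R, 0 <= s <= 1 -> 0 <= t <= 1 -> `|H s t| <= M) ->
  (forall s t : R, 0 <= s <= 1 -> 0 <= t <= 1 -> `|s - p| <= dl -> `|t - q| <= dl ->
     `|H s t - H p q| <= e) ->
  `|bern2 m H p q - H p q| <= e + 4 * M / (dl ^+ 2 * m%:R).
Proof.
move=> m0 dl0 p01 q01 HM He; have mR : 0 < m%:R :> R by rewrite ltr0n.
have M0 : 0 <= M by apply: le_trans (HM p q _ _).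
have e0 : 0 <= e by apply: le_trans (He p q _ _ _ _) => //; rewrite subrr normr0 ltW.
have bnd s t : 0 <= s <= 1 -> 0 <= t <= 1 ->
    `|H s t - H p q| <= e + 2 * M / dl ^+ 2 * (s - p) ^+ 2 + 2 * M / dl ^+ 2 * (t - q) ^+ 2.
  move=> s01 t01.
  have c0 : 0 <= 2 * M / dl ^+ 2 by rewrite divr_ge0 ?sqr_ge0// mulr_ge0.
  have k1 : 0 <= 2 * M / dl ^+ 2 * (s - p) ^+ 2 by rewrite mulr_ge0// sqr_ge0.
  have k2 : 0 <= 2 * M / dl ^+ 2 * (t - q) ^+ 2 by rewrite mulr_ge0// sqr_ge0.
  have tot : `|H s t - H p q| <= 2 * M.
    by rewrite (le_trans (ler_normB _ _))//; have := HM s t s01 t01; have := HM p q p01 q01; lra.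
  have far (x : R) : dl < `|x| -> 2 * M <= 2 * M / dl ^+ 2 * x ^+ 2.
    move=> dx; rewrite -mulrA -[leLHS]mulr1 ler_wpM2l ?mulr_ge0//.
    rewrite mulrC ler_pdivlMr ?exprn_gt0// mul1r -(real_normK (num_real x)).
    by rewrite ler_sqr ?nnegrE ?(ltW dl0)// ltW.
  have [sp|/far sp] := leP `|s - p| dl; last by lra.
  have [tq|/far tq] := leP `|t - q| dl; last by lra.
  by have := He s t s01 t01 sp tq; lra.
have im i : (i <= m)%N -> 0 <= (i%:R / m%:R : R) <= 1.
  move=> im; rewrite divr_ge0//=.
  by rewrite ler_pdivrMr// mul1r ler_nat.
pose c := 2 * M / dl ^+ 2.
have c0 : 0 <= c by rewrite divr_ge0 ?sqr_ge0// mulr_ge0.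
have -> : bern2 m H p q - H p q =
    bern m (fun i => bern m (fun j => H (i%:R / m%:R) (j%:R / m%:R) + - H p q) q) p.
  rewrite /bern2 -[X in _ - X = _](bern_cst m _ p) -mulN1r -bernZ -bernD.
  apply: bern_ext => i _; rewrite mulN1r -[X in _ + X = _](bern_cst m _ q).
  by rewrite -bernD.
apply: le_trans (bern_norm _ _ p01) _.
apply: le_trans (_ : bern m (fun i => (e + c * m%:R^-1) + c * (i%:R / m%:R - p) ^+ 2) p <= _).
  apply: bern_le => // i /im i01.
  apply: le_trans (bern_norm _ _ q01) _.
  apply: le_trans (_ : bern m (fun j => (e + c * (i%:R / m%:R - p) ^+ 2) +
     c * (j%:R / m%:R - q) ^+ 2) q <= _).
    by apply: bern_le => // j /im j01; exact: bnd.
  rewrite bernD bern_cst bernZ; have := ler_wpM2l c0 (bern_var m0 q01).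
  by lra.
rewrite bernD bern_cst bernZ; have := ler_wpM2l c0 (bern_var m0 p01).
have -> : 4 * M / (dl ^+ 2 * m%:R) = 2 * (c * m%:R^-1).
  by rewrite /c; field; rewrite !gt_eqF.
by lra.
Qed.

End bernstein.

(** * Method of moments on the unit square *)

Section moments.
Context {d1 d2 : measure_display} {T : measurableType d1} {O : measurableType d2}
  {R : realType} (P : probability T R) (Q : probability O R).
Variables (p q : nat -> T -> R) (p' q' : O -> R).
Hypothesis mp : forall n, measurable_fun setT (p n).
Hypothesis mq : forall n, measurable_fun setT (q n).
Hypothesis mp' : measurable_fun setT p'.
Hypothesis mq' : measurable_fun setT q'.
Hypothesis p01 : forall n x, 0 <= p n x <= 1.
Hypothesis q01 : forall n x, 0 <= q n x <= 1.
Hypothesis p'01 : forall x, 0 <= p' x <= 1.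
Hypothesis q'01 : forall x, 0 <= q' x <= 1.
Hypothesis momcvg : forall i j : nat,
  (fun n => Ex P (fun x => p n x ^+ i * q n x ^+ j)) @ \oo -->
  Ex Q (fun x => p' x ^+ i * q' x ^+ j).

(** Quantifying over all monomial prefactors makes the property stable under multiplication by
    either coordinate; integrability is carried along so that expectations of sums can be split. *)
Let poly_test (h : R -> R -> R) : Prop := forall i j : nat,
  [/\ forall n, L1 P (fun x => p n x ^+ i * q n x ^+ j * h (p n x) (q n x)),
      L1 Q (fun x => p' x ^+ i * q' x ^+ j * h (p' x) (q' x)) &
      (fun n => Ex P (fun x => p n x ^+ i * q n x ^+ j * h (p n x) (q n x))) @ \oo -->
      Ex Q (fun x => p' x ^+ i * q' x ^+ j * h (p' x) (q' x))].

Let poly_ext h h' : poly_test h -> (forall s t, h s t = h' s t) -> poly_test h'.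
Proof. by move=> hP E; rewrite (_ : h' = h)//; apply/funext => s; apply/funext => t. Qed.

Let poly_cst c : poly_test (fun _ _ => c).
Proof.
move=> i j.
have b01 (s t : R) : 0 <= s <= 1 -> 0 <= t <= 1 -> `|s ^+ i * t ^+ j| <= 1.
  move=> /andP[s0 s1] /andP[t0 t1].
  rewrite ger0_norm ?mulr_ge0 ?exprn_ge0// mulr_ile1 ?exprn_ge0//; exact: exprn_ile1.
have i1 n : L1 P (fun x => p n x ^+ i * q n x ^+ j).
  apply: (L1_bnd P (M := 1)); first by apply: measurable_funM; exact: measurable_funX.
  by move=> x; exact: b01.
have i2 : L1 Q (fun x => p' x ^+ i * q' x ^+ j).
  apply: (L1_bnd Q (M := 1)); first by apply: measurable_funM; exact: measurable_funX.
  by move=> x; exact: b01.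
split; [by move=> n; exact: L1Zr|exact: L1Zr|].
have E n : Ex P (fun x => p n x ^+ i * q n x ^+ j * c) =
    c * Ex P (fun x => p n x ^+ i * q n x ^+ j).
  by rewrite -ExZ//; apply: Ex_ext => x; rewrite mulrC.
have E' : Ex Q (fun x => p' x ^+ i * q' x ^+ j * c) =
    c * Ex Q (fun x => p' x ^+ i * q' x ^+ j).
  by rewrite -ExZ//; apply: Ex_ext => x; rewrite mulrC.
rewrite E'; under eq_fun do rewrite E.
by apply: cvgM => //; exact: cvg_cst.
Qed.

Let poly_D h h' : poly_test h -> poly_test h' -> poly_test (fun s t => h s t + h' s t).
Proof.
move=> hP hP' i j; have [i1 i2 c] := hP i j; have [i1' i2' c'] := hP' i j.
have E n : (fun x => p n x ^+ i * q n x ^+ j * (h (p n x) (q n x) + h' (p n x) (q n x))) =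
    (fun x => p n x ^+ i * q n x ^+ j * h (p n x) (q n x) +
              p n x ^+ i * q n x ^+ j * h' (p n x) (q n x)).
  by apply/funext => x; rewrite mulrDr.
have E' : (fun x => p' x ^+ i * q' x ^+ j * (h (p' x) (q' x) + h' (p' x) (q' x))) =
    (fun x => p' x ^+ i * q' x ^+ j * h (p' x) (q' x) +
              p' x ^+ i * q' x ^+ j * h' (p' x) (q' x)).
  by apply/funext => x; rewrite mulrDr.
split; [by move=> n; rewrite E; exact: L1D|by rewrite E'; exact: L1D|].
rewrite E' ExD//; under eq_fun do rewrite E ExD//.
exact: cvgD.
Qed.

Let poly_Mp h : poly_test h -> poly_test (fun s t => s * h s t).
Proof.
move=> hP i j; have [i1 i2 c] := hP i.+1 j.
have E n : (fun x => p n x ^+ i * q n x ^+ j * (p n x * h (p n x) (q n x))) =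
    (fun x => p n x ^+ i.+1 * q n x ^+ j * h (p n x) (q n x)).
  by apply/funext => x; rewrite exprS; ring.
have E' : (fun x => p' x ^+ i * q' x ^+ j * (p' x * h (p' x) (q' x))) =
    (fun x => p' x ^+ i.+1 * q' x ^+ j * h (p' x) (q' x)).
  by apply/funext => x; rewrite exprS; ring.
by split; [move=> n; rewrite E|rewrite E'|rewrite E'; under eq_fun do rewrite E].
Qed.

Let poly_Mq h : poly_test h -> poly_test (fun s t => t * h s t).
Proof.
move=> hP i j; have [i1 i2 c] := hP i j.+1.
have E n : (fun x => p n x ^+ i * q n x ^+ j * (q n x * h (p n x) (q n x))) =
    (fun x => p n x ^+ i * q n x ^+ j.+1 * h (p n x) (q n x)).
  by apply/funext => x; rewrite exprS; ring.
have E' : (fun x => p' x ^+ i * q' x ^+ j * (q' x * h (p' x) (q' x))) =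
    (fun x => p' x ^+ i * q' x ^+ j.+1 * h (p' x) (q' x)).
  by apply/funext => x; rewrite exprS; ring.
by split; [move=> n; rewrite E|rewrite E'|rewrite E'; under eq_fun do rewrite E].
Qed.

Let poly_Mc c h : poly_test h -> poly_test (fun s t => c * h s t).
Proof.
move=> hP i j; have [i1 i2 k] := hP i j.
have E n : (fun x => p n x ^+ i * q n x ^+ j * (c * h (p n x) (q n x))) =
    (fun x => c * (p n x ^+ i * q n x ^+ j * h (p n x) (q n x))).
  by apply/funext => x; ring.
have E' : (fun x => p' x ^+ i * q' x ^+ j * (c * h (p' x) (q' x))) =
    (fun x => c * (p' x ^+ i * q' x ^+ j * h (p' x) (q' x))).
  by apply/funext => x; ring.
split; [by move=> n; rewrite E; exact: L1Z|by rewrite E'; exact: L1Z|].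
rewrite E' ExZ//; under eq_fun do rewrite E ExZ//.
by apply: cvgM => //; exact: cvg_cst.
Qed.

Let poly_bern_p m (phi : nat -> R -> R) : (forall i, poly_test (fun _ t => phi i t)) ->
  poly_test (fun s t => bern m (fun i => phi i t) s).
Proof.
elim: m phi => [|m ih] phi hphi /=; first exact: hphi.
have h1 := ih phi hphi; have h2 := ih (fun i => phi i.+1) (fun i => hphi i.+1).
apply: (poly_ext (h := fun s t => (bern m (fun i => phi i t) s +
   (- 1) * (s * bern m (fun i => phi i t) s)) + s * bern m (fun i => phi i.+1 t) s)).
  by apply: poly_D; [apply: poly_D => //; apply: poly_Mc; exact: poly_Mp|exact: poly_Mp].
by move=> s t; ring.
Qed.

Let poly_bern_q m (phi : nat -> R) : poly_test (fun _ t => bern m phi t).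
Proof.
elim: m phi => [|m ih] phi /=; first exact: poly_cst.
apply: (poly_ext (h := fun s t => (bern m phi t +
   (- 1) * (t * bern m phi t)) + t * bern m (fun i => phi i.+1) t)).
  by apply: poly_D; [apply: poly_D => //; apply: poly_Mc; exact: poly_Mq|exact: poly_Mq].
by move=> s t; ring.
Qed.

Let poly_bern2 m H : poly_test (bern2 m H).
Proof. by apply: poly_bern_p => i; exact: poly_bern_q. Qed.

(** Weierstrass's argument in three parts of e / 3, with Bernstein polynomials as uniform
    approximants. They also give measurability of H (p, q), as a pointwise limit, since H is only
    controlled on the unit square. *)
Lemma moments_cvg (H : R -> R -> R) (M : R) :
  (forall s t : R, 0 <= s <= 1 -> 0 <= t <= 1 -> `|H s t| <= M) ->
  (forall e : R, 0 < e -> exists2 dl : R, 0 < dl & forall s t s' t' : R,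
    0 <= s <= 1 -> 0 <= t <= 1 -> 0 <= s' <= 1 -> 0 <= t' <= 1 ->
    `|s - s'| <= dl -> `|t - t'| <= dl -> `|H s t - H s' t'| <= e) ->
  [/\ forall n, measurable_fun setT (fun x => H (p n x) (q n x)),
      measurable_fun setT (fun x => H (p' x) (q' x)) &
      (fun n => Ex P (fun x => H (p n x) (q n x))) @ \oo -->
      Ex Q (fun x => H (p' x) (q' x))].
Proof.
move=> HM Hu.
have M0 : 0 <= M by apply: le_trans (HM 0 0 _ _) => //; rewrite lexx ler01.
have app e : 0 < e -> \forall m \near \oo, forall s t, 0 <= s <= 1 -> 0 <= t <= 1 ->
    `|H s t - bern2 m.+1 H s t| <= e.
  move=> e0; have e20 : 0 < e / 2 by rewrite divr_gt0.
  have [dl dl0 hdl] := Hu _ e20.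
  (* The Chebyshev term 4 M / (dl^2 m) has to fall below e / 2; the + 1 covers M = 0. *)
  have e30 : 0 < e / 2 * dl ^+ 2 / (4 * M + 1).
    by rewrite divr_gt0 ?mulr_gt0 ?exprn_gt0//; lra.
  have h := near_infty_natSinv_lt (PosNum e30).
  near=> m => s t s01 t01; rewrite distrC.
  apply: le_trans (@bern2_approx _ H M (e / 2) dl m.+1 s t _ dl0 s01 t01 HM _) _ => //.
    by move=> s' t' s'01 t'01 ? ?; exact: hdl.
  have mm : m.+1%:R^-1 < e / 2 * dl ^+ 2 / (4 * M + 1) by near: m.
  have d20 : 0 < dl ^+ 2 by rewrite exprn_gt0.
  have -> : 4 * M / (dl ^+ 2 * m.+1%:R) = 4 * M / dl ^+ 2 * m.+1%:R^-1.
    by field; rewrite !gt_eqF// addrC natr1 ltr0n.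
  have k0 : 0 <= 4 * M / dl ^+ 2 by rewrite divr_ge0 ?sqr_ge0// mulr_ge0.
  have := ler_wpM2l k0 (ltW mm).
  have -> : 4 * M / dl ^+ 2 * (e / 2 * dl ^+ 2 / (4 * M + 1)) = e / 2 * (4 * M / (4 * M + 1)).
    have M1 : 0 < 4 * M + 1 by lra.
    by field; rewrite !gt_eqF.
  have r1 : 4 * M / (4 * M + 1) <= 1 by rewrite ler_pdivrMr; lra.
  move=> hm; rewrite [leRHS]splitr lerD2l (le_trans hm)//.
  by rewrite -[leRHS]mulr1 ler_wpM2l ?(ltW e20).
have lim s t : 0 <= s <= 1 -> 0 <= t <= 1 ->
    (fun m => bern2 m.+1 H s t) @ \oo --> H s t.
  move=> s01 t01; apply/cvgrPdist_le => e e0; have := app e e0.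
  by apply: filterS => m; exact.
have mH n : measurable_fun setT (fun x => H (p n x) (q n x)).
  apply: (@measurable_fun_cvg _ _ _ _ (fun m x => bern2 m.+1 H (p n x) (q n x))).
    move=> m; have [h _ _] := @poly_bern2 m.+1 H 0%N 0%N.
    by have /L1_meas := h n; under eq_fun do rewrite !expr0 !mul1r.
  by move=> x _; exact: lim.
have mH' : measurable_fun setT (fun x => H (p' x) (q' x)).
  apply: (@measurable_fun_cvg _ _ _ _ (fun m x => bern2 m.+1 H (p' x) (q' x))).
    move=> m; have [_ h _] := @poly_bern2 m.+1 H 0%N 0%N.
    by have /L1_meas := h; under eq_fun do rewrite !expr0 !mul1r.
  by move=> x _; exact: lim.
split => //.
have iH n : L1 P (fun x => H (p n x) (q n x)).
  by apply: (L1_bnd P (mH n)) => x; exact: HM.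
have iH' : L1 Q (fun x => H (p' x) (q' x)).
  by apply: (L1_bnd Q mH') => x; exact: HM.
apply/cvgrPdist_le => e e0; have e30 : 0 < e / 3 by rewrite divr_gt0.
near \oo => m.
have appm s t : 0 <= s <= 1 -> 0 <= t <= 1 -> `|H s t - bern2 m.+1 H s t| <= e / 3.
  by move: s t; near: m; exact: app.
have [i1 i2 c] := @poly_bern2 m.+1 H 0%N 0%N.
have e0E : (fun x => p' x ^+ 0 * q' x ^+ 0 * bern2 m.+1 H (p' x) (q' x)) =
  (fun x => bern2 m.+1 H (p' x) (q' x)) by apply/funext => x; rewrite !expr0 !mul1r.
have e0En n : (fun x => p n x ^+ 0 * q n x ^+ 0 * bern2 m.+1 H (p n x) (q n x)) =
  (fun x => bern2 m.+1 H (p n x) (q n x)) by apply/funext => x; rewrite !expr0 !mul1r.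
rewrite e0E in i2 c.
have {}c : (fun n => Ex P (fun x => bern2 m.+1 H (p n x) (q n x))) @ \oo -->
    Ex Q (fun x => bern2 m.+1 H (p' x) (q' x)).
  by move: c; under eq_fun do rewrite e0En.
move/cvgrPdist_le : c => /(_ _ e30); apply: filterS => n cn.
have k1 : `|Ex Q (fun x => H (p' x) (q' x)) - Ex Q (fun x => bern2 m.+1 H (p' x) (q' x))| <= e / 3.
  by rewrite -ExB//; apply: Ex_bnd; [exact: L1B|move=> x; exact: appm].
have k2 : `|Ex P (fun x => H (p n x) (q n x)) - Ex P (fun x => bern2 m.+1 H (p n x) (q n x))| <= e / 3.
  have := i1 n; rewrite e0En => i1n.
  by rewrite -ExB//; apply: Ex_bnd; [exact: L1B|move=> x; exact: appm].
move: k1 k2 cn; rewrite !ler_norml => /andP[? ?] /andP[? ?] /andP[? ?].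
by apply/andP; split; lra.
Unshelve. all: by end_near.
Qed.

End moments.

(** The formula x exp (- ln (x^2)) for 1 / x also gives the convention 1 / 0 = 0, because of the
    factor x. *)
Lemma measurable_invr {R : realType} : measurable_fun setT (fun x : R => x^-1).
Proof.
rewrite (_ : (fun _ => _) = fun x : R => x * expR (- ln (x ^+ 2))); last first.
  apply/funext => x; have [->|x0] := eqVneq x 0; first by rewrite invr0 mul0r.
  have x20 : 0 < x ^+ 2 by rewrite exprn_even_gt0.
  by rewrite expRN lnK ?posrE//; field.
apply: measurable_funM => //; apply: measurableT_comp => //.
apply: measurable_funN; apply: measurableT_comp; first exact: measurable_ln.
exact: measurable_funX.
Qed.

(** * Lipschitz cutoffs for the ratio *)

Section cutoffs.
Context {R : realType}.
Implicit Types c s t : R.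

(** For c > 0, a Lipschitz majorant of the indicator of s <= c that vanishes from 2 c on. *)
Definition bump c s : R := Num.max 0 (2 - s / c).

Lemma bump_ge0 c s : 0 <= bump c s.
Proof. by rewrite le_max lexx. Qed.

Lemma bump_le2 c s : 0 < c -> 0 <= s -> bump c s <= 2.
Proof.
move=> c0 s0; have sc : 0 <= s / c by rewrite divr_ge0// ltW.
by rewrite ge_max; apply/andP; split; lra.
Qed.

Lemma bump_ge1 c s : 0 < c -> s <= c -> 1 <= bump c s.
Proof.
move=> c0 sc; rewrite le_max; apply/orP; right.
have : s / c <= 1 by rewrite ler_pdivrMr// mul1r.
by lra.
Qed.

Lemma max_lip (a b e : R) : `|Num.max a e - Num.max b e| <= `|a - b|.
Proof.
have := ler_norm (a - b); have := ler_norm (b - a); rewrite distrC.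
by case: (leP a e); case: (leP b e) => *; rewrite ler_norml; apply/andP; split; lra.
Qed.

Lemma min_lip (a b e : R) : `|Num.min a e - Num.min b e| <= `|a - b|.
Proof.
have := ler_norm (a - b); have := ler_norm (b - a); rewrite distrC.
by case: (leP a e); case: (leP b e) => *; rewrite ler_norml; apply/andP; split; lra.
Qed.

Lemma bump_lip c s t : 0 < c -> `|bump c s - bump c t| <= `|s - t| / c.
Proof.
move=> c0; rewrite /bump ![Num.max 0 _]maxC (le_trans (max_lip _ _ _))//.
have -> : 2 - s / c - (2 - t / c) = - ((s - t) / c) by ring.
by rewrite normrN normrM (ger0_norm (_ : 0 <= c^-1))// invr_ge0 ltW.
Qed.

Lemma ln_lip c s t : 0 < c -> c <= s -> c <= t -> `|ln s - ln t| <= `|s - t| / c.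
Proof.
move=> c0; have wl (a b : R) : c <= b -> b <= a -> `|ln a - ln b| <= `|a - b| / c.
  move=> cb ba; have b0 : 0 < b by exact: lt_le_trans cb.
  have a0 : 0 < a by exact: lt_le_trans ba.
  rewrite !ger0_norm ?subr_ge0 ?ler_ln//.
  rewrite -ln_div ?posrE//; have ab0 : 0 < a / b by rewrite divr_gt0.
  have := expR_ge1Dx (ln (a / b)); rewrite lnK ?posrE// => h.
  apply: le_trans (_ : (a - b) / b <= _).
    by rewrite mulrBl divff ?gt_eqF//; lra.
  by rewrite ler_wpM2l ?subr_ge0// lef_pV2 ?posrE.
move=> cs ct; have [st|/ltW ts] := leP t s; first exact: wl.
by rewrite distrC (distrC s); exact: wl.
Qed.

(** In the coordinates s = exp (- u), t = exp (- v), these recover u and v away from the edges of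
    the unit interval. The second is also kept away from t = 1, that is from v = 0, because v is a
    denominator. *)
Definition clampl c s : R := - ln (Num.max s c).
Definition clampv c t : R := - ln (Num.min (Num.max t c) (1 - c)).

Lemma clampl_lip c s t : 0 < c -> `|clampl c s - clampl c t| <= `|s - t| / c.
Proof.
move=> c0; rewrite /clampl -opprD normrN.
apply: le_trans (ln_lip c0 _ _) _; rewrite ?le_max ?lexx ?orbT//.
by rewrite ler_pM2r ?invr_gt0// max_lip.
Qed.

Lemma clampv_lip c s t : 0 < c < 2^-1 -> `|clampv c s - clampv c t| <= `|s - t| / c.
Proof.
move=> /andP[c0 c1]; rewrite /clampv -opprD normrN.
have c2 : c <= 1 - c by lra.
apply: le_trans (ln_lip c0 _ _) _; rewrite ?le_min ?le_max ?lexx ?orbT ?c2//.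
by rewrite ler_pM2r ?invr_gt0// (le_trans (min_lip _ _ _))// max_lip.
Qed.

Lemma clampl_bnd c s : 0 < c < 2^-1 -> s <= 1 -> 0 <= clampl c s <= - ln c.
Proof.
move=> /andP[c0 c1] s1; have m0 : 0 < Num.max s c by rewrite lt_max c0 orbT.
rewrite /clampl oppr_ge0 ln_le0 ?ge_max ?s1 /=; last by lra.
by rewrite lerN2 ler_ln ?posrE// le_max lexx orbT.
Qed.

Lemma clampv_bnd c t : 0 < c < 2^-1 -> - ln (1 - c) <= clampv c t <= - ln c.
Proof.
move=> /andP[c0 c1]; have c2 : c <= 1 - c by lra.
have m0 : 0 < Num.min (Num.max t c) (1 - c).
  by rewrite lt_min lt_max c0 orbT /=; lra.
rewrite /clampv !lerN2 !ler_ln ?posrE//; last by lra.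
by rewrite ge_min lexx orbT le_min le_max lexx orbT c2.
Qed.

Lemma clampl_id c u : 0 < c -> c <= expR (- u) -> clampl c (expR (- u)) = u.
Proof. by move=> c0 cu; rewrite /clampl max_l// expRK opprK. Qed.

Lemma clampv_id c u : 0 < c -> c <= expR (- u) <= 1 - c -> clampv c (expR (- u)) = u.
Proof. by move=> c0 /andP[cu cu']; rewrite /clampv max_l// min_l// expRK opprK. Qed.

Lemma ratio_lip (K dl a b a' b' : R) : 0 < dl -> 0 <= a <= K -> 0 <= a' <= K ->
  dl <= b <= K -> dl <= b' <= K ->
  `|(a - 1) / (2 * b) - (a' - 1) / (2 * b')| <=
  (K + 1) / dl ^+ 2 * (`|a - a'| + `|b - b'|).
Proof.
move=> dl0 /andP[a0 aK] /andP[a'0 a'K] /andP[b0 bK] /andP[b'0 b'K].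
have bp : 0 < b by exact: lt_le_trans b0.
have b'p : 0 < b' by exact: lt_le_trans b'0.
have -> : (a - 1) / (2 * b) - (a' - 1) / (2 * b') =
  ((a - a') * b' - (a' - 1) * (b - b')) / (2 * (b * b')).
  by field; rewrite !gt_eqF.
rewrite normrM mulrAC.
have bb : dl ^+ 2 <= b * b' by rewrite expr2 ler_pM// ltW.
have d20 : 0 < dl ^+ 2 by rewrite exprn_gt0.
rewrite [X in _ * X]ger0_norm ?invr_ge0 ?mulr_ge0 ?(ltW bp) ?(ltW b'p)//.
apply: ler_pM => //; first by rewrite invr_ge0 !mulr_ge0 ?(ltW bp) ?(ltW b'p).
  rewrite (le_trans (ler_normB _ _))// !normrM.
  have h1 : `|b'| <= K + 1 by rewrite ger0_norm ?(ltW b'p)//; lra.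
  have h2 : `|a' - 1| <= K + 1 by rewrite ler_norml; apply/andP; split; lra.
  have := ler_wpM2l (normr_ge0 (a - a')) h1.
  have := ler_wpM2r (normr_ge0 (b - b')) h2.
  by lra.
rewrite lef_pV2 ?posrE ?mulr_gt0//.
by lra.
Qed.

End cutoffs.

(** Dominated convergence, as the bump at a positive point is eventually 0. The index k.+3 makes the
    cutoff less than 1 / 2, as the clamping lemmas require. *)
Lemma bump_small {d} {T : measurableType d} {R : realType} (P : probability T R)
    (X : T -> R) : measurable_fun setT X -> (forall x, 0 <= X x) ->
  P (X @^-1` [set 0]) = 0%E ->
  (fun k => Ex P (fun x => bump k.+3%:R^-1 (X x))) @ \oo --> (0 : R).
Proof.
move=> mX X0 PX0; rewrite -[X in _ --> X](Ex_cst P 0).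
apply: (@Ex_cvg_dom _ _ _ _ _ _ (fun=> 2)).
- move=> k; apply: measurable_maxr => //; apply: measurable_funB => //.
  exact: measurable_funM.
- by move=> k x; rewrite ger0_norm ?bump_ge0// bump_le2// invr_gt0 ltr0n.
- exact: L1_cst.
- exact: measurable_cst.
exists (X @^-1` [set 0]); split => //.
  by rewrite -[X in measurable X]setTI; apply: mX => //; exact: measurable_set1.
move=> x /= /eqP Xn0; have Xp : 0 < X x by rewrite lt_def Xn0 X0.
apply: cvg_near_cst.
have X2 : 0 < X x / 2 by rewrite divr_gt0.
have h := near_infty_natSinv_lt (PosNum X2).
near=> k.
have hk : k.+1%:R^-1 < X x / 2 by near: k.
rewrite /bump invrK; apply: max_l.
have k1 : 1 < X x / 2 * k.+1%:R by rewrite -ltr_pdivrMr ?ltr0n// div1r.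
have k3 : k.+1%:R <= k.+3%:R :> R by rewrite ler_nat -(addn2 k.+1) leq_addr.
have : X x / 2 * k.+1%:R <= X x / 2 * k.+3%:R by rewrite ler_wpM2l// ltW.
by move: k1; lra.
Unshelve. all: by end_near.
Qed.

(** The obstacle is that (u - 1) / (2 v) is not continuous up to the boundary of the unit square in
    p = exp (- u), q = exp (- v). The clamped version [G] is, so [moments_cvg] applies to it; it
    differs from the ratio only where [bad] is at least 1 or the errors e1, e2 are not small. *)
Lemma ratio_cvg {d1 d2} {T : measurableType d1} {O : measurableType d2} {R : realType}
    (P : probability T R) (Q : probability O R)
    (u v e1 e2 Z : nat -> T -> R) (U V : O -> R) (f : R -> R) (M : R) :
  (forall n, measurable_fun setT (u n)) -> (forall n, measurable_fun setT (v n)) ->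
  (forall n, measurable_fun setT (e1 n)) -> (forall n, measurable_fun setT (e2 n)) ->
  (forall n, measurable_fun setT (Z n)) ->
  measurable_fun setT U -> measurable_fun setT V ->
  (forall n x, 0 <= u n x) -> (forall n x, 0 <= v n x) ->
  (forall x, 0 <= U x) -> (forall x, 0 <= V x) ->
  Q (V @^-1` [set 0]) = 0%E ->
  (forall i j : nat,
    (fun n => Ex P (fun x => expR (- (i%:R * u n x + j%:R * v n x)))) @ \oo -->
    Ex Q (fun x => expR (- (i%:R * U x + j%:R * V x)))) ->
  (fun n => Ex P (fun x => Num.min 1 (`|e1 n x| + `|e2 n x|))) @ \oo --> (0 : R) ->
  (forall n x, v n x + e2 n x != 0 ->
    Z n x = ((u n x - 1) / 2 + e1 n x) / (v n x + e2 n x)) ->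
  continuous f -> (forall x, `|f x| <= M) ->
  (fun n => Ex P (fun x => f (Z n x))) @ \oo -->
  Ex Q (fun x => f ((U x - 1) / (2 * V x))).
Proof.
move=> mu mv me1 me2 mZ mU mV u0 v0 U0 V0 QV0 lap err0 ZE cf fM.
have M0 : 0 <= M by exact: le_trans (fM 0).
have mf : measurable_fun setT f by exact: continuous_measurable_fun.
pose p n x := expR (- u n x); pose q n x := expR (- v n x).
pose p' x := expR (- U x); pose q' x := expR (- V x).
have e01 (s : R) : 0 <= s -> 0 <= expR (- s) <= 1.
  by move=> s0; rewrite expR_ge0 -[leRHS]expR0 ler_expR oppr_le0.
have mp n : measurable_fun setT (p n) by apply: measurableT_comp => //; exact: measurable_funN.
have mq n : measurable_fun setT (q n) by apply: measurableT_comp => //; exact: measurable_funN.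
have mp' : measurable_fun setT p' by apply: measurableT_comp => //; exact: measurable_funN.
have mq' : measurable_fun setT q' by apply: measurableT_comp => //; exact: measurable_funN.
have p01 n x : 0 <= p n x <= 1 by exact: e01.
have q01 n x : 0 <= q n x <= 1 by exact: e01.
have p'01 x : 0 <= p' x <= 1 by exact: e01.
have q'01 x : 0 <= q' x <= 1 by exact: e01.
have momcvg i j : (fun n => Ex P (fun x => p n x ^+ i * q n x ^+ j)) @ \oo -->
    Ex Q (fun x => p' x ^+ i * q' x ^+ j).
  have E (s t : R) : expR (- s) ^+ i * expR (- t) ^+ j = expR (- (i%:R * s + j%:R * t)).
    by rewrite -!expRM_natl -expRD; congr expR; ring.
  rewrite (_ : (fun x => p' x ^+ i * q' x ^+ j) = fun x => expR (- (i%:R * U x + j%:R * V x))).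
    rewrite (_ : (fun n => _) = fun n => Ex P (fun x => expR (- (i%:R * u n x + j%:R * v n x))))//.
    by apply/funext => n; apply: Ex_ext => x; exact: E.
  by apply/funext => x; exact: E.
have mom := moments_cvg mp mq mp' mq' p01 q01 p'01 q'01 momcvg.
apply/cvgrPdist_le => eps eps0.
(* At the end 6 M + 3 copies of e are spent: 2 M for the limit, 4 M + 2 for the sequence and 1 for
   the convergence of [G]. *)
pose e : R := eps / (6 * M + 4).
have M4 : 0 < 6 * M + 4 by lra.
have M21 : 0 < 2 * M + 1 by lra.
have e0 : 0 < e by rewrite divr_gt0.
(* The three edges are u large, v large and v near 0; the first two have no mass as exponentials are
   positive, the third by the hypothesis on V. *)
pose bad c (s t : R) := bump c s + (bump c t + bump c (1 - t)).
have q'1 x : 0 <= 1 - q' x by rewrite subr_ge0; case/andP: (q'01 x).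
have p'0 x : 0 <= p' x by case/andP: (p'01 x).
have q'0 x : 0 <= q' x by case/andP: (q'01 x).
have c1 := bump_small (P := Q) mp' p'0.
have c2 := bump_small (P := Q) mq' q'0.
have m1q' : measurable_fun setT (fun x => 1 - q' x) by exact: measurable_funB.
have c3 := bump_small (P := Q) m1q' q'1.
have {}c1 : (fun k => Ex Q (fun x => bump k.+3%:R^-1 (p' x))) @ \oo --> (0 : R).
  apply: c1; rewrite (_ : _ @^-1` _ = set0) ?measure0//.
  by apply/seteqP; split => x //= /eqP; rewrite gt_eqF ?expR_gt0.
have {}c2 : (fun k => Ex Q (fun x => bump k.+3%:R^-1 (q' x))) @ \oo --> (0 : R).
  apply: c2; rewrite (_ : _ @^-1` _ = set0) ?measure0//.
  by apply/seteqP; split => x //= /eqP; rewrite gt_eqF ?expR_gt0.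
have {}c3 : (fun k => Ex Q (fun x => bump k.+3%:R^-1 (1 - q' x))) @ \oo --> (0 : R).
  apply: c3; rewrite (_ : _ @^-1` _ = V @^-1` [set 0])//.
  apply/seteqP; split => x /=.
    move=> /eqP; rewrite subr_eq0 => /eqP h; have := expRK (- V x).
    by rewrite -/(q' x) -h ln1 => /esym/eqP; rewrite oppr_eq0 => /eqP.
  by move=> VE; rewrite /q' VE oppr0 expR0 subrr.
have mb k (X : O -> R) : measurable_fun setT X -> (forall x, 0 <= X x) ->
    L1 Q (fun x => bump k.+3%:R^-1 (X x)).
  move=> mX X0; apply: (L1_bnd Q (M := 2)).
    apply: measurable_maxr => //; apply: measurable_funB => //.
    exact: measurable_funM.
  by move=> x; rewrite ger0_norm ?bump_ge0// bump_le2// invr_gt0 ltr0n.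
have cb : (fun k => Ex Q (fun x => bad k.+3%:R^-1 (p' x) (q' x))) @ \oo --> (0 : R).
  rewrite (_ : (fun k => _) = fun k => Ex Q (fun x => bump k.+3%:R^-1 (p' x)) +
    (Ex Q (fun x => bump k.+3%:R^-1 (q' x)) + Ex Q (fun x => bump k.+3%:R^-1 (1 - q' x)))).
    have z : (0 : R) = 0 + (0 + 0) by rewrite !addr0.
    by rewrite [X in _ --> X]z; exact: (cvgD c1 (cvgD c2 c3)).
  apply/funext => k; rewrite -ExD; [|exact: mb|exact: mb].
  by rewrite -ExD; [|exact: mb|apply: L1D; exact: mb].
move/cvgrPdist_le : cb => /(_ _ e0) cb.
have [k hk] : exists k, Ex Q (fun x => bad k.+3%:R^-1 (p' x) (q' x)) <= e.
  near \oo => k; exists k; apply: le_trans (ler_norm _) _; rewrite -normrN -sub0r.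
  by near: k.
pose c : R := k.+3%:R^-1; rewrite -/c in hk.
have c0 : 0 < c by rewrite invr_gt0 ltr0n.
have c12 : 0 < c < 2^-1 by rewrite c0 /= ltf_pV2 ?posrE ?ltr0n// ltr_nat.
pose K := - ln c; pose dl := - ln (1 - c).
have c1' : 0 < 1 - c < 1 by case/andP: c12 => ? ?; apply/andP; split; lra.
have dl0 : 0 < dl by rewrite oppr_gt0 ln_lt0.
have clK s : s <= 1 -> 0 <= clampl c s <= K by exact: clampl_bnd.
have cvK t : dl <= clampv c t <= K by exact: clampv_bnd.
have dlK : dl <= K by have /andP[] := cvK 0; exact: le_trans.
have K0 : 0 < K by exact: lt_le_trans dlK.
(* The clamped ratio is at most (K + 1) / dl; the extra 1 leaves room for the perturbed ratio. *)
pose L := (K + 1) / dl + 1.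
pose G (s t : R) := f ((clampl c s - 1) / (2 * clampv c t)).
have ratio_bnd a b : 0 <= a <= K -> dl <= b <= K -> `|(a - 1) / (2 * b)| <= (K + 1) / dl.
  move=> /andP[a0 aK] /andP[b0 bK]; have bp : 0 < b by exact: lt_le_trans b0.
  rewrite normrM; apply: ler_pM => //.
    by rewrite ler_norml; apply/andP; split; lra.
  rewrite ger0_norm ?invr_ge0 ?mulr_ge0 ?(ltW bp)// lef_pV2 ?posrE ?mulr_gt0//; lra.
have Gu e' : 0 < e' -> exists2 h : R, 0 < h & forall s t s' t' : R,
    0 <= s <= 1 -> 0 <= t <= 1 -> 0 <= s' <= 1 -> 0 <= t' <= 1 ->
    `|s - s'| <= h -> `|t - t'| <= h -> `|G s t - G s' t'| <= e'.
  move=> e'0; have [h h0 hh] := heine L cf e'0.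
  pose C0 := (K + 1) / dl ^+ 2 * (2 / c).
  have C00 : 0 < C0 by rewrite mulr_gt0 ?divr_gt0 ?exprn_gt0//; lra.
  exists (h / C0); first by rewrite divr_gt0.
  move=> s t s' t' /andP[_ s1] _ /andP[_ s'1] _ ss tt; apply: hh.
  - by rewrite /L (le_trans (ratio_bnd _ _ (clK _ s1) (cvK _)))// lerDl.
  - by rewrite /L (le_trans (ratio_bnd _ _ (clK _ s'1) (cvK _)))// lerDl.
  apply: le_trans (ratio_lip dl0 (clK _ s1) (clK _ s'1) (cvK _) (cvK _)) _.
  have := clampl_lip s s' c0; have := clampv_lip t t' c12.
  have ss2 : `|s - s'| / c <= h / C0 / c by rewrite ler_pM2r ?invr_gt0.
  have tt2 : `|t - t'| / c <= h / C0 / c by rewrite ler_pM2r ?invr_gt0.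
  move=> l1 l2; apply: le_trans (_ : (K + 1) / dl ^+ 2 * (h / C0 / c + h / C0 / c) <= _).
    apply: ler_wpM2l; first by rewrite divr_ge0 ?sqr_ge0// addr_ge0// (ltW K0).
    by apply: lerD; [exact: le_trans l2 ss2|exact: le_trans l1 tt2].
  rewrite le_eqVlt; apply/orP; left; apply/eqP.
  have Kn0 : K + 1 != 0 by rewrite gt_eqF//; lra.
  by rewrite /C0; field; rewrite Kn0 !gt_eqF.
have [mGn mG' cG] := mom G M (fun s t _ _ => fM _) Gu.
have badb (s t : R) : 0 <= s <= 1 -> 0 <= t <= 1 -> `|bad c s t| <= 6.
  move=> /andP[s0 s1] /andP[t0 t1]; rewrite ger0_norm ?addr_ge0 ?bump_ge0//.
  have := bump_le2 c0 s0; have := bump_le2 c0 t0.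
  have : 0 <= 1 - t by rewrite subr_ge0.
  by move=> /(bump_le2 c0); rewrite /bad; lra.
have badu e' : 0 < e' -> exists2 h : R, 0 < h & forall s t s' t' : R,
    0 <= s <= 1 -> 0 <= t <= 1 -> 0 <= s' <= 1 -> 0 <= t' <= 1 ->
    `|s - s'| <= h -> `|t - t'| <= h -> `|bad c s t - bad c s' t'| <= e'.
  move=> e'0; exists (e' * c / 3); first by rewrite divr_gt0// mulr_gt0.
  move=> s t s' t' _ _ _ _ ss tt.
  have l1 := bump_lip s s' c0; have l2 := bump_lip t t' c0.
  have l3 := bump_lip (1 - t) (1 - t') c0.
  have tE : 1 - t - (1 - t') = - (t - t') by ring.
  rewrite tE normrN in l3.
  have s2 : `|s - s'| / c <= e' / 3.
    by rewrite ler_pdivrMr// (le_trans ss)// mulrAC.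
  have t2 : `|t - t'| / c <= e' / 3.
    by rewrite ler_pdivrMr// (le_trans tt)// mulrAC.
  have -> : bad c s t - bad c s' t' = (bump c s - bump c s') +
    ((bump c t - bump c t') + (bump c (1 - t) - bump c (1 - t'))) by rewrite /bad; ring.
  by rewrite (le_trans (ler_normD _ _))// (le_trans (lerD (lexx _) (ler_normD _ _)))//; lra.
(* Applied to [bad] itself, the same convergence carries smallness from the limit to the sequence,
   in place of a separate tightness argument. *)
have [mbn mb' cbad] := mom (bad c) 6 badb badu.
pose C1 := 2 * (2 * K + 1) / dl ^+ 2.
have C10 : 0 < C1 by rewrite divr_gt0 ?exprn_gt0//; lra.
have [h h0 hh] := heine L cf e0.
(* Below 1 / 2 the truncation at 1 in [err] is inactive, below dl / 2 the denominator stays above dl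
   / 2, and the last bound moves the ratio by at most min h 1, with C1 = (2 K + 1) / (dl * dl /
   2). *)
pose eta := Num.min (1 / 2) (Num.min (dl / 2) (Num.min h 1 / C1)).
have hm0 : 0 < Num.min h 1 by rewrite lt_min h0 ltr01.
have eta0 : 0 < eta.
  by rewrite /eta lt_min divr_gt0//= lt_min divr_gt0//= divr_gt0.
have eta1 : eta <= 1 / 2 by rewrite ge_min lexx.
have eta2 : eta <= dl / 2 by rewrite !ge_min lexx orbT.
have eta3 : eta * C1 <= Num.min h 1.
  by rewrite -ler_pdivlMr// !ge_min lexx !orbT.
pose err n x := Num.min 1 (`|e1 n x| + `|e2 n x|).
have good (s t : R) : bad c s t < 1 -> [/\ c <= s, c <= t & t <= 1 - c].
  move=> b1; have b := bump_ge0 c s; have b' := bump_ge0 c t; have b'' := bump_ge0 c (1 - t).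
  split; rewrite leNgt; apply/negP => /ltW h1; move: b1; apply/negP; rewrite -leNgt /bad.
  - by have := bump_ge1 c0 h1; lra.
  - by have := bump_ge1 c0 h1; lra.
  - have h2 : 1 - t <= c by lra.
    by have := bump_ge1 c0 h2; lra.
have f2M (a b : R) : `|f a - f b| <= 2 * M.
  by rewrite (le_trans (ler_normB _ _))//; have := fM a; have := fM b; lra.
have bad0 s t : 0 <= bad c s t by rewrite !addr_ge0 ?bump_ge0.
have err_ge0 n x : 0 <= err n x by rewrite le_min ler01 addr_ge0.
have pt n x : `|f (Z n x) - G (p n x) (q n x)| <=
    e + 2 * M * bad c (p n x) (q n x) + 2 * M / eta * err n x.
  have k1 : 0 <= 2 * M * bad c (p n x) (q n x) by rewrite !mulr_ge0.
  have k2 : 0 <= 2 * M / eta * err n x.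
    by rewrite mulr_ge0// divr_ge0 ?(ltW eta0)// mulr_ge0.
  have [b1|b1] := leP 1 (bad c (p n x) (q n x)).
    have : 2 * M <= 2 * M * bad c (p n x) (q n x).
      by rewrite -[leLHS]mulr1 ler_wpM2l// mulr_ge0.
    by have := f2M (Z n x) ((clampl c (p n x) - 1) / (2 * clampv c (q n x))); rewrite -/(G _ _); lra.
  have [er|er] := leP eta (err n x).
    have : 2 * M <= 2 * M / eta * err n x.
      rewrite -mulrA -[leLHS]mulr1 ler_wpM2l ?mulr_ge0//.
      by rewrite mulrC ler_pdivlMr// mul1r.
    by have := f2M (Z n x) ((clampl c (p n x) - 1) / (2 * clampv c (q n x))); rewrite -/(G _ _); lra.
  apply: le_trans (_ : e <= _); last by lra.
  have [g1 g2 g3] := good _ _ b1.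
  have ulam : clampl c (p n x) = u n x by exact: clampl_id.
  have vlam : clampv c (q n x) = v n x by apply: clampv_id => //; rewrite g2 g3.
  have /andP[p0 p1] := p01 n x.
  have := clK _ p1; rewrite ulam => /andP[_ uK].
  have := cvK (q n x); rewrite vlam => /andP[vdl vK].
  have {}er : `|e1 n x| + `|e2 n x| < eta.
    move: er; rewrite /err; have [h1|//] := leP 1 (`|e1 n x| + `|e2 n x|).
    by lra.
  have n1 := normr_ge0 (e1 n x); have n2 := normr_ge0 (e2 n x).
  have e1e : `|e1 n x| <= eta by lra.
  have e2e : `|e2 n x| <= eta by lra.
  have vpos : dl / 2 <= v n x + e2 n x.
    by move: e2e; rewrite ler_norml => /andP[? _]; lra.
  have vp : 0 < v n x + e2 n x by apply: lt_le_trans vpos; rewrite divr_gt0.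
  have vp0 : 0 < v n x by exact: lt_le_trans vdl.
  have uvb := ratio_bnd (u n x) (v n x).
  rewrite /G ulam vlam ZE ?gt_eqF//.
  set Zn := (_ + _) / _; set r := (_ - 1) / _.
  have dist : `|Zn - r| <= eta * C1.
    have -> : Zn - r = (e1 n x * v n x - e2 n x * ((u n x - 1) / 2)) / (v n x * (v n x + e2 n x)).
      by rewrite /Zn /r; field; rewrite !gt_eqF.
    have -> : eta * C1 = (eta * (2 * K + 1)) / (dl * (dl / 2)).
      by rewrite /C1; field; rewrite gt_eqF.
    rewrite normrM; apply: ler_pM => //.
      rewrite (le_trans (ler_normB _ _))// !normrM.
      have h1 : `|v n x| <= K by rewrite ger0_norm ?(ltW vp0).
      have h2 : `|u n x - 1| <= K + 1.
        by have := u0 n x; move=> ?; rewrite ler_norml; apply/andP; split; lra.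
      have h3 : `|2^-1| = 2^-1 :> R by rewrite ger0_norm// invr_ge0.
      have := ler_pM (normr_ge0 _) (normr_ge0 _) e1e h1.
      have := ler_pM (normr_ge0 _) (normr_ge0 _) e2e h2.
      rewrite h3; have := mulr_ge0 (ltW eta0) (ltW K0); lra.
    rewrite ger0_norm ?invr_ge0 ?mulr_ge0 ?(ltW vp) ?(ltW vp0)//.
    rewrite lef_pV2 ?posrE ?mulr_gt0 ?divr_gt0//.
    by apply: ler_pM => //; rewrite ltW// divr_gt0.
  have rL : `|r| <= (K + 1) / dl by apply: uvb; [rewrite u0|rewrite vdl].
  have [d1' d2'] : `|Zn - r| <= h /\ `|Zn - r| <= 1.
    by split; apply: (le_trans (le_trans dist eta3)); rewrite ge_min lexx ?orbT.
  apply: hh => //; last by rewrite (le_trans rL)// lerDl.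
  have -> : Zn = r + (Zn - r) by ring.
  by rewrite (le_trans (ler_normD _ _))// lerD.
have mlim : measurable_fun setT (fun x => f ((U x - 1) / (2 * V x))).
  apply: measurableT_comp => //; apply: measurable_funM; first exact: measurable_funB.
  by apply: (measurableT_comp measurable_invr); exact: measurable_funM.
have pt' x : `|f ((U x - 1) / (2 * V x)) - G (p' x) (q' x)| <= 2 * M * bad c (p' x) (q' x).
  have [b1|b1] := leP 1 (bad c (p' x) (q' x)).
    apply: le_trans (f2M _ _) _.
    by rewrite -[leLHS]mulr1 ler_wpM2l// mulr_ge0.
  have [g1 g2 g3] := good _ _ b1.
  have ulam : clampl c (p' x) = U x by exact: clampl_id.
  have vlam : clampv c (q' x) = V x by apply: clampv_id => //; rewrite g2 g3.
  by rewrite /G ulam vlam subrr normr0 !mulr_ge0.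
have ifZ n : L1 P (fun x => f (Z n x)).
  by apply: (L1_bnd P (M := M)) => //; exact: measurableT_comp.
have iflim : L1 Q (fun x => f ((U x - 1) / (2 * V x))) by exact: (L1_bnd Q (M := M)).
have iGn n : L1 P (fun x => G (p n x) (q n x)) by apply: (L1_bnd P (M := M)) => // x; exact: fM.
have iG' : L1 Q (fun x => G (p' x) (q' x)) by apply: (L1_bnd Q (M := M)) => // x; exact: fM.
have ibn n : L1 P (fun x => bad c (p n x) (q n x)).
  by apply: (L1_bnd P (M := 6)) => // x; exact: badb.
have ib' : L1 Q (fun x => bad c (p' x) (q' x)).
  by apply: (L1_bnd Q (M := 6)) => // x; exact: badb.
have ierr n : L1 P (err n).
  apply: (L1_bnd P (M := 1)).
    apply: measurable_minr => //.
    by apply: measurable_funD; exact: measurableT_comp.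
  by move=> x; rewrite ger0_norm// ge_min lexx.
have k1 : `|Ex Q (fun x => f ((U x - 1) / (2 * V x))) - Ex Q (fun x => G (p' x) (q' x))| <= 2 * M * e.
  rewrite -ExB//; apply: le_trans (Ex_norm (L1B iflim iG')) _.
  apply: le_trans (_ : 2 * M * Ex Q (fun x => bad c (p' x) (q' x)) <= _); last first.
    by rewrite ler_wpM2l// mulr_ge0.
  by rewrite -ExZ//; apply: Ex_le => //; [apply: L1_norm; exact: L1B|exact: L1Z].
have k2 n : `|Ex P (fun x => f (Z n x)) - Ex P (fun x => G (p n x) (q n x))| <=
    e + 2 * M * Ex P (fun x => bad c (p n x) (q n x)) + 2 * M / eta * Ex P (err n).
  rewrite -ExB//; apply: le_trans (Ex_norm (L1B (ifZ n) (iGn n))) _.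
  have -> : e + 2 * M * Ex P (fun x => bad c (p n x) (q n x)) + 2 * M / eta * Ex P (err n) =
      Ex P (fun x => e + 2 * M * bad c (p n x) (q n x) + 2 * M / eta * err n x).
    rewrite (ExD (L1D (L1_cst P e) (L1Z _ (ibn n))) (L1Z _ (ierr n))).
    by rewrite (ExD (L1_cst P e) (L1Z _ (ibn n))) Ex_cst !ExZ.
  apply: Ex_le => //; first by apply: L1_norm; exact: L1B.
  by apply: L1D; [apply: L1D; [exact: L1_cst|exact: L1Z]|exact: L1Z].
have [e'' e''0 he''] : exists2 e'' : R, 0 < e'' & 2 * M / eta * e'' <= e.
  exists (e * eta / (2 * M + 1)); first by rewrite divr_gt0// mulr_gt0.
  have -> : 2 * M / eta * (e * eta / (2 * M + 1)) = e * (2 * M / (2 * M + 1)).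
    by field; rewrite !gt_eqF.
  by rewrite -[leRHS]mulr1 ler_wpM2l ?(ltW e0)// ler_pdivrMr// mul1r lerDl.
move/cvgrPdist_le : err0 => /(_ _ e''0) err0.
move/cvgrPdist_le : cbad => /(_ _ e0) cbad.
move/cvgrPdist_le : cG => /(_ _ e0) cG.
near=> n.
have z1 : `|0 - Ex P (err n)| <= e'' by near: n; exact: err0.
have z2 : `|Ex Q (fun x => bad c (p' x) (q' x)) - Ex P (fun x => bad c (p n x) (q n x))| <= e.
  by near: n; exact: cbad.
have z3 : `|Ex Q (fun x => G (p' x) (q' x)) - Ex P (fun x => G (p n x) (q n x))| <= e.
  by near: n; exact: cG.
have y1 : 2 * M / eta * Ex P (err n) <= e.
  apply: le_trans he''; rewrite ler_wpM2l ?divr_ge0 ?(ltW eta0) ?mulr_ge0//.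
  by rewrite sub0r normrN in z1; apply: le_trans z1; exact: ler_norm.
have y2 : 2 * M * Ex P (fun x => bad c (p n x) (q n x)) <= 2 * M * (2 * e).
  rewrite ler_wpM2l ?mulr_ge0//; move: z2; rewrite ler_norml => /andP[? ?].
  by lra.
have := k2 n.
have epsE : eps = (6 * M + 4) * e by rewrite /e; field; rewrite gt_eqF.
have Me : 0 <= M * e by rewrite mulr_ge0// ltW.
move: k1 z3; rewrite epsE !ler_norml => /andP[? ?] /andP[? ?] /andP[? ?].
by apply/andP; split; lra.
Unshelve. all: by end_near.
Qed.

(** * Gaussian moments *)

Section gauss_moments.
Context {R : realType}.
Notation mu := (@lebesgue_measure R).

Context {d : measure_display} {O : measurableType d} (Q : probability O R).
Variables (X : O -> R) (s : R).
Hypothesis mX : measurable_fun setT X.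
Hypothesis s0 : 0 < s.
Hypothesis lawX : forall A, measurable A -> Q (X @^-1` A) = normal_prob 0 s A.

Lemma ge0_integral_normal_law (h : R -> R) : measurable_fun setT h ->
  (forall x, 0 <= h x) ->
  (\int[Q]_w (h (X w))%:E = \int[mu]_x (h x * normal_pdf 0 s x)%:E)%E.
Proof.
move=> mh h0.
pose XR : O -> measurableTypeR R := X.
have mXR : measurable_fun setT XR by exact: mX.
pose X' : {RV Q >-> measurableTypeR R} :=
  HB.pack XR (isMeasurableFun.Build _ _ _ _ XR mXR).
have {}mh : measurable_fun [set: measurableTypeR R] h by exact: mh.
pose nu := distribution Q X'.
have nuE (A : set (measurableTypeR R)) : measurable A -> nu A = normal_prob 0 s A by exact: lawX.
have dom : nu `<< mu.
  have /null_content_dominatesP nd := normal_prob_dominates (0 : R) s.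
  apply/null_content_dominatesP => A mA A0.
  exact: (etrans (nuE _ mA) (nd _ mA A0)).
have mhE : measurable_fun setT (EFin \o h) by exact/measurable_EFinP.
transitivity (\int[nu]_y (h y)%:E)%E.
  by rewrite ge0_integral_distribution//; exact/measurable_EFinP.
have := @Radon_Nikodym_SigmaFinite.change_of_variables _ _ _ nu mu dom
  (EFin \o h) setT _ measurableT mhE.
move=> <-; last by move=> x; rewrite lee_fin.
have iRN := Radon_Nikodym_SigmaFinite.f_integrable dom.
have mpdf : measurable_fun setT (fun x => (normal_pdf 0 s x)%:E).
  by apply/measurable_EFinP; exact: measurable_normal_pdf.
apply: ae_eq_integral => //.
- by apply: emeasurable_funM => //; exact: measurable_int iRN.
- apply/measurable_EFinP; apply: measurable_funM => //; exact: measurable_normal_pdf.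
under [X in ae_eq _ _ _ X]eq_fun do rewrite EFinM.
apply: ae_eqe_mul2l.
apply: integral_ae_eq => //.
move=> E _ mE; apply: etrans (nuE _ mE).
by apply/esym; exact: Radon_Nikodym_SigmaFinite.f_integral.
Qed.

(** Exponential tilting: when h times the density is c times another normal density, total mass 1 of
    the latter gives the expectation. Changing the variance yields [gauss_laplace], shifting the
    mean yields [gauss_mgf]. *)
Lemma L1_gauss_ratio (h : R -> R) (m s' c : R) : measurable_fun setT h ->
  (forall x, 0 <= h x) -> 0 < c ->
  (forall x, h x * normal_pdf 0 s x = c * normal_pdf m s' x) ->
  L1 Q (h \o X) /\ Ex Q (h \o X) = c.
Proof.
move=> mh h0 c0 hE.
have E : (\int[Q]_w (h (X w))%:E = c%:E)%E.
  rewrite ge0_integral_normal_law//; under eq_integral do rewrite hE EFinM.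
  rewrite ge0_integralZl//.
  - by rewrite integral_normal_pdf mule1.
  - by apply/measurable_EFinP; exact: measurable_normal_pdf.
  - by move=> x _; rewrite lee_fin normal_pdf_ge0.
  - by rewrite lee_fin ltW.
split; last by rewrite /Ex /Rintegral E.
apply: L1_ge0; [exact: measurableT_comp|by move=> w; exact: h0|].
by apply: le_lt_trans (ltry c); rewrite -E.
Qed.

Lemma gauss_laplace (k : R) : 0 < k ->
  L1 Q (fun w => expR (- ((k ^+ 2 - 1) * (X w ^+ 2 / (s ^+ 2 *+ 2))))) /\
  Ex Q (fun w => expR (- ((k ^+ 2 - 1) * (X w ^+ 2 / (s ^+ 2 *+ 2))))) = k^-1.
Proof.
move=> k0; have sk0 : 0 < s / k by rewrite divr_gt0.
have sn0 : s != 0 by rewrite gt_eqF.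
have kn0 : k != 0 by rewrite gt_eqF.
apply: (@L1_gauss_ratio (fun x => expR (- ((k ^+ 2 - 1) * (x ^+ 2 / (s ^+ 2 *+ 2))))) 0 (s / k)).
- apply: measurableT_comp => //; apply: measurable_funN.
  apply: measurable_funM => //; apply: measurable_funM => //.
- by move=> x; exact: expR_ge0.
- by rewrite invr_gt0.
move=> x; rewrite !normal_pdfE ?(gt_eqF sk0)//.
rewrite /normal_fun subr0 mulrCA -expRD.
have pk : normal_peak (s / k) = k * normal_peak s.
  rewrite /normal_peak.
  have -> : (s / k) ^+ 2 * pi *+ 2 = k^-1 ^+ 2 * (s ^+ 2 * pi *+ 2).
    by field.
  rewrite sqrtrM ?sqr_ge0// sqrtr_sqr ger0_norm ?invr_ge0 ?(ltW k0)//.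
  by rewrite invfM invrK.
rewrite pk -[X in _ = _ * X]mulrA mulKf//; congr (_ * expR _).
by field; rewrite sn0 kn0.
Qed.

Lemma gauss_mgf (t : R) :
  L1 Q (fun w => expR (t * X w)) /\
  Ex Q (fun w => expR (t * X w)) = expR (t ^+ 2 * s ^+ 2 / 2).
Proof.
have sn0 : s != 0 by rewrite gt_eqF.
apply: (@L1_gauss_ratio (fun x => expR (t * x)) (t * s ^+ 2) s).
- by apply: measurableT_comp => //; exact: measurable_funM.
- by move=> x; exact: expR_ge0.
- exact: expR_gt0.
move=> x; rewrite !normal_pdfE// /normal_fun subr0 mulrCA [RHS]mulrCA -!expRD.
congr (_ * expR _).
by field.
Qed.

Let z w := X w ^+ 2 / (s ^+ 2 *+ 2).

Let z0 w : 0 <= z w.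
Proof. by rewrite divr_ge0 ?sqr_ge0// mulrn_wge0// sqr_ge0. Qed.

Let zE w : X w ^+ 2 = s ^+ 2 * 2 * z w.
Proof. by rewrite /z; field; rewrite gt_eqF. Qed.

Let mz : measurable_fun setT z.
Proof. by apply: measurable_funM => //; exact: measurable_funX. Qed.

Let ez_L1 : L1 Q (fun w => expR (z w / 2)) /\ Ex Q (fun w => expR (z w / 2)) <= 2.
Proof.
(* For k = 1 / sqrt 2 the exponent - (k^2 - 1) z is + z / 2, a positive exponential moment of value
   sqrt 2 <= 2. *)
have h2 : 0 < (Num.sqrt 2)^-1 :> R by rewrite invr_gt0 sqrtr_gt0.
have [i e] := gauss_laplace h2.
have E w : expR (- ((((Num.sqrt 2)^-1) ^+ 2 - 1) * (X w ^+ 2 / (s ^+ 2 *+ 2)))) = expR (z w / 2).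
  by rewrite -/(z w) exprVn sqr_sqrtr//; congr expR; field.
split; first by apply: L1_ext i E.
rewrite -(Ex_ext Q E) e invrK -[leRHS]ger0_norm// -sqrtr_sqr ler_sqrt ?sqr_ge0//.
by rewrite expr2; lra.
Qed.

Let z_L1 : L1 Q z.
Proof.
apply: (L1_le mz _ (L1Z 2 (proj1 ez_L1))) => w; rewrite ger0_norm//.
by have := expR_ge1Dx (z w / 2); lra.
Qed.

Lemma gauss_L2 : L1 Q (fun w => X w ^+ 2).
Proof. by apply: (L1_ext (L1Z (s ^+ 2 * 2) z_L1)) => w; rewrite zE. Qed.

(* Both sides of E e^{-(k^2-1)z} = 1/k >= 1 - (k^2-1) E z near k = 1. *)
Lemma gauss_var : Ex Q (fun w => X w ^+ 2) = s ^+ 2.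
Proof.
have -> : Ex Q (fun w => X w ^+ 2) = s ^+ 2 * 2 * Ex Q z.
  by rewrite -ExZ//; apply: Ex_ext => w; rewrite zE.
suff -> : Ex Q z = 2^-1 by field.
set c := Ex Q z; have c0 : 0 <= c by exact: Ex_ge0.
have key (k : R) : 0 < k -> 1 - (k ^+ 2 - 1) * c <= k^-1.
  move=> k0; have [i <-] := gauss_laplace k0.
  rewrite -[X in X - _](Ex_cst Q) -ExZ// -ExB; [|exact: L1_cst|exact: L1Z].
  apply: Ex_le => //; first by apply: L1B; [exact: L1_cst|exact: L1Z].
  by move=> w; apply: le_trans (expR_ge1Dx _); rewrite -/(z w).
have key2 (k : R) : 0 < k -> k - (k ^+ 2 - 1) * k * c <= 1.
  move=> k0; have := ler_wpM2l (ltW k0) (key k k0).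
  by rewrite mulfV ?gt_eqF//; lra.
apply/eqP; rewrite eq_le; apply/andP; split; rewrite leNgt; apply/negP => hc.
- have c1 : 0 < c by lra.
  (* At k = 1 - dl the first-order gain is dl (2 c - 1) and the second-order loss 3 c dl^2; this dl
     makes the loss half of the gain. The other case tests k = 1 + dl. *)
  pose dl := (2 * c - 1) / (6 * c).
  have dc : dl * (6 * c) = 2 * c - 1 by rewrite /dl; field; rewrite gt_eqF.
  have dl0 : 0 < dl by rewrite divr_gt0//; lra.
  have dl1 : dl < 1 by rewrite ltr_pdivrMr; lra.
  have h1 : 0 < 1 - dl by lra.
  have := key2 _ h1.
  have -> : 1 - dl - ((1 - dl) ^+ 2 - 1) * (1 - dl) * c =
    1 + dl * ((2 * c - 1) - dl * (6 * c) / 2 + dl ^+ 2 * c) by field.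
  rewrite dc => h2.
  have : 0 < dl * (2 * c - 1 - (2 * c - 1) / 2 + dl ^+ 2 * c).
    have q : 0 <= dl ^+ 2 * c by rewrite mulr_ge0 ?sqr_ge0.
    by apply: mulr_gt0 => //; lra.
  by lra.
- pose dl := (1 - 2 * c) / 8.
  have dl0 : 0 < dl by rewrite divr_gt0//; lra.
  have dl1 : dl <= 1 / 8 by rewrite /dl; lra.
  have h1 : 0 < 1 + dl by lra.
  have := key2 _ h1.
  have -> : 1 + dl - ((1 + dl) ^+ 2 - 1) * (1 + dl) * c =
    1 + dl * (1 - 2 * c - dl * 3 * c - dl * dl * c) by ring.
  have h3 : dl * dl * c <= dl * c.
    have dlc : 0 <= dl * c by exact: mulr_ge0 (ltW dl0) c0.
    have dl11 : dl <= 1 by lra.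
    by have := ler_wpM2r dlc dl11; lra.
  have h4 : dl * c <= dl * (1 / 2) by rewrite ler_wpM2l ?(ltW dl0)//; lra.
  have h5 : dl * 8 = 1 - 2 * c by rewrite /dl; field.
  have : 0 < dl * (1 - 2 * c - dl * 3 * c - dl * dl * c) by apply: mulr_gt0 => //; lra.
  by lra.
Qed.

(** From exp x >= 1 + x, 1 + t b <= exp (t^2 s^2 / 2) for all t. Near t = 0 the right side exceeds 1
    only to second order, so b = 0. *)
Lemma gauss_mean : Ex Q X = 0.
Proof.
have iX := L2_L1 mX gauss_L2.
set b := Ex Q X; apply/eqP/negPn/negP => b0.
have key t : 1 + t * b <= expR (t ^+ 2 * s ^+ 2 / 2).
  have [i <-] := gauss_mgf t.
  rewrite -[X in X + _](Ex_cst Q) -ExZ// -ExD; [|exact: L1_cst|exact: L1Z].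
  apply: Ex_le => //; first by apply: L1D; [exact: L1_cst|exact: L1Z].
  by move=> w; exact: expR_ge1Dx.
(* Small enough that both rho s^2 and rho b^2 are below 1; the test value is t = rho b. *)
pose rho := (2 * (b ^+ 2 + 1) * (s ^+ 2 + 1))^-1.
have b2 : 0 < b ^+ 2 by rewrite exprn_even_gt0.
have s2 : 0 < s ^+ 2 by rewrite exprn_gt0.
have rho0 : 0 < rho by rewrite invr_gt0 !mulr_gt0//; lra.
have D0 : 0 < 2 * (b ^+ 2 + 1) * (s ^+ 2 + 1) by rewrite -invr_gt0.
have rho1 : rho * (2 * (b ^+ 2 + 1) * (s ^+ 2 + 1)) = 1 by rewrite mulVf// gt_eqF.
have rs : rho * s ^+ 2 < 1.
  rewrite -rho1 ltr_pM2l//.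
  have : 0 < b ^+ 2 * s ^+ 2 by exact: mulr_gt0.
  by nra.
have rb : rho * b ^+ 2 < 1.
  rewrite -rho1 ltr_pM2l//.
  have : 0 < b ^+ 2 * s ^+ 2 by exact: mulr_gt0.
  by nra.
pose w := (rho * b) ^+ 2 * s ^+ 2 / 2.
have w0 : 0 <= w by rewrite divr_ge0// mulr_ge0// sqr_ge0.
have wE : w = (rho * b ^+ 2) * (rho * s ^+ 2) / 2 by rewrite /w; ring.
have w1 : w <= 1 / 2.
  rewrite wE ler_wpM2r ?invr_ge0// mulr_ile1 ?(ltW rs) ?(ltW rb)//.
    by rewrite mulr_ge0 ?(ltW rho0) ?(ltW b2).
  by rewrite mulr_ge0 ?(ltW rho0) ?(ltW s2).
have ew : expR w <= 1 + 2 * w.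
  have := expR_ge1Dx (- w); rewrite expRN => h.
  have ww : (1 - w) * expR w <= 1.
    by have := ler_wpM2r (expR_ge0 w) h; rewrite mulVf ?gt_eqF ?expR_gt0.
  have e1 := expR_gt0 w; have : expR w * (1 - 2 * w) * 1 <= expR w * 1 by nra.
  have e2 : expR w <= 2 by nra.
  by nra.
have := le_trans (key (rho * b)) ew.
have -> : rho * b * b = rho * b ^+ 2 by ring.
rewrite lerD2l wE => h.
have rb0 : 0 < rho * b ^+ 2 by exact: mulr_gt0.
have : rho * b ^+ 2 * (rho * s ^+ 2) < rho * b ^+ 2 * 1 by rewrite ltr_pM2l.
by lra.
Qed.

(** With y = |X| / s, y^3 <= y^2 + y^4 <= 65 (1 + y^2 / 8)^2 <= 65 exp (y^2 / 4), and the last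
    exponential has mean at most 2, whence 130. *)
Lemma gauss_third : Ex Q (fun w => X w ^+ 2 * Num.min 1 `|X w|) <= 130 * s ^+ 3.
Proof.
have [ie Ee] := ez_L1.
apply: le_trans (_ : (65 * s ^+ 3) * Ex Q (fun w => expR (z w / 2)) <= _); last first.
  have : 0 <= 65 * s ^+ 3 by rewrite mulr_ge0// exprn_ge0// ltW.
  by move=> /ler_wpM2l - /(_ _ _ Ee); lra.
rewrite -ExZ//; apply: Ex_le; [|exact: L1Z|].
  apply: (L1_le _ _ gauss_L2).
    apply: measurable_funM; first exact: measurable_funX.
    by apply: measurable_minr => //; exact: measurableT_comp.
  move=> w; rewrite ger0_norm; last by rewrite mulr_ge0 ?sqr_ge0// le_min ler01 normr_ge0.
  by rewrite -[leRHS]mulr1 ler_wpM2l ?sqr_ge0// ge_min lexx.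
move=> w; apply: le_trans (_ : X w ^+ 2 * `|X w| <= _).
  by rewrite ler_wpM2l ?sqr_ge0// ge_min lexx orbT.
pose y := `|X w| / s.
have y0 : 0 <= y by rewrite divr_ge0// ltW.
have XE : `|X w| = s * y by rewrite /y; field; rewrite gt_eqF.
rewrite -(real_normK (num_real (X w))) XE.
have -> : (s * y) ^+ 2 * (s * y) = s ^+ 3 * y ^+ 3 by ring.
have -> : 65 * s ^+ 3 * expR (z w / 2) = s ^+ 3 * (65 * expR (z w / 2)) by ring.
apply: ler_wpM2l; first by rewrite exprn_ge0// ltW.
have zy : z w / 2 = y ^+ 2 / 4.
  by rewrite /z -(real_normK (num_real (X w))) XE; field; rewrite gt_eqF.
have -> : expR (z w / 2) = expR (y ^+ 2 / 8) ^+ 2.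
  by rewrite zy -expRM_natl; congr expR; field.
have e1 : 1 + y ^+ 2 / 8 <= expR (y ^+ 2 / 8) by exact: expR_ge1Dx.
have q0 : 0 <= y ^+ 2 by exact: sqr_ge0.
apply: le_trans (_ : 65 * (1 + y ^+ 2 / 8) ^+ 2 <= _); last first.
  by rewrite ler_wpM2l// ler_sqr ?nnegrE ?expR_ge0//; lra.
have : y ^+ 3 <= y ^+ 2 + (y ^+ 2) ^+ 2.
  have := mulr_ge0 q0 (sqr_ge0 (y - 1)); have := mulr_ge0 q0 y0.
  have -> : y ^+ 3 = y ^+ 2 * y by ring.
  by nra.
by nra.
Qed.

End gauss_moments.

(** * Riemann sums along continuous paths *)

Section riemann.
Context {R : realType}.
Notation mu := (@lebesgue_measure R).
Variable x : R -> R.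
Hypothesis cx : continuous x.

(** The primitive starts at -1 and is used up to 2, so that 0 and 1 are interior points where it is
    differentiable. *)
Let F (t : R) : R := Rintegral mu `[-1, t] x.

Let ix (a b : R) : mu.-integrable `[a, b] (EFin \o x).
Proof.
apply: continuous_compact_integrable; first exact: segment_compact.
exact: continuous_subspaceT.
Qed.

Let dF (t : R) : -1 < t -> t < 2 -> is_derive t 1 F (x t).
Proof.
move=> t1 t2; have [dF' F'] := continuous_FTC1_closed t2 (ix (-1) 2) t1 (@cx t).
apply: DeriveDef; first exact: dF'.
by rewrite -derive1E; exact: F'.
Qed.

Let F01 : F 1 - F 0 = Rintegral mu `[0, 1] x.
Proof.
rewrite /F (@Rintegral_itvB _ x (BLeft (-1)) (BRight 1) 0)//.
- rewrite Rintegral_itv_obnd_cbnd//.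
  by apply: integrableS (ix 0 1) => //; exact: subset_itv_oc_cc.
- by rewrite bnd_simp; lra.
- by rewrite bnd_simp ler01.
Qed.

Let mvt (a b : R) : 0 <= a -> a < b -> b <= 1 ->
  exists2 c, a < c < b & F b - F a = x c * (b - a).
Proof.
move=> a0 ab b1.
have [||c] := @MVT _ F x a b ab.
- by move=> t; rewrite in_itv/= => /andP[ta tb]; apply: dF; lra.
- apply: derivable_within_continuous => t; rewrite in_itv/= => /andP[ta tb].
  by have [] := @dF t _ _ => //; lra.
by rewrite in_itv/=; exists c.
Qed.

(** By the mean value theorem each increment of the primitive over a grid cell is x(c) / n for some
    c in the cell, and uniform continuity compares x(c) with the value at the left end. *)
Lemma riemann_cvg :
  (fun n => n%:R^-1 * \sum_(0 <= i < n) x (i%:R / n%:R)) @ \oo -->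
  Rintegral mu `[0, 1] x.
Proof.
apply/cvgrPdist_le => e e0; have [h h0 hh] := heine 1 cx e0.
have [N _ hN] := near_infty_natSinv_lt (PosNum h0).
exists N.+1 => // -[//|n] /= Nn.
have n1 : n.+1%:R^-1 < h by exact: (hN n).
have n0 : 0 < n.+1%:R :> R by rewrite ltr0n.
have nV0 : 0 < n.+1%:R^-1 :> R by rewrite invr_gt0.
rewrite -F01.
have tel : F 1 - F 0 = \sum_(0 <= i < n.+1) (F (i.+1%:R / n.+1%:R) - F (i%:R / n.+1%:R)).
  by rewrite (telescope_sumr (fun i => F (i%:R / n.+1%:R)))// mul0r divff ?gt_eqF.
rewrite tel mulr_sumr -sumrB.
apply: le_trans (ler_norm_sum _ _ _) _.
apply: le_trans (_ : \sum_(0 <= i < n.+1) e * n.+1%:R^-1 <= _); last first.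
  by rewrite sumr_const_nat subn0 -[leLHS]mulr_natr mulfVK ?gt_eqF.
apply: ler_sum_nat => i /andP[_ iN].
have iE : i.+1%:R / n.+1%:R - i%:R / n.+1%:R = n.+1%:R^-1 :> R.
  by rewrite -mulrBl -natr1 addrAC subrr add0r mul1r.
have i0 : 0 <= i%:R / n.+1%:R :> R by rewrite divr_ge0.
have i1 : i.+1%:R / n.+1%:R <= 1 :> R by rewrite ler_pdivrMr// mul1r ler_nat.
have ilt : i%:R / n.+1%:R < i.+1%:R / n.+1%:R :> R by rewrite -subr_gt0 iE.
have [c /andP[ic ci] ->] := mvt i0 ilt i1.
rewrite iE (mulrC n.+1%:R^-1) -mulrBl normrM (ger0_norm (ltW nV0)) ler_pM2r//.
apply: hh.
- by rewrite ger0_norm ltW ?(lt_le_trans ci)// (le_lt_trans i0).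
- by rewrite ger0_norm// ltW// (lt_le_trans ilt).
rewrite ger0_norm ?subr_ge0 ?(ltW ic)// (le_trans _ (ltW n1))// -[leRHS]iE lerB//.
exact: ltW.
Qed.

(** The endpoint 1 is the one of interest: for a Brownian path, zero energy then forces B(1) = 0, a
    null event. *)
Lemma Rintegral_eq0 : (forall t, 0 <= x t) -> Rintegral mu `[0, 1] x = 0 -> x 1 = 0.
Proof.
move=> x0; rewrite -F01 => I0; apply/eqP/negPn/negP => xn0.
have x1 : 0 < x 1 by rewrite lt_def xn0 x0.
have := @cx 1; move/cvgrPdist_lt => /(_ _ x1); case=> dl /= dl0 hdl.
pose t := Num.max 0 (1 - dl / 2).
have t0 : 0 <= t by rewrite le_max lexx.
have t1 : t < 1 by rewrite gt_max ltr01 /=; lra.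
have [c /andP[tc c1] Fc] := mvt t0 t1 (lexx 1).
have xc : 0 < x c.
  have := hdl c; rewrite /ball_ /=.
  have -> : `|1 - c| = 1 - c by rewrite ger0_norm//; lra.
  have tdl : 1 - dl / 2 <= t by rewrite le_max lexx orbT.
  have h1 : 1 - c < dl by lra.
  by move=> /(_ h1); rewrite ltr_norml => /andP[_]; lra.
have F1t : 0 < F 1 - F t by rewrite Fc mulr_gt0//; lra.
have Ft0 : 0 <= F t - F 0.
  have [->|tn0] := eqVneq t 0; first by rewrite subrr.
  have tp : 0 < t by rewrite lt_def tn0.
  have [c' _ ->] := mvt (lexx 0) tp (ltW t1).
  by rewrite mulr_ge0// subr0.
by lra.
Qed.

End riemann.

(** * The Laplace functional of Brownian motion *)

(** Paths are continuous on the closed half-line only; freezing them at time 0 to the left gives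
    functions continuous on the whole line. *)
Lemma continuous_halfline {R : realType} (b : R -> R) :
  {within `[0, +oo[, continuous b} -> continuous (fun t : R => b (Num.max t 0)).
Proof.
move=> /continuous_within_itvcyP[c1 c2] t; apply/cvgrPdist_le => e e0.
have [t0|t0|->] := ltgtP t 0.
- exists (- t) => /=; first by rewrite oppr_gt0.
  move=> z /=; rewrite /ball_ /= => tz.
  have z0 : z <= 0 by move: tz; rewrite ltr_norml => /andP[? ?]; lra.
  by rewrite max_r// subrr normr0 ltW.
- have ti : t \in `]0, +oo[ by rewrite in_itv/= t0.
  have /cvgrPdist_le /(_ _ e0) [dl /= dl0 hdl] := c1 t ti.
  exists (Num.min dl t) => /=; first by rewrite lt_min dl0 t0.
  move=> z /=; rewrite /ball_ /= lt_min => /andP[zd zt].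
  have z0 : 0 < z by move: zt; rewrite ltr_norml => /andP[? ?]; lra.
  by rewrite max_l ?(ltW z0)//; exact: hdl.
- have /cvgrPdist_le /(_ _ e0) [dl /= dl0 hdl] := c2.
  exists dl => //= z /=; rewrite /ball_ /= => zd; rewrite ?maxxx.
  have [z0|z0] := leP z 0; first by rewrite subrr normr0 ltW.
  exact: hdl.
Qed.

Section brownian.
Context {d : measure_display} {O : measurableType d} {R : realType}
  (Q : probability O R) (B : R -> O -> R).
Hypothesis hB : standard_brownian_motion Q B.
Notation mu := (@lebesgue_measure R).

Let mB (t : R) : 0 <= t -> measurable_fun setT (B t).
Proof. by case: hB => h _ _ _ _; exact: h. Qed.

Let B0 w : B 0 w = 0.
Proof. by case: hB => _ h _ _ _; exact: h. Qed.

Let path w (t : R) : R := B (Num.max t 0) w ^+ 2.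

Let cpath w : continuous (path w).
Proof.
case: hB => _ _ cB _ _ t.
have c := @continuous_halfline _ _ (cB w) t.
rewrite /path (_ : (fun _ => _) = fun t : R => B (Num.max t 0) w * B (Num.max t 0) w).
  exact: cvgM.
by apply/funext => s; rewrite expr2.
Qed.

Definition bm_energy w : R := Rintegral mu `[0, 1] (fun t => B t w ^+ 2).

Let energyE w : bm_energy w = Rintegral mu `[0, 1] (path w).
Proof.
apply: eq_Rintegral => t; rewrite inE/= in_itv/= => /andP[t0 _].
by rewrite /path max_l.
Qed.

(** Left-endpoint sums, to match the energy over 0 <= i < n in [laplace_riccati]. *)
Let riem (n : nat) w : R := n%:R^-1 * \sum_(0 <= i < n) B (i%:R / n%:R) w ^+ 2.

Let riem_cvg w : (fun n => riem n w) @ \oo --> bm_energy w.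
Proof.
rewrite energyE; have := riemann_cvg (@cpath w).
rewrite (_ : (fun n => n%:R^-1 * _) = fun n => riem n w)//.
apply/funext => n; congr (_ * _); apply: eq_bigr => i _.
by rewrite /path max_l// divr_ge0.
Qed.

Let mriem n : measurable_fun setT (riem n).
Proof.
apply: measurable_funM => //; apply: measurable_sum => i.
by apply: measurable_funX; apply: mB; rewrite divr_ge0.
Qed.

Lemma measurable_bm_energy : measurable_fun setT bm_energy.
Proof.
exact: (measurable_fun_cvg mriem (fun w _ => @riem_cvg w)).
Qed.

Lemma bm_energy_ge0 w : 0 <= bm_energy w.
Proof. by apply: Rintegral_ge0 => t _; exact: sqr_ge0. Qed.

Let law (s t : R) : 0 <= s -> s < t -> forall A, measurable A ->
  Q ((fun w => B t w - B s w) @^-1` A) = normal_prob 0 (Num.sqrt (t - s)) A.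
Proof. by case: hB => _ _ _ h _; exact: h. Qed.

Lemma bm_energy_eq0 : Q (bm_energy @^-1` [set 0]) = 0%E.
Proof.
have m1 : measurable (B 1 @^-1` [set 0]).
  by rewrite -[X in measurable X]setTI; apply: mB.
have m0 : measurable (bm_energy @^-1` [set 0]).
  by rewrite -[X in measurable X]setTI; apply: measurable_bm_energy.
have Q1 : Q (B 1 @^-1` [set 0]) = 0%E.
  have -> : B 1 @^-1` [set 0] = (fun w => B 1 w - B 0 w) @^-1` [set 0].
    by apply/seteqP; split => w /=; rewrite B0 subr0.
  rewrite law//.
  have /null_content_dominatesP nd := normal_prob_dominates (0 : R) (Num.sqrt (1 - 0)).
  apply: nd => //; exact: lebesgue_measure_set1.
apply/eqP; rewrite eq_le measure_ge0 andbT -Q1; apply: le_measure; rewrite ?inE//.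
move=> w /= E0; have := @Rintegral_eq0 _ (path w) (@cpath w) (fun t => sqr_ge0 _).
rewrite -energyE => /(_ E0); rewrite /path max_l// => /eqP.
by rewrite sqrf_eq0 => /eqP.
Qed.

(** Grid increments shifted by one: index 0 is the constant initial value, which contributes
    probability 0 or 1 to the product formula. *)
Let xi n k w : R :=
  if k is k'.+1 then B (k'.+1%:R / n%:R) w - B (k'%:R / n%:R) w else 0.

Let indep_xi n : (0 < n)%N -> indep_seq Q (xi n).
Proof.
move=> n0; have nR : 0 < n%:R :> R by rewrite ltr0n.
have mxi j : measurable_fun setT (xi n j).
  by case: j => [|j] /=; [exact: measurable_cst|apply: measurable_funB; apply: mB; rewrite divr_ge0].
split => // t A mA.
case: hB => _ _ _ _ /(_ t (fun i => i%:R / n%:R)).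
case.
- by rewrite divr_ge0.
- by move=> i _; rewrite ltr_pM2r ?invr_gt0// ltr_nat.
move=> _ /(_ (enum 'I_t) (fun j => A j.+1) (enum_uniq _) (fun j => mA j.+1)).
rewrite big_enum /= => E.
rewrite big_nat_recl// big_mkord.
have -> : \bigcap_(j in [set j | (j <= t)%N]) (xi n j @^-1` A j) = (fun=> 0) @^-1` A 0%N `&`
    \bigcap_(j in [set` enum 'I_t])
      ((fun w => B (j.+1%:R / n%:R) w - B ((j : nat)%:R / n%:R) w) @^-1` A j.+1).
  apply/seteqP; split => w.
    move=> H; split; first by have := H 0%N; exact.
    by move=> j _; have := H j.+1; apply; exact: ltn_ord.
  move=> [H0 H] [_ //|j /= jt].
  by have := H (Ordinal jt); rewrite /= mem_enum; apply.
have [A0|A0] := pselect (A 0%N 0).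
  have E0 : xi n 0%N @^-1` A 0%N = setT by apply/seteqP; split.
  have E1 : (fun=> 0) @^-1` A 0%N = [set: O] by apply/seteqP; split.
  by rewrite E0 ?E1 setTI probability_setT mul1e; exact: E.
have E0 : xi n 0%N @^-1` A 0%N = set0 by apply/seteqP; split.
have E1 : (fun=> 0) @^-1` A 0%N = set0 :> set O by apply/seteqP; split.
by rewrite E0 ?E1 set0I measure0 mul0e.
Qed.

(** On the grid i / n Brownian motion is a chain with g the identity and initial value 0, so the
    last two errors of [laplace_riccati] vanish. The others are O(1 / sqrt n), as kappa = 130
    n^(-3/2), while Riemann sums and dominated convergence give the limit of the left side. *)
Lemma bm_laplace_cvg (lam th : R) : 0 <= lam -> 0 <= th ->
  (fun n => \prod_(0 <= j < n) (1 - ric lam th n%:R j / n%:R)) @ \oo -->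
  Ex Q (fun w => expR (- (lam * B 1 w ^+ 2 + th * bm_energy w))).
Proof.
move=> lam0 th0; pose A := lam + th + 1.
have A1 : 1 <= A by rewrite /A; lra.
have lamA : 0 <= lam <= A by rewrite lam0 /A; lra.
have thA : th <= 2 * A ^+ 2 by rewrite /A; nra.
pose X n w := expR (- (lam * B 1 w ^+ 2 + th * riem n w)).
have mB1 : measurable_fun setT (B 1) by exact: mB.
have mX n : measurable_fun setT (X n).
  apply: measurableT_comp => //; apply: measurable_funN.
  apply: measurable_funD; apply: measurable_funM => //.
  exact: measurable_funX.
have riem0 n w : 0 <= riem n w.
  by rewrite mulr_ge0 ?invr_ge0// sumr_ge0// => i _; exact: sqr_ge0.
have cX : (fun n => Ex Q (X n)) @ \oo -->
    Ex Q (fun w => expR (- (lam * B 1 w ^+ 2 + th * bm_energy w))).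
  apply: (@Ex_cvg_dom _ _ _ _ _ _ (fun=> 1)) => //.
  - move=> n w; rewrite ger0_norm ?expR_ge0// -[leRHS]expR0 ler_expR oppr_le0.
    by rewrite addr_ge0// mulr_ge0 ?sqr_ge0.
  - exact: L1_cst.
  - apply: measurableT_comp => //; apply: measurable_funN.
    apply: measurable_funD; apply: measurable_funM => //.
      exact: measurable_funX.
    exact: measurable_bm_energy.
  exists set0; split => // w _; apply: continuous_cvg; first exact: continuous_expR.
  apply: cvgN; apply: cvgD; first exact: cvg_cst.
  by apply: cvgM; [exact: cvg_cst|exact: riem_cvg].
have key n : (0 < n)%N -> 4 * A <= n%:R ->
    `|Ex Q (X n) - \prod_(0 <= j < n) (1 - ric lam th n%:R j / n%:R)| <=
    (32 * 130 + 66) * A ^+ 2 * Num.sqrt n%:R^-1.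
  move=> n0 An; have nR : 0 < n%:R :> R by rewrite ltr0n.
  set s := Num.sqrt _; have s0 : 0 < s by rewrite sqrtr_gt0 invr_gt0.
  have s2 : s ^+ 2 = n%:R^-1 by rewrite sqr_sqrtr// invr_ge0 ltW.
  have lt01 k : k%:R / n%:R < k.+1%:R / n%:R :> R.
    by rewrite ltr_pM2r ?invr_gt0// ltr_nat.
  have ge0 k : 0 <= k%:R / n%:R :> R by rewrite divr_ge0.
  have sE k : Num.sqrt (k.+1%:R / n%:R - k%:R / n%:R) = s.
    by congr Num.sqrt; rewrite -mulrBl -natr1 addrAC subrr add0r mul1r.
  have mxi k : measurable_fun setT (xi n k.+1) by exact: (proj1 (indep_xi n0)).
  have lxi k D : measurable D -> Q (xi n k.+1 @^-1` D) = normal_prob 0 s D.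
    by move=> mD; rewrite -(sE k); exact: (law (ge0 k) (lt01 k)).
  pose y k w := B (k%:R / n%:R) w.
  have y0 : y 0%N = fun=> 0 by apply/funext => w; rewrite /y mul0r.
  have := @laplace_riccati _ _ _ Q (xi n) id y (indep_xi n0) (@measurable_id _ _ _) _ _
    lam th A (130 * s ^+ 3) n lamA th0 thA A1 An.
  have -> : y n = B 1 by rewrite /y divff// gt_eqF.
  rewrite y0; move=> /(_ (measurable_cst _)).
  have z0 j : (fun w : O => `|id (y j w) ^+ 2 - y j w ^+ 2|) = fun=> 0.
    by apply/funext => w; rewrite subrr normr0.
  move=> H; apply: le_trans (H _ _ _ _ _ _ _) _.
  - by move=> j w; rewrite /y /=; ring.
  - by move=> j _; exact: (gauss_L2 (mxi j) s0 (@lxi j)).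
  - by move=> j _; exact: (gauss_mean (mxi j) s0 (@lxi j)).
  - by move=> j _; rewrite -s2; exact: (gauss_var (mxi j) s0 (@lxi j)).
  - by move=> j _; exact: (gauss_third (mxi j) s0 (@lxi j)).
  - by move=> j _; rewrite z0; exact: L1_cst.
  - by rewrite expr0n /=; exact: L1_cst.
  under eq_bigr do rewrite z0 Ex_cst.
  rewrite big1// mulr0 expr0n /= Ex_cst mulr0 !addr0.
  have -> : n%:R * (130 * s ^+ 3) = 130 * s.
    have -> : s ^+ 3 = n%:R^-1 * s by rewrite -s2; ring.
    by field; rewrite gt_eqF.
  have ns : n%:R^-1 <= s.
    rewrite -s2 expr2 ler_piMl ?(ltW s0)//.
    rewrite -(@ler_pXn2r _ 2) ?nnegrE ?(ltW s0)// s2 expr1n invf_le1//.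
    by rewrite ler1n.
  have A20 : 0 <= A ^+ 2 by exact: sqr_ge0.
  have := ler_wpM2l A20 ns; lra.
have {key} [K K0 key] : exists2 K : R, 0 < K & forall n, (0 < n)%N -> 4 * A <= n%:R ->
    `|Ex Q (X n) - \prod_(0 <= j < n) (1 - ric lam th n%:R j / n%:R)| <=
    K * A ^+ 2 * Num.sqrt n%:R^-1.
  by exists (32 * 130 + 66) => //; lra.
apply/cvgrPdist_le => e e0; have e20 : 0 < e / 2 by rewrite divr_gt0.
move/cvgrPdist_le : cX => /(_ _ e20) cX.
have A0 : 0 < A by lra.
pose dl := e / 2 / (K * A ^+ 2).
have C0 : 0 < K * A ^+ 2 by rewrite mulr_gt0// exprn_gt0.
have dl0 : 0 < dl by rewrite divr_gt0.
near=> n.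
have h1 : `|Ex Q (fun w => expR (- (lam * B 1 w ^+ 2 + th * bm_energy w))) - Ex Q (X n)| <= e / 2.
  by near: n; exact: cX.
have h2 : 4 * A <= n%:R by near: n; exact: nbhs_infty_ger.
have h3 : (dl ^+ 2)^-1 <= n%:R by near: n; exact: nbhs_infty_ger.
have nR : 0 < n%:R :> R by apply: lt_le_trans h2; rewrite mulr_gt0.
have n0 : (0 < n)%N by rewrite -(ltr0n R).
have h4 : Num.sqrt n%:R^-1 <= dl.
  rewrite -[leRHS]ger0_norm ?(ltW dl0)// -sqrtr_sqr ler_sqrt ?sqr_ge0//.
  by rewrite -[leRHS]invrK lef_pV2 ?posrE ?invr_gt0 ?exprn_gt0.
have := le_trans (key n n0 h2) (ler_wpM2l (ltW C0) h4).
have -> : K * A ^+ 2 * dl = e / 2 by rewrite /dl mulrC divfK ?gt_eqF.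
move=> h5; rewrite [leRHS]splitr.
rewrite -(subrK (Ex Q (X n)) (Ex Q _)) -addrA.
exact: le_trans (ler_normD _ _) (lerD h1 h5).
Unshelve. all: by end_near.
Qed.

End brownian.

(** * Second moments of the threshold chain *)

Lemma Ex_same_law {d} {T : measurableType d} {R : realType} (P : probability T R)
    (X X' : T -> R) (h : R -> R) :
  measurable_fun setT X -> measurable_fun setT X' -> measurable_fun setT h ->
  (forall A, measurable A -> P (X' @^-1` A) = P (X @^-1` A)) ->
  L1 P (h \o X) -> L1 P (h \o X') /\ Ex P (h \o X') = Ex P (h \o X).
Proof.
move=> mX mX' mh XX' iX.
pose U : {RV P >-> R} := HB.pack X (isMeasurableFun.Build _ _ _ _ X mX).
pose U' : {RV P >-> R} := HB.pack X' (isMeasurableFun.Build _ _ _ _ X' mX').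
have law A : measurable A -> distribution P U' A = distribution P U A by exact: XX'.
have mhE : measurable_fun setT (EFin \o h) by exact/measurable_EFinP.
have iX' : L1 P (h \o X').
  apply/integrableP; split; first exact/measurable_EFinP/measurableT_comp.
  have mah : measurable_fun setT (fun y => `|(h y)%:E|)%E by exact: measurableT_comp.
  have := @ge0_integral_distribution _ _ _ _ _ P U' _ mah (fun y => abse_ge0 _).
  move=> /= <-; rewrite (@eq_measure_integral _ _ _ setT (distribution P U)).
    by rewrite ge0_integral_distribution//; case/integrableP : iX.
  by move=> A mA _; exact: law.
split => //; rewrite /Ex /Rintegral; congr fine.
have -> : (\int[P]_x ((h \o X') x)%:E = \int[distribution P U']_y (h y)%:E)%E.
  by rewrite integral_distribution.
have -> : (\int[P]_x ((h \o X) x)%:E = \int[distribution P U]_y (h y)%:E)%E.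
  by rewrite integral_distribution.
by apply: (@eq_measure_integral _ _ _ setT (distribution P U)) => A mA _; exact: law.
Qed.

(** Orthogonality of martingale increments: in the expanded square, [S n x * X n x] is adapted and
    the next increment is centred, so the cross term has mean 0. *)
Lemma mart_L2 {d} {T : measurableType d} {R : realType} (P : probability T R)
    (xi : nat -> T -> R) (X : nat -> T -> R) (h : R -> R) (C : R) n :
  indep_seq P xi -> measurable_fun setT h ->
  (forall t, adapted xi t (X t)) -> (forall t, L1 P (fun x => X t x ^+ 2)) ->
  (forall t, L1 P (fun x => h (xi t.+1 x) ^+ 2)) ->
  (forall t, Ex P (h \o xi t.+1) = 0) ->
  (forall t, Ex P (fun x => h (xi t.+1 x) ^+ 2) <= C) ->
  L1 P (fun x => (\sum_(0 <= t < n) X t x * h (xi t.+1 x)) ^+ 2) /\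
  Ex P (fun x => (\sum_(0 <= t < n) X t x * h (xi t.+1 x)) ^+ 2) <=
    C * \sum_(0 <= t < n) Ex P (fun x => X t x ^+ 2).
Proof.
move=> indep mh aX iX ih h0 hC.
pose S n x := \sum_(0 <= t < n) X t x * h (xi t.+1 x).
rewrite -/(S n).
have aS k : adapted xi k (S k).
  apply: (adapted_sum (X := fun t x => X t x * h (xi t.+1 x))) => i ik.
  apply: measurable_funM; first exact: (adapted_le (ltnW ik) (aX i)).
  by apply: (measurableT_comp mh); exact: adapted_xi.
have mS k := adapted_measurable indep (aS k).
have mX k := adapted_measurable indep (aX k).
have mhx k : measurable_fun setT (h \o xi k.+1).
  by apply: measurableT_comp => //; exact: (proj1 indep).
elim: n => [|n [i1 e1]].
  have -> : (fun x => S 0%N x ^+ 2) = fun=> 0.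
    by apply/funext => x; rewrite /S big_nil expr0n.
  by rewrite Ex_cst big_nil mulr0; split; [exact: L1_cst|exact: lexx].
have aSX : adapted xi n (fun x => S n x * X n x).
  by apply: measurable_funM; [exact: aS|exact: aX].
have iSX : L1 P (fun x => S n x * X n x) by exact: L2_mul.
have ihn : L1 P (h \o xi n.+1) by exact: L2_L1 (mhx n) (ih n).
have [i2 e2] := adapted_mul_indep indep aSX mh iSX ihn.
rewrite h0 mulr0 in e2.
have mh2 : measurable_fun setT (fun y => h y ^+ 2) by exact: measurable_funX.
have aX2 : adapted xi n (fun x => X n x ^+ 2) by apply: measurable_funX; exact: aX.
have [i3 e3] := adapted_mul_indep indep aX2 mh2 (iX n) (ih n).
have E : (fun x => S n.+1 x ^+ 2) = fun x => S n x ^+ 2 +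
    2 * (S n x * X n x * h (xi n.+1 x)) + X n x ^+ 2 * h (xi n.+1 x) ^+ 2.
  by apply/funext => x; rewrite /S big_nat_recr//=; ring.
have i12 := L1D i1 (L1Z 2 i2).
rewrite E; split; first exact: L1D.
rewrite (ExD i12 i3) (ExD i1 (L1Z 2 i2)) ExZ// e2 mulr0 addr0 e3 big_nat_recr//= mulrDr lerD//.
rewrite mulrC ler_wpM2r//; first by apply: Ex_ge0 => x; exact: sqr_ge0.
exact: hC.
Qed.

(** * Sublinear growth *)

(** An upper bound o(n) in a form valid for all n, so that sums and multiples can be taken without
    thresholds on n. *)
Definition sublinear {R : realType} (S : nat -> R) : Prop :=
  forall e : R, 0 < e -> exists C : R, forall n, S n <= C + e * n%:R.

Section sublinear.
Context {R : realType}.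
Implicit Type S : nat -> R.

Lemma sublinear_le S (S' : nat -> R) : sublinear S' -> (forall n, S n <= S' n) -> sublinear S.
Proof. by move=> h SS e e0; have [C hC] := h e e0; exists C => n; exact: le_trans (SS n) _. Qed.

Lemma sublinear_cst c : sublinear (fun=> c : R).
Proof. by move=> e e0; exists c => n; rewrite lerDl mulr_ge0// ltW. Qed.

Lemma sublinearD S (S' : nat -> R) : sublinear S -> sublinear S' -> sublinear (fun n => S n + S' n).
Proof.
move=> h h' e e0; have e20 : 0 < e / 2 by rewrite divr_gt0.
have [C hC] := h _ e20; have [C' hC'] := h' _ e20; exists (C + C') => n.
by have := hC n; have := hC' n; lra.
Qed.

Lemma sublinearZ c S : 0 <= c -> sublinear S -> sublinear (fun n => c * S n).
Proof.
move=> c0 h e e0; have c1 : 0 < c + 1 by lra.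
have ec : 0 < e / (c + 1) by rewrite divr_gt0.
have [C hC] := h _ ec; exists (c * C) => n.
apply: le_trans (ler_wpM2l c0 (hC n)) _; rewrite mulrDr lerD2l mulrA ler_wpM2r//.
by rewrite mulrA ler_pdivrMr//; nra.
Qed.

(* AM-GM with a free parameter: a linear second moment gives a sublinear first moment. *)
Lemma sublinear_sqr S (S2 : nat -> R) (C : R) : (forall n, S2 n <= C * (1 + n%:R)) ->
  (forall n (th : R), 0 < th -> S n <= S2 n / th + th) -> sublinear S.
Proof.
move=> hC hS e e0; pose th := (`|C| + 1) / e.
have th0 : 0 < th by rewrite divr_gt0// ltr_wpDl.
have Cth : C / th <= e.
  rewrite ler_pdivrMr// /th mulrC divfK ?gt_eqF//.
  by rewrite (le_trans (ler_norm C))// lerDl.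
exists (e + th) => n; apply: le_trans (hS n th th0) _.
have := ler_wpM2r (_ : 0 <= th^-1) (hC n); rewrite invr_ge0 (ltW th0) => /(_ isT) h1.
have n0 : 0 <= 1 + n%:R :> R by rewrite addr_ge0.
have := ler_wpM2r n0 Cth.
have -> : C / th * (1 + n%:R) = C * (1 + n%:R) / th by ring.
by lra.
Qed.

Lemma sublinear_cvg0 S (c : R) : 0 < c -> (forall n, 0 <= S n) -> sublinear S ->
  (fun n => S n / (n%:R * c)) @ \oo --> (0 : R).
Proof.
move=> c0 S0 h; apply/cvgr0Pnorm_le => e e0.
have ec : 0 < e * c / 2 by rewrite divr_gt0// mulr_gt0.
have [C hC] := h _ ec.
near=> n.
have n1 : 1 <= n%:R :> R by near: n; exact: nbhs_infty_ger.
have n0 : 0 < n%:R :> R by lra.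
have nC : C / (e * c / 2) <= n%:R by near: n; exact: nbhs_infty_ger.
rewrite ger0_norm; last by rewrite divr_ge0// mulr_ge0// ltW.
rewrite ler_pdivrMr ?mulr_gt0//; apply: le_trans (hC n) _.
have : C <= e * c / 2 * n%:R by rewrite mulrC -ler_pdivrMr.
by lra.
Unshelve. all: by end_near.
Qed.

End sublinear.

Lemma Ex_abs_amgm {d} {T : measurableType d} {R : realType} (P : probability T R)
    (X : T -> R) (th : R) : measurable_fun setT X -> L1 P (fun x => X x ^+ 2) ->
  0 < th -> Ex P (fun x => `|X x|) <= Ex P (fun x => X x ^+ 2) / th + th.
Proof.
move=> mX iX2 th0; have iX := L2_L1 mX iX2.
rewrite mulrC -(ExZ _ iX2) -[X in _ <= _ + X](Ex_cst P).
rewrite -(ExD (L1Z _ iX2) (L1_cst P th)).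
apply: Ex_le; [exact: L1_norm|by apply: L1D; [exact: L1Z|exact: L1_cst]|].
move=> x; rewrite -(real_normK (num_real (X x))).
rewrite mulrC -(ler_pM2r th0) mulrDl divfK ?gt_eqF//.
by have := sqr_ge0 (`|X x| - th); have := normr_ge0 (X x); nra.
Qed.

(** * Energy, noise and Laplace functional of the threshold chain *)

Section chain_moments.
Context {d : measure_display} {T : measurableType d} {R : realType}
  (P : probability T R) (xi Y : nat -> T -> R) (beta r s2 : R).
Definition thr_map (y : R) : R := if r < y then y else beta * y.
Definition lowsq (y : R) : R := if y <= r then y ^+ 2 else 0.
Local Notation g := thr_map.
Local Notation low := lowsq.
Hypothesis indep : indep_seq P xi.
Hypothesis Y0E : forall x, Y 0%N x = xi 0%N x.
Hypothesis YSE : forall t x, Y t.+1 x = g (Y t x) + xi t.+1 x.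
Hypothesis i0 : L1 P (fun x => xi 0%N x ^+ 2).
Hypothesis i1 : L1 P (fun x => xi 1%N x ^+ 2).
Hypothesis ident : forall t (h : R -> R), measurable_fun setT h ->
  L1 P (h \o xi 1%N) ->
  L1 P (h \o xi t.+1) /\ Ex P (h \o xi t.+1) = Ex P (h \o xi 1%N).
Hypothesis e1 : Ex P (xi 1%N) = 0.
Hypothesis e2 : Ex P (fun x => xi 1%N x ^+ 2) = s2.
Hypothesis s20 : 0 < s2.

Let mxi t : measurable_fun setT (xi t). Proof. exact: (proj1 indep). Qed.

Let msq : measurable_fun setT (fun y : R => y ^+ 2).
Proof. exact: exprn_measurable. Qed.

Lemma chain_noise2 t : L1 P (fun x => xi t.+1 x ^+ 2).
Proof. by have [] := ident t msq i1. Qed.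

Lemma chain_noise_var t : Ex P (fun x => xi t.+1 x ^+ 2) = s2.
Proof. by rewrite -e2; have [] := ident t msq i1. Qed.

Lemma chain_noise1 t : L1 P (xi t.+1).
Proof. exact: L2_L1 (mxi _) (chain_noise2 t). Qed.

Lemma chain_noise_mean t : Ex P (xi t.+1) = 0.
Proof. by rewrite -e1; have [] := @ident t id (@measurable_id _ _ _) (chain_noise1 0). Qed.

Lemma measurable_thr_map : measurable_fun setT g.
Proof. by apply: measurable_fun_ifT => //; apply: measurable_fun_ltr. Qed.

Lemma measurable_lowsq : measurable_fun setT low.
Proof. by apply: measurable_fun_ifT => //; apply: measurable_fun_ler. Qed.

Let mg := measurable_thr_map.
Let mlow := measurable_lowsq.

Lemma chain_adapted t : adapted xi t (Y t).
Proof.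
apply: (adapted_chain mg _ YSE).
by rewrite (_ : Y 0%N = xi 0%N); [exact: adapted_xi|apply/funext].
Qed.

Lemma chain_measurable t : measurable_fun setT (Y t).
Proof. exact: (adapted_measurable indep (@chain_adapted t)). Qed.

Let mY := chain_measurable.

Let mgY t : measurable_fun setT (fun x => g (Y t x)).
Proof. exact: measurableT_comp. Qed.

Let agY t : adapted xi t (fun x => g (Y t x)).
Proof. by apply: (measurableT_comp mg); exact: chain_adapted. Qed.

Let gsq y : g y ^+ 2 = y ^+ 2 + (beta ^+ 2 - 1) * low y.
Proof. by rewrite /g /low; case: ltP => _; ring. Qed.

Let low0 y : 0 <= low y.
Proof. by rewrite /low; case: ifP => // _; exact: sqr_ge0. Qed.

Let low_le y : low y <= y ^+ 2.
Proof. by rewrite /low; case: ifP => // _; exact: sqr_ge0. Qed.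

Lemma chain_L2 t : L1 P (fun x => Y t x ^+ 2).
Proof.
elim: t => [|t ih].
  by apply: (L1_ext i0) => x; rewrite Y0E.
apply: (L1_ext (X := fun x => (g (Y t x) + xi t.+1 x) ^+ 2)); last by move=> x; rewrite YSE.
apply: L2_D => //; last exact: chain_noise2.
apply: (L1_le _ _ (L1Z (1 + beta ^+ 2) ih)); first exact: measurable_funX.
move=> x; rewrite ger0_norm ?sqr_ge0// gsq.
have := low0 (Y t x); have := low_le (Y t x).
have := sqr_ge0 beta; have := sqr_ge0 (Y t x); nra.
Qed.

Lemma chain_low_L1 t : L1 P (fun x => low (Y t x)).
Proof.
apply: (L1_le _ _ (chain_L2 t)); first exact: measurableT_comp.
by move=> x; rewrite ger0_norm.
Qed.

Let lowE t := Ex P (fun x => low (Y t x)).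

Let lowE0 t : 0 <= lowE t. Proof. exact: Ex_ge0. Qed.

Let igY2 t : L1 P (fun x => g (Y t x) ^+ 2).
Proof.
apply: (L1_ext (L1D (chain_L2 t) (L1Z (beta ^+ 2 - 1) (chain_low_L1 t)))) => x.
by rewrite gsq.
Qed.

Let chain_var t : Ex P (fun x => Y t.+1 x ^+ 2) =
  Ex P (fun x => Y t x ^+ 2) + (beta ^+ 2 - 1) * lowE t + s2.
Proof.
have igY : L1 P (fun x => g (Y t x)) by exact: L2_L1 (@mgY t) (igY2 t).
have [ic ec] := adapted_mul_indep indep (@agY t) (@measurable_id _ _ _) igY (chain_noise1 t).
rewrite /= in ic ec.
rewrite (_ : Ex P (id \o xi t.+1) = 0) ?mulr0 in ec; last exact: chain_noise_mean.
have -> : Ex P (fun x => Y t.+1 x ^+ 2) =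
    Ex P (fun x => g (Y t x) ^+ 2 + 2 * (g (Y t x) * xi t.+1 x) + xi t.+1 x ^+ 2).
  by apply: Ex_ext => x; rewrite YSE; ring.
rewrite (ExD (L1D (igY2 t) (L1Z 2 ic)) (chain_noise2 t)) (ExD (igY2 t) (L1Z 2 ic)).
rewrite ExZ// ec mulr0 addr0 chain_noise_var; congr (_ + _).
have -> : Ex P (fun x => g (Y t x) ^+ 2) =
    Ex P (fun x => Y t x ^+ 2 + (beta ^+ 2 - 1) * low (Y t x)).
  by apply: Ex_ext => x; rewrite gsq.
by rewrite (ExD (chain_L2 t) (L1Z _ (chain_low_L1 t))) (ExZ _ (chain_low_L1 t)).
Qed.

Let sqr_bnd (a e : R) : - `|r| - `|e| <= a <= `|r| -> a ^+ 2 <= 2 * r ^+ 2 + 2 * e ^+ 2.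
Proof.
move=> /andP[h1 h2]; rewrite -(real_normK (num_real a)).
rewrite -(real_normK (num_real r)) -(real_normK (num_real e)).
have ra : `|a| <= `|r| + `|e|.
  by have := normr_ge0 e; rewrite ler_norml => ?; apply/andP; split; lra.
have := sqr_ge0 (`|r| - `|e|); have := normr_ge0 a; have := normr_ge0 r; have := normr_ge0 e.
by nra.
Qed.

(** If the map never goes below -|r|, a value below r lies between -|r| - |xi| and |r|: its energy
    comes from the fresh innovation and not from the past. *)
Let low_bnd t : (forall y, - `|r| <= g y) -> lowE t.+1 <= 2 * r ^+ 2 + 2 * s2.
Proof.
move=> hg; rewrite -(chain_noise_var t) -(ExZ 2 (chain_noise2 t)) -[X in X + _](Ex_cst P).
rewrite -(ExD (L1_cst P _) (L1Z 2 (chain_noise2 t))).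
apply: Ex_le; [exact: chain_low_L1|by apply: L1D; [exact: L1_cst|apply: L1Z; exact: chain_noise2]|].
move=> x; rewrite /low; case: ifPn => [Yr|_]; last first.
  by rewrite addr_ge0// mulr_ge0// sqr_ge0.
apply: sqr_bnd; rewrite YSE in Yr *.
have := hg (Y t x); have := ler_norm r; have := ler_norm (- xi t.+1 x); rewrite normrN.
by move=> *; apply/andP; split; lra.
Qed.

Let lowE_init : lowE 0 <= Ex P (fun x => xi 0%N x ^+ 2).
Proof.
apply: Ex_le => //; first exact: chain_low_L1.
by move=> x; rewrite -Y0E.
Qed.

Lemma low_linear : (forall y, - `|r| <= g y) ->
  exists C : R, forall n, \sum_(0 <= t < n) Ex P (fun x => lowsq (Y t x)) <= C * (1 + n%:R).
Proof.
move=> hg; pose C := Ex P (fun x => xi 0%N x ^+ 2) + (2 * r ^+ 2 + 2 * s2).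
have q0 : 0 <= Ex P (fun x => xi 0%N x ^+ 2) by apply: Ex_ge0 => x; exact: sqr_ge0.
have q1 : 0 <= 2 * r ^+ 2 + 2 * s2 by have := s20; have := sqr_ge0 r; lra.
exists C => n.
apply: le_trans (_ : \sum_(0 <= t < n) C <= _).
  apply: ler_sum_nat => -[_|t _]; first by have := lowE_init; rewrite /C /lowE; lra.
  by have := low_bnd t hg; rewrite /C /lowE; lra.
rewrite sumr_const_nat subn0 -[leLHS]mulr_natr.
by apply: ler_wpM2l; [exact: addr_ge0|rewrite lerDr].
Qed.

Let tail K (e : R) : R := if K < `|e| then e ^+ 2 else 0.

Let mtail K : measurable_fun setT (tail K).
Proof.
by apply: measurable_fun_ifT => //; apply: measurable_fun_ltr.
Qed.

Let itail K : L1 P (tail K \o xi 1%N).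
Proof.
apply: (L1_le _ _ i1); first exact: measurableT_comp.
by move=> x; rewrite /= /tail; case: ifP => _; rewrite ?normr0 ?sqr_ge0// ger0_norm ?sqr_ge0.
Qed.

Let tail_small e : 0 < e -> exists2 K, 0 <= K & Ex P (tail K \o xi 1%N) <= e.
Proof.
move=> e0.
have c : (fun k => Ex P (tail k%:R \o xi 1%N)) @ \oo --> (0 : R).
  rewrite -[X in _ --> X](Ex_cst P 0).
  apply: (@Ex_cvg_dom _ _ _ _ _ _ (fun x => xi 1%N x ^+ 2)) => //.
  - by move=> k; exact: measurableT_comp.
  - by move=> k x; rewrite /= /tail; case: ifP => _; rewrite ?normr0 ?sqr_ge0// ger0_norm ?sqr_ge0.
  exists set0; split => // x _; apply: cvg_near_cst.
  near=> k; rewrite /= /tail ltNge.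
  have -> // : `|xi 1%N x| <= k%:R by near: k; exact: nbhs_infty_ger.
move/cvgr0Pnorm_le : c => /(_ _ e0) c.
near \oo => k; exists k%:R => //.
by apply: le_trans (ler_norm _) _; near: k.
Unshelve. all: by end_near.
Qed.

Let trunc K (e : R) : R := if K < `|e| then 0 else e ^+ 2.

Let mtrunc K : measurable_fun setT (trunc K).
Proof. by apply: measurable_fun_ifT => //; apply: measurable_fun_ltr. Qed.

Let trunc_bnd K e : 0 <= K -> 0 <= trunc K e <= K ^+ 2.
Proof.
move=> K0; rewrite /trunc; case: ltP => h; first by rewrite lexx sqr_ge0.
by rewrite sqr_ge0 -(real_normK (num_real e)) ler_sqr ?nnegrE.
Qed.

Let truncE K e : e ^+ 2 = trunc K e + tail K e.
Proof. by rewrite /trunc /tail; case: ifP => _; rewrite ?add0r ?addr0. Qed.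

(** A weak law in mean for squares that have only a first moment: the truncated, centred part is
    bounded and treated in L2, the tail is small in L1. *)
Lemma noise_lln :
  sublinear (fun n => Ex P (fun x => `|\sum_(0 <= t < n) xi t.+1 x ^+ 2 - n%:R * s2|)).
Proof.
(* The tail is counted twice, in the sum and in its mean, hence e / 4; the other half goes to the
   truncated part. *)
move=> e e0; have e40 : 0 < e / 4 by rewrite divr_gt0.
have e20 : 0 < e / 2 by rewrite divr_gt0.
have [K K0 tK] := tail_small e40.
have itr : L1 P (trunc K \o xi 1%N).
  apply: (L1_bnd P (M := K ^+ 2)); first exact: measurableT_comp.
  by move=> x; have /andP[h1 h2] := trunc_bnd (xi 1%N x) K0; rewrite /= ger0_norm.
pose m := Ex P (trunc K \o xi 1%N).
have m0 : 0 <= m by apply: Ex_ge0 => x; case/andP: (trunc_bnd (xi 1%N x) K0).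
have mK : m <= K ^+ 2.
  rewrite -[leRHS](Ex_cst P); apply: Ex_le => //; first exact: L1_cst.
  by move=> x; case/andP: (trunc_bnd (xi 1%N x) K0).
have s2E : s2 = m + Ex P (tail K \o xi 1%N).
  rewrite -e2 -(ExD itr (itail K)); apply: Ex_ext => x; exact: truncE.
pose h (y : R) := trunc K y - m.
have mh : measurable_fun setT h by exact: measurable_funB.
have hK y : `|h y| <= K ^+ 2.
  by have /andP[h1 h2] := trunc_bnd y K0; rewrite /h ler_norml; apply/andP; split; lra.
have ih2 t : L1 P (fun x => h (xi t.+1 x) ^+ 2).
  apply: (L1_bnd P (M := (K ^+ 2) ^+ 2)).
    by apply: measurable_funX; exact: (measurableT_comp mh (mxi t.+1)).
  move=> x; rewrite ger0_norm ?sqr_ge0// -(real_normK (num_real (h _))).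
  by rewrite ler_sqr ?nnegrE ?sqr_ge0.
have h0 t : Ex P (h \o xi t.+1) = 0.
  have [it et] := ident t (mtrunc K) itr.
  by rewrite (ExB it (L1_cst P m)) et Ex_cst subrr.
have hC t : Ex P (fun x => h (xi t.+1 x) ^+ 2) <= (K ^+ 2) ^+ 2.
  rewrite -[leRHS](Ex_cst P); apply: Ex_le => //; first exact: L1_cst.
  by move=> x; rewrite -(real_normK (num_real (h _))) ler_sqr ?nnegrE ?sqr_ge0.
pose S n x := \sum_(0 <= t < n) 1 * h (xi t.+1 x).
have a1 t : adapted xi t (fun _ : T => (1 : R)) by exact: measurable_cst.
have i1' (t : nat) : L1 P (fun _ : T => (1 : R) ^+ 2) by exact: L1_cst.
have hS n := @mart_L2 _ _ _ P xi (fun _ _ => (1 : R)) h ((K ^+ 2) ^+ 2) n indep mh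
  a1 i1' ih2 h0 hC.
have mS n : measurable_fun setT (S n).
  apply: measurable_sum => t; apply: measurable_funM => //.
  exact: (measurableT_comp mh (mxi t.+1)).
have S2n n : Ex P (fun x => S n x ^+ 2) <= (K ^+ 2) ^+ 2 * (1 + n%:R).
  apply: le_trans (proj2 (hS n)) _; apply: ler_wpM2l; first exact: sqr_ge0.
  under eq_bigr do rewrite expr1n Ex_cst.
  by rewrite sumr_const_nat subn0 lerDr.
have sS : sublinear (fun n => Ex P (fun x => `|S n x|)).
  apply: (sublinear_sqr S2n) => n th th0.
  by apply: Ex_abs_amgm => //; have [] := hS n.
have [C hCn] := sS _ e20.
exists C => n.
have itl t : L1 P (tail K \o xi t.+1) by have [] := ident t (mtail K) (itail K).
have etl t : Ex P (tail K \o xi t.+1) = Ex P (tail K \o xi 1%N).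
  by have [] := ident t (mtail K) (itail K).
have tl0 y : 0 <= tail K y by rewrite /tail; case: ifP => // _; exact: sqr_ge0.
set dl := Ex P (tail K \o xi 1%N) in tK s2E etl.
have dl0 : 0 <= dl by apply: Ex_ge0 => x; exact: tl0.
have iS n' : L1 P (S n') by apply: L2_L1 => //; have [] := hS n'.
have isum n' : L1 P (fun x => \sum_(0 <= t < n') tail K (xi t.+1 x)).
  by apply: (L1_sum_nat (X := fun t => tail K \o xi t.+1)) => t _; exact: itl.
have imain : L1 P (fun x => `|\sum_(0 <= t < n) xi t.+1 x ^+ 2 - n%:R * s2|).
  apply: L1_norm; apply: L1B; last exact: L1_cst.
  by apply: (L1_sum_nat (X := fun t x => xi t.+1 x ^+ 2)) => t _; exact: chain_noise2.
apply: le_trans (_ : Ex P (fun x => `|S n x|) + (n%:R * dl + n%:R * dl) <= _).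
  have -> : Ex P (fun x => `|S n x|) + (n%:R * dl + n%:R * dl) =
      Ex P (fun x => `|S n x| + \sum_(0 <= t < n) tail K (xi t.+1 x) + n%:R * dl).
    rewrite (ExD (L1D (L1_norm (iS n)) (isum n)) (L1_cst P _)) Ex_cst.
    rewrite (ExD (L1_norm (iS n)) (isum n)) -addrA; congr (_ + (_ + _)).
    rewrite (Ex_sum_nat (X := fun t => tail K \o xi t.+1)); last by move=> t _; exact: itl.
    by under eq_bigr do rewrite etl; rewrite sumr_const_nat subn0 -[RHS]mulr_natl.
  apply: Ex_le => //.
    by apply: L1D; [apply: L1D => //; exact: L1_norm|exact: L1_cst].
  move=> x.
  have -> : \sum_(0 <= t < n) xi t.+1 x ^+ 2 - n%:R * s2 =
      S n x + \sum_(0 <= t < n) tail K (xi t.+1 x) - n%:R * dl.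
    rewrite /S -big_split /= s2E.
    under [in RHS]eq_bigr do rewrite mul1r /h addrAC -truncE.
    by rewrite sumrB sumr_const_nat subn0 -mulr_natl; ring.
  rewrite (le_trans (ler_normB _ _))// lerD//; last by rewrite ger0_norm// mulr_ge0.
  rewrite (le_trans (ler_normD _ _))// lerD2l ger0_norm//.
  by apply: sumr_ge0 => t _; exact: tl0.
have hn := hCn n.
have nd : n%:R * dl <= n%:R * (e / 4) by rewrite ler_wpM2l.
by lra.
Qed.

Definition lowid (y : R) : R := if y <= r then y else 0.

Let mlowid : measurable_fun setT lowid.
Proof. by apply: measurable_fun_ifT => //; apply: measurable_fun_ler. Qed.

(** Here linear growth of the energy below r suffices: it bounds the second moment of the martingale
    linearly, hence its first moment by O(sqrt n). *)
Lemma low_mart_sublinear (C : R) :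
  (forall n, \sum_(0 <= t < n) Ex P (fun x => lowsq (Y t x)) <= C * (1 + n%:R)) ->
  (forall n, L1 P (fun x => \sum_(0 <= t < n) lowid (Y t x) * xi t.+1 x)) /\
  sublinear (fun n => Ex P (fun x => `|\sum_(0 <= t < n) lowid (Y t x) * xi t.+1 x|)).
Proof.
move=> hC.
have a t : adapted xi t (fun x => lowid (Y t x)).
  by apply: (measurableT_comp mlowid); exact: chain_adapted.
have lE t : (fun x => lowid (Y t x) ^+ 2) = fun x => low (Y t x).
  by apply/funext => x; rewrite /lowid /low; case: ifP => // _; rewrite expr0n.
have il t : L1 P (fun x => lowid (Y t x) ^+ 2) by rewrite lE; exact: chain_low_L1.
have hv t : Ex P (fun x => xi t.+1 x ^+ 2) <= s2 by rewrite chain_noise_var.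
have hS n := @mart_L2 _ _ _ P xi (fun t x => lowid (Y t x)) id s2 n indep
  (@measurable_id _ _ _) a il chain_noise2 chain_noise_mean hv.
have mS n : measurable_fun setT (fun x => \sum_(0 <= t < n) lowid (Y t x) * xi t.+1 x).
  apply: measurable_sum => t; apply: measurable_funM => //.
  exact: (measurableT_comp mlowid (@mY t)).
split; first by move=> n; apply: L2_L1 => //; have [] := hS n.
have S2n n : Ex P (fun x => (\sum_(0 <= t < n) lowid (Y t x) * xi t.+1 x) ^+ 2) <=
    s2 * C * (1 + n%:R).
  apply: le_trans (proj2 (hS n)) _; rewrite -mulrA; apply: ler_wpM2l; first exact: ltW.
  by under eq_bigr do rewrite lE; exact: hC.
apply: (sublinear_sqr S2n) => n th th0.
by apply: Ex_abs_amgm => //; have [] := hS n.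
Qed.

Let lindeberg : (fun n => Ex P (fun x => xi 1%N x ^+ 2 *
   Num.min 1 `|(Num.sqrt (n%:R * s2))^-1 * xi 1%N x|)) @ \oo --> (0 : R).
Proof.
apply/cvgr0Pnorm_le => e e0; have e20 : 0 < e / 2 by rewrite divr_gt0.
have [K K0 tK] := tail_small e20.
(* Once sqrt (n s2) >= B, the innovations of size at most K contribute c K s2 <= e / 2. *)
pose B := K * s2 / (e / 2).
have B0 : 0 <= B by rewrite divr_ge0 ?(ltW e20)// mulr_ge0// ltW.
near=> n.
have n1 : 1 <= n%:R :> R by near: n; exact: nbhs_infty_ger.
have nB : B ^+ 2 / s2 <= n%:R by near: n; exact: nbhs_infty_ger.
have n0 : 0 < n%:R :> R by exact: lt_le_trans n1.
set c := (Num.sqrt (n%:R * s2))^-1.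
have ns0 : 0 < n%:R * s2 by exact: mulr_gt0.
have c0 : 0 < c by rewrite invr_gt0 sqrtr_gt0.
have BN : B <= Num.sqrt (n%:R * s2).
  rewrite -[leLHS]ger0_norm// -sqrtr_sqr ler_sqrt ?(ltW ns0)//.
  by rewrite -ler_pdivrMr.
have cK : c * K * s2 <= e / 2.
  have -> : c * K * s2 = (e / 2) * (B / Num.sqrt (n%:R * s2)).
    by rewrite /B /c; field; rewrite !gt_eqF ?sqrtr_gt0.
  rewrite -[leRHS]mulr1 ler_wpM2l ?(ltW e20)//.
  by rewrite ler_pdivrMr ?sqrtr_gt0// mul1r.
have p0 x : 0 <= xi 1%N x ^+ 2 * Num.min 1 `|c * xi 1%N x|.
  by rewrite mulr_ge0 ?sqr_ge0// le_min ler01 normr_ge0.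
rewrite ger0_norm; last exact: Ex_ge0.
apply: le_trans (_ : c * K * Ex P (fun x => xi 1%N x ^+ 2) + Ex P (tail K \o xi 1%N) <= _).
  rewrite -(ExZ _ i1) -(ExD (L1Z _ i1) (itail K)); apply: Ex_le.
  - apply: (L1_le _ _ i1).
      apply: measurable_funM; first exact: measurable_funX.
      apply: measurable_minr => //; apply: measurableT_comp => //.
      exact: measurable_funM.
    by move=> x; rewrite ger0_norm// -[leRHS]mulr1 ler_wpM2l ?sqr_ge0// ge_min lexx.
  - by apply: L1D; [exact: L1Z|exact: itail].
  move=> x /=; rewrite /tail; have [eK|eK] := ltP K `|xi 1%N x|.
    apply: le_trans (_ : xi 1%N x ^+ 2 <= _).
      by rewrite -[leRHS]mulr1 ler_wpM2l ?sqr_ge0// ge_min lexx.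
    rewrite lerDr; apply: mulr_ge0; last exact: sqr_ge0.
    by apply: mulr_ge0 => //; exact: ltW.
  rewrite addr0 [leRHS]mulrC ler_wpM2l ?sqr_ge0// ge_min; apply/orP; right.
  by rewrite normrM (ger0_norm (ltW c0)) ler_wpM2l// ltW.
by rewrite e2; lra.
Unshelve. all: by end_near.
Qed.

(** Scaling by c = 1 / sqrt (n s2) gives innovations of variance 1 / n and the conjugated map u -> c
    g(u / c). Then n * kappa is L(n) / s2, which vanishes by Lindeberg, and the threshold error is
    the energy below r over n s2. *)
Lemma chain_laplace (lam th : R) : 0 <= lam -> 0 <= th ->
  sublinear (fun n => `|beta ^+ 2 - 1| * \sum_(0 <= t < n) Ex P (fun x => lowsq (Y t x))) ->
  (fun n => Ex P (fun x => expR (- (lam * (Y n x ^+ 2 / (n%:R * s2)) +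
     th * ((\sum_(0 <= i < n) Y i x ^+ 2) / (n%:R ^+ 2 * s2))))) -
   \prod_(0 <= j < n) (1 - ric lam th n%:R j / n%:R)) @ \oo --> (0 : R).
Proof.
move=> lam0 th0 sub; pose A := lam + th + 1.
have A1 : 1 <= A by rewrite /A; lra.
have lamA : 0 <= lam <= A by rewrite lam0 /A; lra.
have thA : th <= 2 * A ^+ 2 by rewrite /A; nra.
have A0 : 0 <= A by lra.
pose S n := `|beta ^+ 2 - 1| * \sum_(0 <= t < n) lowE t + Ex P (fun x => xi 0%N x ^+ 2).
pose L n := Ex P (fun x => xi 1%N x ^+ 2 * Num.min 1 `|(Num.sqrt (n%:R * s2))^-1 * xi 1%N x|).
(* 1 / n is written as 1 / (n * 1) to be an instance of [sublinear_cvg0] for the constant sequence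
   1. *)
pose bnd n := 32 * A ^+ 2 / s2 * L n + 66 * A ^+ 2 * (1 / (n%:R * 1)) + A * (S n / (n%:R * s2)).
have x00 : 0 <= Ex P (fun x => xi 0%N x ^+ 2) by apply: Ex_ge0 => x; exact: sqr_ge0.
have S0 n : 0 <= S n by rewrite addr_ge0// mulr_ge0// sumr_ge0.
have sS : sublinear S by apply: sublinearD => //; exact: sublinear_cst.
have cb : bnd @ \oo --> (0 : R).
  have z : (0 : R) = 32 * A ^+ 2 / s2 * 0 + 66 * A ^+ 2 * 0 + A * 0 by rewrite !mulr0 !addr0.
  rewrite [X in _ --> X]z.
  have c1 := cvgM (cvg_cst (32 * A ^+ 2 / s2)) lindeberg.
  have c2 := cvgM (cvg_cst (66 * A ^+ 2))
    (sublinear_cvg0 ltr01 (fun n => ler01) (sublinear_cst (1 : R))).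
  have c3 := cvgM (cvg_cst A) (sublinear_cvg0 s20 S0 sS).
  exact: (cvgD (cvgD (c1 _ _) (c2 _ _)) (c3 _ _)).
apply/cvgr0Pnorm_le => e e0; move/cvgr0Pnorm_le : cb => /(_ _ e0) cb.
near=> n.
have hb : `|bnd n| <= e by near: n; exact: cb.
have An : 4 * A <= n%:R by near: n; exact: nbhs_infty_ger.
apply: le_trans hb; apply: le_trans (ler_norm _).
have n0 : 0 < n%:R :> R by lra.
have ns0 : 0 < n%:R * s2 by exact: mulr_gt0.
pose c := (Num.sqrt (n%:R * s2))^-1.
have c0 : 0 < c by rewrite invr_gt0 sqrtr_gt0.
have c2 : c ^+ 2 = (n%:R * s2)^-1 by rewrite exprVn sqr_sqrtr// ltW.
pose xi' t x := c * xi t x; pose y t x := c * Y t x; pose g' u := c * g (c^-1 * u).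
have mxi' t : measurable_fun setT (xi' t) by exact: measurable_funM.
have indep' : indep_seq P xi'.
  split => // t D mD.
  have mcD j : measurable ((fun u => c * u) @^-1` D j).
    by rewrite -[X in measurable X]setTI; apply: (mulrl_measurable c) => //.
  exact: (proj2 indep t (fun j => (fun u => c * u) @^-1` D j) mcD).
have mg' : measurable_fun setT g'.
  by apply: measurable_funM => //; apply: (measurableT_comp mg); exact: mulrl_measurable.
have ay0 : adapted xi' 0 (y 0%N).
  rewrite (_ : y 0%N = xi' 0%N); first exact: adapted_xi.
  by apply/funext => x; rewrite /y Y0E.
have ySE' j x : y j.+1 x = g' (y j x) + xi' j.+1 x.
  by rewrite /y /g' mulKf ?gt_eqF// YSE mulrDr.
have E2' j : (fun x => xi' j x ^+ 2) = fun x => c ^+ 2 * xi j x ^+ 2.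
  by apply/funext => x; rewrite exprMn.
have gE j : (fun x => `|g' (y j x) ^+ 2 - y j x ^+ 2|) =
    fun x => c ^+ 2 * `|beta ^+ 2 - 1| * low (Y j x).
  apply/funext => x; rewrite /g' /y mulKf ?gt_eqF// !exprMn gsq -mulrBr.
  have l0 : 0 <= low (Y j x) by rewrite /lowsq; case: ifP => // _; exact: sqr_ge0.
  rewrite [Y j x ^+ 2 + _]addrC addrK normrM [X in _ * X]normrM (ger0_norm (sqr_ge0 c)).
  by rewrite (ger0_norm l0) mulrA.
pose h (u : R) := (c * u) ^+ 2 * Num.min 1 `|c * u|.
have mh : measurable_fun setT h.
  have mcu : measurable_fun setT (fun u : R => c * u) by exact: mulrl_measurable.
  apply: measurable_funM; first exact: measurable_funX.
  by apply: measurable_minr => //; exact: measurableT_comp.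
have ih : L1 P (h \o xi 1%N).
  apply: (L1_le _ _ (L1Z (c ^+ 2) i1)); first exact: measurableT_comp.
  move=> x; rewrite /= /h ger0_norm.
    by rewrite -exprMn -[leRHS]mulr1 ler_wpM2l ?sqr_ge0// ge_min lexx.
  by rewrite mulr_ge0 ?sqr_ge0// le_min ler01 normr_ge0.
have hL : Ex P (h \o xi 1%N) = c ^+ 2 * L n.
  rewrite -ExZ.
    by apply: Ex_ext => x; rewrite /= /h exprMn mulrA.
  apply: (L1_le _ _ i1).
    apply: measurable_funM; first exact: measurable_funX.
    apply: measurable_minr => //; apply: measurableT_comp => //.
    exact: measurable_funM.
  move=> x; rewrite ger0_norm; last by rewrite mulr_ge0 ?sqr_ge0// le_min ler01 normr_ge0.
  by rewrite -[leRHS]mulr1 ler_wpM2l ?sqr_ge0// ge_min lexx.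
have := @laplace_riccati _ _ _ P xi' g' y indep' mg' ay0 ySE' lam th A (c ^+ 2 * L n) n
  lamA th0 thA A1 An.
have nV : n%:R != 0 :> R by rewrite gt_eqF.
have sV : s2 != 0 by rewrite gt_eqF.
have -> : (fun x => expR (- (lam * y n x ^+ 2 + th * (n%:R^-1 * \sum_(0 <= i < n) y i x ^+ 2)))) =
    fun x => expR (- (lam * (Y n x ^+ 2 / (n%:R * s2)) +
     th * ((\sum_(0 <= i < n) Y i x ^+ 2) / (n%:R ^+ 2 * s2)))).
  apply/funext => x.
  have E1 : y n x ^+ 2 = Y n x ^+ 2 / (n%:R * s2) by rewrite /y exprMn c2 mulrC.
  have E2 : n%:R^-1 * (\sum_(0 <= i < n) y i x ^+ 2) =
      (\sum_(0 <= i < n) Y i x ^+ 2) / (n%:R ^+ 2 * s2).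
    have -> : \sum_(0 <= i < n) y i x ^+ 2 = c ^+ 2 * \sum_(0 <= i < n) Y i x ^+ 2.
      by rewrite mulr_sumr; apply: eq_bigr => i _; rewrite /y exprMn.
    by rewrite c2; field; rewrite nV sV.
  by rewrite E1 E2.
move=> H; apply: le_trans (H _ _ _ _ _ _) _.
- by move=> j _; rewrite E2'; apply: L1Z; exact: chain_noise2.
- by move=> j _; rewrite /xi' (ExZ c (chain_noise1 j)) chain_noise_mean mulr0.
- move=> j _; rewrite E2' (ExZ _ (chain_noise2 j)) chain_noise_var c2.
  by field; rewrite nV sV.
- move=> j _; have [_ hj] := ident j mh ih.
  by rewrite -hL -hj.
- by move=> j _; rewrite gE; apply: L1Z; exact: chain_low_L1.
- apply: (L1_ext (L1Z (c ^+ 2) i0)) => x; by rewrite /y Y0E exprMn.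
have -> : Ex P (fun x => y 0%N x ^+ 2) = c ^+ 2 * Ex P (fun x => xi 0%N x ^+ 2).
  by rewrite -(ExZ _ i0); apply: Ex_ext => x; rewrite /y Y0E exprMn.
have -> : \sum_(0 <= j < n) Ex P (fun x => `|g' (y j x) ^+ 2 - y j x ^+ 2|) =
    c ^+ 2 * `|beta ^+ 2 - 1| * \sum_(0 <= j < n) lowE j.
  by rewrite mulr_sumr; apply: eq_bigr => j _; rewrite gE (ExZ _ (chain_low_L1 j)).
rewrite le_eqVlt; apply/orP; left; apply/eqP.
rewrite c2 /bnd /S; field; by rewrite nV sV.
Unshelve. all: by end_near.
Qed.

(** ** Occupation of half-lines *)

Hypothesis beta1 : beta < 1.
Hypothesis r0 : r <= 0.

(** A Lyapunov function with slope [psi] between 1 and 3. Strict convexity makes noise raise its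
    mean at bounded positions, and the term 2 y makes the upward push below r raise it although sqrt
    (1 + y^2) may decrease. *)
Let F (y : R) : R := 2 * y + Num.sqrt (1 + y ^+ 2).
Let psi (y : R) : R := 2 + y / Num.sqrt (1 + y ^+ 2).
(** A lower bound of the convexity gain of [F] under a jump e from a point of modulus at most K. *)
Let q K (e : R) : R := e ^+ 2 / (2 * (1 + K ^+ 2) * (1 + K + `|e|)).

Let rt0 (y : R) : 0 < Num.sqrt (1 + y ^+ 2).
Proof. by rewrite sqrtr_gt0; have := sqr_ge0 y; lra. Qed.

Let rt2 (y : R) : Num.sqrt (1 + y ^+ 2) ^+ 2 = 1 + y ^+ 2.
Proof. by rewrite sqr_sqrtr//; have := sqr_ge0 y; lra. Qed.

Let rt_ge (y : R) : `|y| <= Num.sqrt (1 + y ^+ 2) <= 1 + `|y|.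
Proof.
have := rt0 y; have := rt2 y; rewrite -(real_normK (num_real y)).
have := normr_ge0 y; set s := Num.sqrt _; move=> *; apply/andP; split; nra.
Qed.

(** With z = y + e and a, b the two square roots, (a b)^2 = (1 + y z)^2 + e^2. Hence a b - (1 + y z)
    = e^2 / (a b + 1 + y z) >= e^2 / (2 a b), and divided by a this is the gain over the tangent. *)
Let F_expand (y e : R) : F y + psi y * e +
  e ^+ 2 / (2 * (1 + y ^+ 2) * Num.sqrt (1 + (y + e) ^+ 2)) <= F (y + e).
Proof.
rewrite /F /psi; set a := Num.sqrt (1 + y ^+ 2); set z := y + e.
set b := Num.sqrt (1 + z ^+ 2).
have a0 : 0 < a by exact: rt0.
have b0 : 0 < b by exact: rt0.
have a2 : a ^+ 2 = 1 + y ^+ 2 by exact: rt2.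
have b2 : b ^+ 2 = 1 + z ^+ 2 by exact: rt2.
have ab0 : 0 < a * b by exact: mulr_gt0.
have D2 : (a * b) ^+ 2 = (1 + y * z) ^+ 2 + e ^+ 2 by rewrite exprMn a2 b2 /z; ring.
have D0 : 1 + y * z <= a * b.
  rewrite leNgt; apply/negP => h; have := sqr_ge0 e.
  have : (a * b) ^+ 2 < (1 + y * z) ^+ 2.
    by rewrite ltr_sqr ?nnegrE ?(ltW ab0)// ltW// (lt_trans ab0).
  by rewrite D2; lra.
have DD : (a * b - (1 + y * z)) * (a * b + (1 + y * z)) = e ^+ 2.
  by rewrite -subr_sqr D2; ring.
have key : e ^+ 2 <= (a * b - (1 + y * z)) * (2 * (a * b)).
  by rewrite -DD ler_wpM2l ?subr_ge0//; lra.
rewrite -a2.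
have -> : 2 * y + a + (2 + y / a) * e + e ^+ 2 / (2 * a ^+ 2 * b) =
   2 * z + a + y * e / a + e ^+ 2 / (2 * (a * b)) / a.
  by rewrite /z; field; rewrite !gt_eqF.
have -> : 2 * z + b = 2 * z + a + y * e / a + (a * b - (1 + y * z)) / a.
  have -> : 1 + y * z = a ^+ 2 + y * e by rewrite a2 /z; ring.
  by field; rewrite gt_eqF.
by rewrite lerD2l ler_pM2r ?invr_gt0// ler_pdivrMr// mulr_gt0.
Qed.

Let q0 K e : 0 <= K -> 0 <= q K e.
Proof.
move=> K0; have := sqr_ge0 K; have := normr_ge0 e => ? ?.
by apply: divr_ge0; [exact: sqr_ge0|apply: mulr_ge0; lra].
Qed.

Let q_le K e : 0 <= K -> q K e <= e ^+ 2.
Proof.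
move=> K0; have K2 := sqr_ge0 K; have en := normr_ge0 e.
have D1 : 1 <= 2 * (1 + K ^+ 2) * (1 + K + `|e|).
  have h1 : 1 <= 2 * (1 + K ^+ 2) by lra.
  have h2 : 1 <= 1 + K + `|e| by lra.
  by rewrite -[leLHS]mulr1 ler_pM.
by rewrite /q ler_pdivrMr ?(lt_le_trans ltr01)// ler_peMr// sqr_ge0.
Qed.

Let ind K y : R := if `|g y| <= K then 1 else 0.

Let mind K : measurable_fun setT (ind K).
Proof.
apply: measurable_fun_ifT => //; apply: measurable_fun_ler => //.
by apply: measurableT_comp.
Qed.

Let mq K : measurable_fun setT (q K).
Proof.
apply: measurable_funM => //; apply: (measurableT_comp measurable_invr).
by apply: measurable_funM => //; apply: measurable_funD.
Qed.

Let ind01 K y : 0 <= ind K y <= 1.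
Proof. by rewrite /ind; case: ifP => _; rewrite ?lexx ?ler01. Qed.

Let F_step K y e : 0 <= K ->
  F (g y) + psi (g y) * e + ind K y * q K e <= F (g y + e).
Proof.
move=> K0; apply: le_trans (F_expand (g y) e); rewrite lerD2l /ind.
have [gK|_] := leP `|g y| K; last first.
  rewrite mul0r divr_ge0 ?sqr_ge0// mulr_ge0 ?(ltW (rt0 _))//.
  by have := sqr_ge0 (g y); lra.
rewrite mul1r /q ler_wpM2l ?sqr_ge0//.
have gn := normr_ge0 (g y); have en := normr_ge0 e.
have g2 : g y ^+ 2 <= K ^+ 2.
  by rewrite -(real_normK (num_real (g y))) ler_sqr ?nnegrE.
have p1 : 0 < 2 * (1 + g y ^+ 2) by have := sqr_ge0 (g y); lra.
have p2 : 0 < 2 * (1 + K ^+ 2) by have := sqr_ge0 K; lra.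
have p3 : 0 < 1 + K + `|e| by lra.
rewrite lef_pV2 ?posrE; [|exact: mulr_gt0|exact: mulr_gt0].
apply: ler_pM; [exact: ltW|exact: (ltW (rt0 _))|lra|].
have /andP[_ h] := rt_ge (g y + e); apply: le_trans h _.
by have := ler_normD (g y) e; lra.
Qed.

Let mlow1 (y : R) : R := if y <= r then - y else 0.

Let mmlow1 : measurable_fun setT mlow1.
Proof. by apply: measurable_fun_ifT => //; apply: measurable_fun_ler. Qed.

Let mlow1_ge0 y : 0 <= mlow1 y.
Proof. by rewrite /mlow1; case: ifP => // yr; rewrite oppr_ge0 (le_trans yr). Qed.

(** Below r <= 0 the map moves y up by dl = (1 - beta) |y|; the term 2 y gains 2 dl and the
    1-Lipschitz square root loses at most dl. *)
Let F_push y : F y + (1 - beta) * mlow1 y <= F (g y).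
Proof.
rewrite /mlow1 /g; case: ltP => yr; first by rewrite mulr0 addr0.
have y0 : y <= 0 by exact: le_trans r0.
pose dl := (1 - beta) * - y.
have dl0 : 0 <= dl by rewrite mulr_ge0 ?oppr_ge0// subr_ge0 ltW.
have bE : beta * y = y + dl by rewrite /dl; ring.
rewrite -/dl bE /F.
set a := Num.sqrt (1 + y ^+ 2); set b := Num.sqrt (1 + (y + dl) ^+ 2).
have a2 : a ^+ 2 = 1 + y ^+ 2 by exact: rt2.
have b2 : b ^+ 2 = 1 + (y + dl) ^+ 2 by exact: rt2.
have a0 : 0 < a by exact: rt0.
have b0 : 0 < b by exact: rt0.
have bn : - (y + dl) <= b.
  by have /andP[h _] := rt_ge (y + dl); apply: le_trans h; rewrite -normrN ler_norm.
suff : a <= b + dl by lra.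
rewrite leNgt; apply/negP => h.
have h2 : (b + dl) ^+ 2 < a ^+ 2 by rewrite ltr_sqr ?nnegrE; lra.
have ybd : 0 <= y + dl + b by lra.
have := mulr_ge0 dl0 ybd; move: h2.
have -> : (b + dl) ^+ 2 = b ^+ 2 + 2 * b * dl + dl ^+ 2 by ring.
rewrite a2 b2.
have -> : 1 + (y + dl) ^+ 2 + 2 * b * dl + dl ^+ 2 = 1 + y ^+ 2 + 2 * (dl * (y + dl + b)) by ring.
by lra.
Qed.

Let mF : measurable_fun setT F.
Proof.
apply: measurable_funD; first exact: measurable_funM.
apply: continuous_measurable_fun => y.
apply: continuous_comp; last exact: sqrt_continuous.
by apply: cvgD; [exact: cvg_cst|exact: exprn_continuous].
Qed.

Let F_abs y : `|F y| <= 3 * `|y| + 1.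
Proof.
rewrite /F (le_trans (ler_normD _ _))// normrM (ger0_norm (ltW (rt0 y))).
have /andP[_ h] := rt_ge y; rewrite ger0_norm//; lra.
Qed.

Let mpsi : measurable_fun setT psi.
Proof.
rewrite (_ : psi = fun y => 2 + y * (F y - 2 * y)^-1); last first.
  by apply/funext => y; rewrite /psi /F; congr (_ + _ / _); ring.
apply: measurable_funD => //; apply: measurable_funM => //.
by apply: (measurableT_comp measurable_invr); apply: measurable_funB.
Qed.

Let psi_abs y : `|psi y| <= 3.
Proof.
have h : `|y / Num.sqrt (1 + y ^+ 2)| <= 1.
  rewrite normrM (ger0_norm (_ : 0 <= (Num.sqrt (1 + y ^+ 2))^-1)).
    by rewrite ler_pdivrMr// mul1r; have /andP[] := rt_ge y.
  by rewrite invr_ge0 ltW.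
by rewrite /psi (le_trans (ler_normD _ _))// ger0_norm//; lra.
Qed.

Let iq K : 0 <= K -> L1 P (q K \o xi 1%N).
Proof.
move=> K0; apply: (L1_le _ _ i1); first exact: measurableT_comp.
by move=> x; rewrite /= ger0_norm ?q0// q_le.
Qed.

(** On |e| <= L, q is at least e^2 / D, and for L large the innovations of size at most L carry half
    of the variance. *)
Let q_pos K : 0 <= K -> 0 < Ex P (q K \o xi 1%N).
Proof.
have r0' := r0; have s20' := s20; have beta1' := beta1.
move=> K0; have s22 : 0 < s2 / 2 by rewrite divr_gt0.
have [L L0 tL] := tail_small s22.
pose D := 2 * (1 + K ^+ 2) * (1 + K + L).
have K2 := sqr_ge0 K.
have D0 : 0 < D by apply: mulr_gt0; lra.
have : s2 <= D * Ex P (q K \o xi 1%N) + Ex P (tail L \o xi 1%N).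
  rewrite -e2 -(ExZ D (iq K0)) -(ExD (L1Z D (iq K0)) (itail L)).
  apply: Ex_le; [exact: i1|by apply: L1D; [apply: L1Z; exact: iq|exact: itail]|].
  move=> x /=; rewrite /tail; have [eL|eL] := ltP L `|xi 1%N x|.
    by rewrite lerDr mulr_ge0 ?(ltW D0)// q0.
  have en := normr_ge0 (xi 1%N x).
  have p2 : 0 < 2 * (1 + K ^+ 2) by lra.
  have p3 : 0 < 1 + K + `|xi 1%N x| by lra.
  have p4 : 0 < 2 * (1 + K ^+ 2) * (1 + K + `|xi 1%N x|) by exact: mulr_gt0.
  have h : 1 <= D / (2 * (1 + K ^+ 2) * (1 + K + `|xi 1%N x|)).
    by rewrite ler_pdivlMr// mul1r /D ler_pM2l//; lra.
  rewrite addr0 /q mulrCA -[leLHS]mulr1.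
  by apply: ler_wpM2l => //; exact: sqr_ge0.
have Eq0 : 0 <= Ex P (q K \o xi 1%N) by apply: Ex_ge0 => x /=; exact: q0.
move=> h; rewrite lt_def Eq0 andbT; apply/eqP => E0.
by move: h; rewrite E0 mulr0; lra.
Qed.

Let iF t : L1 P (fun x => F (Y t x)).
Proof.
have iY : L1 P (Y t) by exact: L2_L1 (@mY t) (chain_L2 t).
apply: (L1_le _ _ (L1D (L1Z 3 (L1_norm iY)) (L1_cst P 1))); first exact: measurableT_comp.
by move=> x; exact: F_abs.
Qed.

Let iFg t : L1 P (fun x => F (g (Y t x))).
Proof.
have igY : L1 P (fun x => g (Y t x)) by exact: L2_L1 (@mgY t) (igY2 t).
apply: (L1_le _ _ (L1D (L1Z 3 (L1_norm igY)) (L1_cst P 1))).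
  exact: (measurableT_comp mF (@mgY t)).
by move=> x; exact: F_abs.
Qed.

Let im t : L1 P (fun x => mlow1 (Y t x)).
Proof.
have iY : L1 P (Y t) by exact: L2_L1 (@mY t) (chain_L2 t).
apply: (L1_le _ _ (L1_norm iY)); first exact: (measurableT_comp mmlow1 (@mY t)).
move=> x; rewrite ger0_norm// /mlow1; case: ifP => // _.
by rewrite -normrN ler_norm.
Qed.

Let iind K t : L1 P (fun x => ind K (Y t x)).
Proof.
apply: (L1_bnd P (M := 1)); first exact: (measurableT_comp (mind K) (@mY t)).
by move=> x; have /andP[h1 h2] := ind01 K (Y t x); rewrite ger0_norm.
Qed.

(** The tangent term averages to 0 as its slope is known at time t; what remains is the push below r
    and the convexity gain where |g(Y_t)| <= K. *)
Let drift K t : 0 <= K ->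
  Ex P (fun x => F (Y t x)) + (1 - beta) * Ex P (fun x => mlow1 (Y t x)) +
  Ex P (q K \o xi 1%N) * Ex P (fun x => ind K (Y t x)) <= Ex P (fun x => F (Y t.+1 x)).
Proof.
move=> K0.
have apsi : adapted xi t (fun x => psi (g (Y t x))) by apply: (measurableT_comp mpsi); exact: agY.
have ipsi : L1 P (fun x => psi (g (Y t x))).
  by apply: (L1_bnd P (M := 3)) => //; exact: (measurableT_comp mpsi (@mgY t)).
have [ic ec] := adapted_mul_indep indep apsi (@measurable_id _ _ _) ipsi (chain_noise1 t).
rewrite /= in ic ec.
rewrite (_ : Ex P (id \o xi t.+1) = 0) ?mulr0 in ec; last exact: chain_noise_mean.
have aind : adapted xi t (fun x => ind K (Y t x)).
  by apply: (measurableT_comp (mind K)); exact: chain_adapted.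
have [iqt eqt] := ident t (mq K) (iq K0).
have [iq' eq'] := adapted_mul_indep indep aind (mq K) (iind K t) iqt.
rewrite eqt mulrC in eq'.
rewrite -eq' -(ExZ _ (im t)) -(ExD (iF t) (L1Z _ (im t))).
apply: le_trans (_ : Ex P (fun x => F (g (Y t x))) + Ex P (fun x => ind K (Y t x) * q K (xi t.+1 x)) <= _).
  rewrite lerD2r; apply: Ex_le; [|exact: iFg|by move=> x; exact: F_push].
  by apply: L1D; [exact: iF|apply: L1Z; exact: im].
have -> : Ex P (fun x => F (g (Y t x))) + Ex P (fun x => ind K (Y t x) * q K (xi t.+1 x)) =
    Ex P (fun x => F (g (Y t x)) + psi (g (Y t x)) * xi t.+1 x + ind K (Y t x) * q K (xi t.+1 x)).
  by rewrite (ExD (L1D (iFg t) ic) iq') (ExD (iFg t) ic) ec addr0.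
apply: Ex_le; [|exact: iF|by move=> x; rewrite YSE; exact: F_step].
by apply: L1D; [apply: L1D; [exact: iFg|exact: ic]|exact: iq'].
Qed.

Let below K (y : R) : R := if y <= K then 1 else 0.

Let mbelow K : measurable_fun setT (below K).
Proof. by apply: measurable_fun_ifT => //; apply: measurable_fun_ler. Qed.

Let ibelow K t : L1 P (fun x => below K (Y t x)).
Proof.
apply: (L1_bnd P (M := 1)); first exact: (measurableT_comp (mbelow K) (@mY t)).
by move=> x; rewrite /below; case: ifP => _; rewrite ger0_norm.
Qed.

(** A point below K either has modulus at most K, so its image is bounded by (1 + |beta|) K, or lies
    under -K <= r, where the push term is at least 1. *)
Let below_cover K y : 1 <= K -> `|r| <= K ->
  below K y <= ind ((1 + `|beta|) * K) y + mlow1 y.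
Proof.
have r0' := r0; have s20' := s20; have beta1' := beta1.
move=> K1 rK; have bn := normr_ge0 beta; have m0 := mlow1_ge0 y.
have /andP[id0 _] := ind01 ((1 + `|beta|) * K) y.
have bK : 0 <= `|beta| * K by rewrite mulr_ge0//; lra.
rewrite /below; case: ifPn => [yK|_]; last by lra.
have [yK'|yK'] := leP `|y| K.
  have -> : ind ((1 + `|beta|) * K) y = 1.
    rewrite /ind /g; case: ltP => _; rewrite ?normrM.
      by have -> : `|y| <= (1 + `|beta|) * K by lra.
    have h : `|beta| * `|y| <= `|beta| * K by rewrite ler_wpM2l.
    by have -> : `|beta| * `|y| <= (1 + `|beta|) * K by lra.
  by lra.
have yn : y < 0.
  rewrite ltNge; apply/negP => y0; move: yK'; rewrite ger0_norm//; lra.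
have ny : `|y| = - y by rewrite ltr0_norm.
have nr : `|r| = - r by rewrite ler0_norm.
have yr : y <= r by rewrite ny in yK'; rewrite nr in rK; lra.
by rewrite /mlow1 yr -ny; lra.
Qed.

Hypothesis glow : beta < 0 -> forall y, - `|r| <= g y.

(** In the variance recursion the term (beta^2 - 1) E low is nonpositive for 0 <= beta < 1; for beta
    < 0 the map is bounded below and [low_bnd] bounds it. *)
Let second_linear : exists C : R, forall n, Ex P (fun x => Y n x ^+ 2) <= C * (1 + n%:R).
Proof.
have r0' := r0; have s20' := s20; have beta1' := beta1.
pose C0 := Ex P (fun x => xi 0%N x ^+ 2) + (2 * r ^+ 2 + 2 * s2).
have q0' : 0 <= Ex P (fun x => xi 0%N x ^+ 2) by apply: Ex_ge0 => x; exact: sqr_ge0.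
have q1' : 0 <= 2 * r ^+ 2 + 2 * s2 by have := s20; have := sqr_ge0 r; lra.
have C00 : 0 <= C0 by rewrite /C0; lra.
have b2 := sqr_ge0 beta.
have hb t : (beta ^+ 2 - 1) * lowE t <= (beta ^+ 2 + 1) * C0.
  have l0 := lowE0 t.
  have rhs0 : 0 <= (beta ^+ 2 + 1) * C0 by apply: mulr_ge0; lra.
  have [b0|b0] := leP 0 beta.
    apply: le_trans rhs0; rewrite mulr_le0_ge0// subr_le0.
    by rewrite expr_le1// ltW.
  have lC : lowE t <= C0.
    case: t {l0} => [|t]; first by have := lowE_init; rewrite /C0; lra.
    by have := low_bnd t (glow b0); rewrite /C0; lra.
  apply: le_trans (_ : (beta ^+ 2 + 1) * lowE t <= _); last by rewrite ler_wpM2l//; lra.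
  by rewrite ler_wpM2r//; lra.
pose C := Ex P (fun x => xi 0%N x ^+ 2) + (beta ^+ 2 + 1) * C0 + s2.
have rhs0 : 0 <= (beta ^+ 2 + 1) * C0 by apply: mulr_ge0; lra.
have CC : 0 <= C by rewrite /C; lra.
exists C; elim=> [|n ih].
  have -> : Ex P (fun x => Y 0%N x ^+ 2) = Ex P (fun x => xi 0%N x ^+ 2).
    by apply: Ex_ext => x; rewrite Y0E.
  by rewrite addr0 mulr1 /C; lra.
rewrite chain_var -natr1; have := hb n; rewrite /C in ih *.
by lra.
Qed.

(** Summing the drift telescopes E F(Y_t), so the occupation is at most a constant plus a multiple
    of E |Y_n|, which is sublinear because E Y_n^2 is O(n). *)
Lemma occupation_sublinear K :
  sublinear (fun n => \sum_(0 <= t < n) Ex P (fun x => below K (Y t x))).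
Proof.
have r0' := r0; have s20' := s20; have beta1' := beta1.
pose K0 := Num.max K (Num.max 1 `|r|).
have K01 : 1 <= K0 by rewrite !le_max lexx orbT.
have K0r : `|r| <= K0 by rewrite !le_max lexx !orbT.
have KK0 : K <= K0 by rewrite le_max lexx.
pose K1 := (1 + `|beta|) * K0.
have K10 : 0 <= K1 by rewrite mulr_ge0 ?addr_ge0//; lra.
pose c := Num.min (1 - beta) (Ex P (q K1 \o xi 1%N)).
have c0 : 0 < c by rewrite lt_min q_pos// andbT subr_gt0.
have step t : c * Ex P (fun x => below K (Y t x)) <=
    Ex P (fun x => F (Y t.+1 x)) - Ex P (fun x => F (Y t x)).
  have h1 : Ex P (fun x => below K (Y t x)) <=
      Ex P (fun x => ind K1 (Y t x)) + Ex P (fun x => mlow1 (Y t x)).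
    rewrite -(ExD (iind K1 t) (im t)); apply: Ex_le; [exact: ibelow|by apply: L1D; [exact: iind|exact: im]|].
    move=> x; apply: le_trans (below_cover _ K01 K0r); rewrite /below.
    case: ifPn => [yK|_]; first by rewrite (le_trans yK).
    by case: ifP => _; rewrite ?ler01.
  have h2 := drift t K10.
  have m0 : 0 <= Ex P (fun x => mlow1 (Y t x)) by exact: Ex_ge0.
  have n0 : 0 <= Ex P (fun x => ind K1 (Y t x)).
    by apply: Ex_ge0 => x; case/andP: (ind01 K1 (Y t x)).
  have h3 : c * Ex P (fun x => mlow1 (Y t x)) <= (1 - beta) * Ex P (fun x => mlow1 (Y t x)).
    by rewrite ler_wpM2r// ge_min lexx.
  have h4 : c * Ex P (fun x => ind K1 (Y t x)) <=
      Ex P (q K1 \o xi 1%N) * Ex P (fun x => ind K1 (Y t x)).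
    by rewrite ler_wpM2r// ge_min lexx orbT.
  have := ler_wpM2l (ltW c0) h1; lra.
have [C hC] := second_linear.
have sumE n : c * \sum_(0 <= t < n) Ex P (fun x => below K (Y t x)) <=
    Ex P (fun x => F (Y n x)) - Ex P (fun x => F (Y 0%N x)).
  rewrite mulr_sumr -(telescope_sumr (fun t => Ex P (fun x => F (Y t x))))//.
  by apply: ler_sum_nat => t _; exact: step.
pose D := `|Ex P (fun x => F (Y 0%N x))| + 1.
apply: (sublinear_le (S' := fun n => c^-1 * (D + 3 * Ex P (fun x => `|Y n x|)))).
  apply: sublinearZ; first by rewrite invr_ge0 ltW.
  apply: sublinearD; first exact: sublinear_cst.
  apply: sublinearZ => //.
  apply: (sublinear_sqr hC) => n th th0.
  by apply: Ex_abs_amgm => //; exact: chain_L2.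
move=> n; rewrite ler_pdivlMl//; apply: le_trans (sumE n) _.
have iY : L1 P (Y n) by exact: L2_L1 (@mY n) (chain_L2 n).
have : Ex P (fun x => F (Y n x)) <= 3 * Ex P (fun x => `|Y n x|) + 1.
  rewrite -(ExZ 3 (L1_norm iY)) -[X in _ <= _ + X](Ex_cst P).
  rewrite -(ExD (L1Z 3 (L1_norm iY)) (L1_cst P 1)).
  apply: Ex_le; [exact: iF|by apply: L1D; [apply: L1Z; exact: L1_norm|exact: L1_cst]|].
  by move=> x; exact: le_trans (ler_norm _) (F_abs _).
have := ler_norm (- Ex P (fun x => F (Y 0%N x))); rewrite normrN /D; lra.
Qed.

(** A contraction with sublinear input: E low at t+1 is at most b^2 times E low at t, plus C P(Y_t
    <= K), plus a tail made small by K. Summing and absorbing b^2 < 1 leaves the occupation time. *)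
Lemma low_sublinear :
  sublinear (fun n => \sum_(0 <= t < n) Ex P (fun x => lowsq (Y t x))).
Proof.
have r0' := r0; have s20' := s20; have beta1' := beta1.
(* For beta < 0 a low value is reflected above -|r| and passes none of its energy on, so the
   contraction factor is 0. *)
pose b := Num.max beta 0.
have b0 : 0 <= b by rewrite le_max lexx orbT.
have b1 : b < 1 by rewrite gt_max beta1 ltr01.
have bb : b ^+ 2 < 1 by rewrite expr_lt1.
pose C := 2 * r ^+ 2 + 2 * s2.
have C0 : 0 <= C by have := s20; have := sqr_ge0 r; rewrite /C; lra.
pose my (y : R) := if y <= r then y else 0.
have mmy : measurable_fun setT my by apply: measurable_fun_ifT => //; apply: measurable_fun_ler.
have pt K y e : 0 <= K -> low (g y + e) <=
    b ^+ 2 * low y + 2 * b * (my y * e) + below K y * (2 * r ^+ 2 + 2 * e ^+ 2) + tail K e.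
  move=> K0; have t0 : 0 <= tail K e by rewrite /tail; case: ifP => // _; exact: sqr_ge0.
  have c0 : 0 <= 2 * r ^+ 2 + 2 * e ^+ 2 by have := sqr_ge0 r; have := sqr_ge0 e; lra.
  have nr : `|r| = - r by rewrite ler0_norm.
  have ne := ler_norm (- e); rewrite normrN in ne.
  have en := normr_ge0 e.
  rewrite {2}/low /my /g; have [ry|yr] := ltP r y.
    rewrite !mul0r !mulr0 !add0r /below; have [yK|yK] := leP y K.
      rewrite mul1r; rewrite /low; case: ifPn => [yer|_]; last by rewrite addr_ge0.
      apply: le_trans (_ : 2 * r ^+ 2 + 2 * e ^+ 2 <= _); last by rewrite lerDl.
      by apply: sqr_bnd; rewrite nr; apply/andP; split; lra.
    (* Falling from above K to below r <= 0 takes an innovation e with |e| > K, and then (y + e)^2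
       <= e^2. *)
    rewrite mul0r add0r /low; case: ifPn => // yer.
    have Ke : K < `|e| by lra.
    have e' : e < 0 by lra.
    rewrite /tail Ke -[leLHS]sqrrN -[leRHS]sqrrN.
    by rewrite ler_sqr ?nnegrE; lra.
  have -> : below K y = 1 by rewrite /below (le_trans yr)// (le_trans r0).
  rewrite mul1r; have [bp|bn] := leP 0 beta.
    have -> : b = beta by rewrite /b max_l.
    apply: le_trans (low_le _) _.
    have -> : (beta * y + e) ^+ 2 = beta ^+ 2 * y ^+ 2 + 2 * beta * (y * e) + e ^+ 2 by ring.
    by have := sqr_ge0 r; have := sqr_ge0 e; lra.
  have -> : b = 0 by rewrite /b max_r// ltW.
  rewrite expr0n /= !(mulr0, mul0r) !add0r.
  rewrite /low; case: ifPn => [yer|_]; last by rewrite addr_ge0.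
  apply: le_trans (_ : 2 * r ^+ 2 + 2 * e ^+ 2 <= _); last by rewrite lerDl.
  apply: sqr_bnd; have := glow bn y; rewrite /g ltNge yr /= => gl.
  by rewrite nr in gl *; apply/andP; split; lra.
have amy t : adapted xi t (fun x => my (Y t x)).
  by apply: (measurableT_comp mmy); exact: chain_adapted.
have imy t : L1 P (fun x => my (Y t x)).
  have iY : L1 P (Y t) by exact: L2_L1 (@mY t) (chain_L2 t).
  apply: (L1_le _ _ (L1_norm iY)); first exact: (measurableT_comp mmy (@mY t)).
  by move=> x; rewrite /my; case: ifP => // _; rewrite normr0.
have step K t : 0 <= K -> lowE t.+1 <= b ^+ 2 * lowE t +
    C * Ex P (fun x => below K (Y t x)) + Ex P (tail K \o xi 1%N).
  move=> K0.
  have [ic ec] := adapted_mul_indep indep (amy t) (@measurable_id _ _ _) (imy t) (chain_noise1 t).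
  rewrite /= in ic ec.
  rewrite (_ : Ex P (id \o xi t.+1) = 0) ?mulr0 in ec; last exact: chain_noise_mean.
  have abel : adapted xi t (fun x => below K (Y t x)).
    by apply: (measurableT_comp (mbelow K)); exact: chain_adapted.
  have mc : measurable_fun setT (fun e : R => 2 * r ^+ 2 + 2 * e ^+ 2).
    by apply: measurable_funD => //; exact: measurable_funM.
  have icc : L1 P ((fun e : R => 2 * r ^+ 2 + 2 * e ^+ 2) \o xi t.+1).
    by apply: (L1D (L1_cst P _)); apply: L1Z; exact: chain_noise2.
  have [ib eb] := adapted_mul_indep indep abel mc (ibelow K t) icc.
  have ecc : Ex P ((fun e : R => 2 * r ^+ 2 + 2 * e ^+ 2) \o xi t.+1) = C.
    rewrite /C -(chain_noise_var t) -(ExZ 2 (chain_noise2 t)) -[X in _ = X + _](Ex_cst P).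
    by rewrite -(ExD (L1_cst P _) (L1Z 2 (chain_noise2 t))).
  rewrite ecc in eb.
  have [it et] := ident t (mtail K) (itail K).
  rewrite -et [C * _]mulrC -eb.
  have j1 := L1Z (b ^+ 2) (chain_low_L1 t).
  have j2 := L1Z (2 * b) ic.
  have -> : b ^+ 2 * lowE t + Ex P (fun x => below K (Y t x) * (2 * r ^+ 2 + 2 * xi t.+1 x ^+ 2)) +
      Ex P (tail K \o xi t.+1) =
      Ex P (fun x => b ^+ 2 * low (Y t x) + 2 * b * (my (Y t x) * xi t.+1 x) +
        below K (Y t x) * (2 * r ^+ 2 + 2 * xi t.+1 x ^+ 2) + tail K (xi t.+1 x)).
    rewrite (ExD (L1D (L1D j1 j2) ib) it) (ExD (L1D j1 j2) ib) (ExD j1 j2).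
    by rewrite (ExZ _ (chain_low_L1 t)) (ExZ _ ic) ec mulr0 addr0.
  apply: Ex_le; [exact: chain_low_L1|by apply: L1D => //; apply: L1D => //; exact: L1D j1 j2|].
  by move=> x; rewrite YSE; exact: pt.
move=> e e0.
pose c := 1 - b ^+ 2; have c0 : 0 < c by rewrite subr_gt0.
have ec2 : 0 < e * c / 2 by rewrite divr_gt0// mulr_gt0.
have [K K0 tK] := tail_small ec2.
have [D hD] := sublinearZ C0 (occupation_sublinear K) ec2.
exists ((lowE 0 + D) / c) => n.
pose S := \sum_(0 <= t < n) lowE t; rewrite -/S.
have h1 : S <= lowE 0 + \sum_(0 <= t < n) lowE t.+1.
  have -> : lowE 0 + \sum_(0 <= t < n) lowE t.+1 = \sum_(0 <= t < n.+1) lowE t.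
    by rewrite big_nat_recl.
  by rewrite big_nat_recr//= lerDl.
have h2 : \sum_(0 <= t < n) lowE t.+1 <= b ^+ 2 * S +
    C * \sum_(0 <= t < n) Ex P (fun x => below K (Y t x)) + e * c / 2 * n%:R.
  apply: le_trans (_ : \sum_(0 <= t < n) (b ^+ 2 * lowE t +
     C * Ex P (fun x => below K (Y t x)) + e * c / 2) <= _).
    by apply: ler_sum_nat => t _; apply: le_trans (step K t K0) _; rewrite lerD2l.
  rewrite !big_split /= sumr_const_nat subn0 -[X in _ + X <= _]mulr_natr.
  by rewrite -!mulr_sumr.
have h3 : c * S <= lowE 0 + D + e * c * n%:R.
  have cS : c * S = S - b ^+ 2 * S by rewrite /c; ring.
  by have hDn := hD n; rewrite cS; lra.
have -> : (lowE 0 + D) / c + e * n%:R = (lowE 0 + D + e * c * n%:R) / c.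
  by field; rewrite gt_eqF.
by rewrite ler_pdivlMr// mulrC.
Qed.

End chain_moments.

Lemma EFin_Ex {d} {T : measurableType d} {R : realType} (P : probability T R)
    (X : T -> R) : L1 P X -> (\int[P]_x (X x)%:E)%E = (Ex P X)%:E.
Proof.
by move=> iX; rewrite /Ex /Rintegral fineK//; apply: integrable_fin_num.
Qed.

(** * Pathwise error of the estimator's numerator and denominator *)

Section lse_error.
Context {R : realType} (beta r : R) (y e : nat -> R).
Hypothesis yS : forall t, y t.+1 = thr_map beta r (y t) + e t.+1.

Let hiid (u : R) : R := if r < u then u else 0.

Lemma thr_square_telescope n : y n ^+ 2 = y 0%N ^+ 2 +
  (beta ^+ 2 - 1) * (\sum_(0 <= t < n) lowsq r (y t)) +
  2 * (\sum_(0 <= t < n) hiid (y t) * e t.+1) +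
  2 * beta * (\sum_(0 <= t < n) lowid r (y t) * e t.+1) +
  \sum_(0 <= t < n) e t.+1 ^+ 2.
Proof.
elim: n => [|n IH]; first by rewrite !big_geq// !mulr0 !addr0.
rewrite !big_nat_recr//=; move: IH.
set S1 := \sum_(_ <= _ < _) _; set S2 := \sum_(_ <= _ < _) _.
set S3 := \sum_(_ <= _ < _) _; set S4 := \sum_(_ <= _ < _) _ => IH.
have -> : y n.+1 ^+ 2 = y n ^+ 2 + (beta ^+ 2 - 1) * lowsq r (y n) +
    2 * (hiid (y n) * e n.+1) + 2 * beta * (lowid r (y n) * e n.+1) + e n.+1 ^+ 2.
  rewrite yS /thr_map /hiid /lowid /lowsq ?leNgt.
  by case: (r < y n) => /=; ring.
by rewrite IH; ring.
Qed.

(** The telescoped square is solved for the martingale above r. The sums of the estimator start at t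
    = 1, so the term 2 h e_1 at t = 0 joins the error through 2 |h e_1| <= y_0^2 + e_1^2, whence 2
    y_0^2. Later s is n s2. *)
Lemma lse_num_error n (s : R) : (0 < n)%N ->
  `|2 * (\sum_(1 <= t < n) (if r < y t then y t * y t.+1 else 0) -
         \sum_(1 <= t < n) (if r < y t then y t ^+ 2 else 0)) - (y n ^+ 2 - s)| <=
  2 * y 0%N ^+ 2 + e 1%N ^+ 2 +
  `|beta ^+ 2 - 1| * (\sum_(0 <= t < n) lowsq r (y t)) +
  2 * `|beta| * `|\sum_(0 <= t < n) lowid r (y t) * e t.+1| +
  `|\sum_(0 <= t < n) e t.+1 ^+ 2 - s|.
Proof.
move=> n0; rewrite -sumrB.
have -> : \sum_(1 <= t < n) ((if r < y t then y t * y t.+1 else 0) -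
     (if r < y t then y t ^+ 2 else 0)) = \sum_(1 <= t < n) hiid (y t) * e t.+1.
  apply: eq_bigr => t _; rewrite yS /thr_map /hiid ?leNgt.
  by case: (r < y t) => /=; ring.
have := thr_square_telescope n.
rewrite (big_ltn (F := fun t => hiid (y t) * e t.+1) n0).
have low0 : 0 <= \sum_(0 <= t < n) lowsq r (y t).
  by apply: sumr_ge0 => t _; rewrite /lowsq; case: ifP => // _; exact: sqr_ge0.
set S1 := \sum_(0 <= t < n) lowsq r (y t) in low0 *; set S2 := \sum_(1 <= _ < _) _.
set S3 := \sum_(0 <= t < n) lowid r (y t) * e t.+1.
set S4 := \sum_(0 <= t < n) e t.+1 ^+ 2; set h := hiid (y 0%N) => ->.
have -> : 2 * S2 - (y 0%N ^+ 2 + (beta ^+ 2 - 1) * S1 + 2 * (h * e 1%N + S2) +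
    2 * beta * S3 + S4 - s) = - ((2 * (h * e 1%N) + y 0%N ^+ 2) + (beta ^+ 2 - 1) * S1 +
    2 * beta * S3 + (S4 - s)) by ring.
have h2 : h ^+ 2 <= y 0%N ^+ 2.
  by rewrite /h /hiid; case: ifP => // _; rewrite expr0n; exact: sqr_ge0.
have n2 (a b : R) : `|2 * a * b| = 2 * `|a| * `|b| by rewrite !normrM (ger0_norm (ler0n _ 2)).
rewrite normrN (le_trans (ler_normD _ _))// lerD2r.
rewrite (le_trans (ler_normD _ _))// n2 lerD2r.
rewrite (le_trans (ler_normD _ _))// normrM (ger0_norm low0) lerD2r.
rewrite (le_trans (ler_normD _ _))// (ger0_norm (sqr_ge0 _)) mulrA n2.
have p := sqr_ge0 (`|h| - `|e 1%N|).
have q1 : `|h| ^+ 2 = h ^+ 2 by rewrite real_normK ?num_real.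
have q2 : `|e 1%N| ^+ 2 = e 1%N ^+ 2 by rewrite real_normK ?num_real.
have pE : (`|h| - `|e 1%N|) ^+ 2 = `|h| ^+ 2 + `|e 1%N| ^+ 2 - 2 * `|h| * `|e 1%N| by ring.
by rewrite pE q1 q2 in p; lra.
Qed.

Lemma lse_den_error n : (0 < n)%N ->
  `|\sum_(1 <= t < n) (if r < y t then y t ^+ 2 else 0) - \sum_(0 <= t < n) y t ^+ 2| <=
  y 0%N ^+ 2 + \sum_(0 <= t < n) lowsq r (y t).
Proof.
move=> n0.
have -> : \sum_(1 <= t < n) (if r < y t then y t ^+ 2 else 0) =
    \sum_(1 <= t < n) y t ^+ 2 - \sum_(1 <= t < n) lowsq r (y t).
  rewrite -sumrB; apply: eq_bigr => t _; rewrite /lowsq ?leNgt.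
  by case: (r < y t) => /=; ring.
have l0 t : 0 <= lowsq r (y t) by rewrite /lowsq; case: ifP => // _; exact: sqr_ge0.
have s0 : 0 <= \sum_(1 <= t < n) lowsq r (y t) by apply: sumr_ge0 => t _; exact: l0.
rewrite (big_ltn (F := fun t => y t ^+ 2) n0) (big_ltn (F := fun t => lowsq r (y t)) n0).
set S1 := \sum_(1 <= t < n) y t ^+ 2; set S2 := \sum_(1 <= t < n) _ in s0 *.
have -> : S1 - S2 - (y 0%N ^+ 2 + S1) = - (y 0%N ^+ 2 + S2) by ring.
rewrite normrN ger0_norm; last by rewrite addr_ge0// sqr_ge0.
by rewrite lerD2l lerDr.
Qed.

End lse_error.

(** * Assembly of the limit theorem *)

Theorem theorem2p1 (R : realType) (d : measure_display) (T : measurableType d)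
  (P : probability T R) (eps : nat -> T -> R) (Y0 : T -> R)
  (alpha beta r : R) (ahat : nat -> T -> R) :
  (* {Y0, eps_1, eps_2, ...} mutually independent (eps i.i.d., Y0 independent of eps) *)
  mutually_independent P (fun t : nat => if t == 0%N then Y0 else eps t) ->
  (* eps_t identically distributed, t >= 1 *)
  (forall t A, (1 <= t)%N -> measurable A ->
     P (eps t @^-1` A) = P (eps 1%N @^-1` A)) ->
  (* E eps_1 = 0, 0 < E eps_1^2 < oo *)
  P.-integrable setT (fun x => (eps 1%N x)%:E) ->
  (\int[P]_x (eps 1%N x)%:E = 0)%E ->
  (0 < \int[P]_x (eps 1%N x ^+ 2)%:E < +oo)%E ->
  (* E Y0^2 < oo *)
  (\int[P]_x (Y0 x ^+ 2)%:E < +oo)%E ->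
  (* hat alpha_n: any measurable version equal to num/den where den <> 0 *)
  (forall n, measurable_fun setT (ahat n)) ->
  (forall n x, lse_den r (tar1 alpha beta r Y0 eps) n x != 0 ->
     ahat n x = lse_num r (tar1 alpha beta r Y0 eps) n x
                / lse_den r (tar1 alpha beta r Y0 eps) n x) ->
  (* cases (i) and (ii) *)
  ((alpha = 1 /\ beta < 1 /\ r <= 0) \/ (alpha = 1 /\ beta = -1)) ->
  forall (dO : measure_display) (O : measurableType dO) (Q : probability O R)
         (B : R -> O -> R),
  standard_brownian_motion Q B ->
  conv_in_distribution P (fun n x => n%:R * (ahat n x - 1)) Q
    (fun w => (B 1 w ^+ 2 - 1) /
              (2 * Rintegral lebesgue_measure `[0, 1] (fun t => B t w ^+ 2))).
Proof.
move=> indepM law ieps eeps /andP[v0 voo] Y02 mahat ahatE cases dO O Q B hB.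
have [alE {}cases] : alpha = 1 /\ ((beta < 1 /\ r <= 0) \/ beta = -1).
  by case: cases => [[? ?]|[? ?]]; split => //; [left|right].
subst alpha.
pose xi (t : nat) := if t == 0%N then Y0 else eps t.
have {}indepM : mutually_independent P xi by exact: indepM.
pose Y := tar1 1 beta r Y0 eps.
have indep : indep_seq P xi by exact: mutually_independent_indep_seq.
have mxi := proj1 indep.
pose s2 := Ex P (fun x => xi 1%N x ^+ 2).
have i0 : L1 P (fun x => xi 0%N x ^+ 2).
  apply: L1_ge0; [exact: measurable_funX|by move=> x; exact: sqr_ge0|exact: Y02].
have i1 : L1 P (fun x => xi 1%N x ^+ 2).
  apply: L1_ge0; [exact: measurable_funX|by move=> x; exact: sqr_ge0|exact: voo].
have s20 : 0 < s2.
  have h : (\int[P]_x (eps 1%N x ^+ 2)%:E)%E = s2%:E := EFin_Ex i1.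
  by move: v0; rewrite h lte_fin.
have iE1 : L1 P (xi 1%N) by exact: ieps.
have e1 : Ex P (xi 1%N) = 0.
  have h : 0%E = (Ex P (xi 1%N))%:E := etrans (esym eeps) (EFin_Ex iE1).
  by case: h.
have e2 : Ex P (fun x => xi 1%N x ^+ 2) = s2 by [].
have ident t (h : R -> R) : measurable_fun setT h -> L1 P (h \o xi 1%N) ->
    L1 P (h \o xi t.+1) /\ Ex P (h \o xi t.+1) = Ex P (h \o xi 1%N).
  move=> mh ih.
  exact: (Ex_same_law (mxi 1%N) (mxi t.+1) mh (fun A mA => law t.+1 A isT mA) ih).
have Y0E x : Y 0%N x = xi 0%N x by [].
have YSE t x : Y t.+1 x = thr_map beta r (Y t x) + xi t.+1 x.
  by rewrite /Y /thr_map /= mul1r ?leNgt ?if_neg.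
have rN1 := ler_norm r.
have rN2 : - r <= `|r| by rewrite -normrN; exact: ler_norm.
have mY t : measurable_fun setT (Y t).
  by apply: (@chain_measurable _ _ _ P xi Y beta r) => //.
have ilow t : L1 P (fun x => lowsq r (Y t x)).
  by apply: (@chain_low_L1 _ _ _ P xi Y beta r) => //.
pose LS n := \sum_(0 <= t < n) Ex P (fun x => lowsq r (Y t x)).
have [[C hC] sub] : (exists C, forall n, LS n <= C * (1 + n%:R)) /\
    sublinear (fun n => `|beta ^+ 2 - 1| * LS n).
  case: cases => [[b1 r0]|bE].
    have glow : beta < 0 -> forall u, - `|r| <= thr_map beta r u.
      move=> b0 u; rewrite /thr_map; case: (ltP r u) => /= ur; first by lra.
      apply: le_trans (_ : 0 <= _); first by rewrite oppr_le0.
      by apply: mulr_le0; [exact: ltW|exact: le_trans r0].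
    have sl : sublinear LS.
      by apply: (@low_sublinear _ _ _ P xi Y beta r s2) => //.
    split; last by apply: sublinearZ.
    (* Sublinearity with slope 1 gives the linear bound: C + n <= (|C| + 1) (1 + n). *)
    have [C hC] := sl 1 ltr01; exists (`|C| + 1) => n; apply: le_trans (hC n) _.
    have c1 := ler_norm C; have c2 : 0 <= `|C| * n%:R by exact: mulr_ge0.
    by lra.
  (* For beta = -1 the energy below r has coefficient beta^2 - 1 = 0 in the squares, but its linear
     growth still controls the low martingale and the denominator. *)
  split.
    apply: (@low_linear _ _ _ P xi Y beta r s2) => //.
    move=> u; rewrite /thr_map bE; case: (ltP r u) => /= ur; lra.
  apply: (sublinear_le (S' := fun=> 0)); first exact: sublinear_cst.
  by move=> n; rewrite bE sqrrN expr1n subrr normr0 mul0r.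
have C0 : 0 <= C by have := hC 0%N; rewrite /LS big_geq// mulr0n addr0 mulr1.
have [iM sM] : (forall n, L1 P (fun x => \sum_(0 <= t < n) lowid r (Y t x) * xi t.+1 x)) /\
    sublinear (fun n => Ex P (fun x => `|\sum_(0 <= t < n) lowid r (Y t x) * xi t.+1 x|)).
  by apply: (@low_mart_sublinear _ _ _ P xi Y beta r s2 _ _ _ _ _ _ _ _ _ C).
have sN : sublinear
    (fun n => Ex P (fun x => `|\sum_(0 <= t < n) xi t.+1 x ^+ 2 - n%:R * s2|)).
  by apply: (@noise_lln _ _ _ P xi s2).
have iN n : L1 P (fun x => `|\sum_(0 <= t < n) xi t.+1 x ^+ 2 - n%:R * s2|).
  apply: L1_norm; apply: L1B; last exact: L1_cst.
  apply: (L1_sum_nat (X := fun t x => xi t.+1 x ^+ 2)) => t _.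
  by apply: (@chain_noise2 _ _ _ P xi).
pose u n x := Y n x ^+ 2 / (n%:R * s2).
pose v n x := (\sum_(0 <= i < n) Y i x ^+ 2) / (n%:R ^+ 2 * s2).
(* Defined as exact differences, so that the normalised estimator equals the perturbed ratio of
   [ratio_cvg] with no remainder. *)
pose er1 n x := (lse_num r Y n x - lse_den r Y n x) / (n%:R * s2) - (u n x - 1) / 2.
pose er2 n x := lse_den r Y n x / (n%:R ^+ 2 * s2) - v n x.
have mnum n : measurable_fun setT (lse_num r Y n).
  rewrite /lse_num; apply: measurable_sum => t; apply: measurable_fun_ifT => //.
    exact: measurable_fun_ltr.
  exact: measurable_funM.
have mden n : measurable_fun setT (lse_den r Y n).
  rewrite /lse_den; apply: measurable_sum => t; apply: measurable_fun_ifT => //.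
    exact: measurable_fun_ltr.
  exact: measurable_funX.
have mu n : measurable_fun setT (u n).
  by apply: measurable_funM => //; exact: measurable_funX.
have mv n : measurable_fun setT (v n).
  by apply: measurable_funM => //; apply: measurable_sum => t; exact: measurable_funX.
have me1 n : measurable_fun setT (er1 n).
  apply: measurable_funB; apply: measurable_funM => //; exact: measurable_funB.
have me2 n : measurable_fun setT (er2 n).
  by apply: measurable_funB => //; exact: measurable_funM.
have mZ n : measurable_fun setT (fun x => n%:R * (ahat n x - 1)).
  by apply: measurable_funM => //; exact: measurable_funB.
have mB1 : measurable_fun setT (B 1) by case: hB => h _ _ _ _; apply: h.
have mU : measurable_fun setT (fun w => B 1 w ^+ 2) by exact: measurable_funX.
have mV : measurable_fun setT (bm_energy B) by exact: (measurable_bm_energy hB).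
have u0 n x : 0 <= u n x by rewrite divr_ge0 ?sqr_ge0// mulr_ge0// ltW.
have v0' n x : 0 <= v n x.
  rewrite divr_ge0//; first by apply: sumr_ge0 => t _; exact: sqr_ge0.
  by rewrite mulr_ge0 ?sqr_ge0// ltW.
have lap (i j : nat) :
    (fun n => Ex P (fun x => expR (- (i%:R * u n x + j%:R * v n x)))) @ \oo -->
    Ex Q (fun x => expR (- (i%:R * B 1 x ^+ 2 + j%:R * bm_energy B x))).
  have c1 : (fun n => Ex P (fun x => expR (- (i%:R * u n x + j%:R * v n x))) -
      \prod_(0 <= k < n) (1 - ric i%:R j%:R n%:R k / n%:R)) @ \oo --> (0 : R).
    by apply: (@chain_laplace _ _ _ P xi Y beta r s2) => //.
  have c2 := bm_laplace_cvg hB (ler0n R i) (ler0n R j).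
  have h := cvgD c1 c2; rewrite add0r in h.
  have FE : (fun n => Ex P (fun x => expR (- (i%:R * u n x + j%:R * v n x)))) =
     (fun n => (Ex P (fun x => expR (- (i%:R * u n x + j%:R * v n x))) -
      \prod_(0 <= k < n) (1 - ric i%:R j%:R n%:R k / n%:R)) +
      \prod_(0 <= k < n) (1 - ric i%:R j%:R n%:R k / n%:R)).
    by apply/funext => n; rewrite subrK.
  by rewrite FE; exact: h.
pose m0 := Ex P (fun x => xi 0%N x ^+ 2).
have m00 : 0 <= m0 by apply: Ex_ge0 => x; exact: sqr_ge0.
(* The last summand m0 + 2 C pays for the denominator: its error has mean at most m0 + C (1 + n) and
   carries an extra factor 1 / n. *)
pose W n := 2 * m0 + s2 + `|beta ^+ 2 - 1| * LS n +
  2 * `|beta| * Ex P (fun x => `|\sum_(0 <= t < n) lowid r (Y t x) * xi t.+1 x|) +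
  Ex P (fun x => `|\sum_(0 <= t < n) xi t.+1 x ^+ 2 - n%:R * s2|) + (m0 + 2 * C).
have b0 : 0 <= 2 * `|beta| by exact: mulr_ge0.
have sW : sublinear W.
  rewrite /W; apply: sublinearD; last exact: sublinear_cst.
  apply: sublinearD => //; apply: sublinearD; last exact: sublinearZ.
  by apply: sublinearD => //; exact: sublinear_cst.
have LS0 n : 0 <= LS n.
  apply: sumr_ge0 => t _; apply: Ex_ge0 => x; rewrite /lowsq.
  by case: ifP => // _; exact: sqr_ge0.
have W0 n : 0 <= W n.
  rewrite /W; apply: addr_ge0; last by rewrite addr_ge0// mulr_ge0.
  apply: addr_ge0; last exact: Ex_ge0.
  apply: addr_ge0; last by apply: mulr_ge0 => //; exact: Ex_ge0.
  apply: addr_ge0; last exact: mulr_ge0.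
  by apply: addr_ge0; [exact: mulr_ge0|exact: ltW].
have err : (fun n => Ex P (fun x => Num.min 1 (`|er1 n x| + `|er2 n x|))) @ \oo --> (0 : R).
  apply: (squeeze_cvgr _ (cvg_cst 0) (sublinear_cvg0 s20 W0 sW)).
  near=> n.
  have n0 : (0 < n)%N by near: n; exact: nbhs_infty_gt.
  have n1 : 1 <= n%:R :> R by rewrite ler1n.
  have nP : 0 < n%:R :> R by rewrite ltr0n.
  have nV : n%:R != 0 :> R by rewrite gt_eqF.
  have sV : s2 != 0 by rewrite gt_eqF.
  apply/andP; split.
    by apply: Ex_ge0 => x; rewrite le_min ler01 addr_ge0.
  pose w1 x := 2 * xi 0%N x ^+ 2 + xi 1%N x ^+ 2 +
    `|beta ^+ 2 - 1| * (\sum_(0 <= t < n) lowsq r (Y t x)) +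
    2 * `|beta| * `|\sum_(0 <= t < n) lowid r (Y t x) * xi t.+1 x| +
    `|\sum_(0 <= t < n) xi t.+1 x ^+ 2 - n%:R * s2|.
  pose w2 x := xi 0%N x ^+ 2 + \sum_(0 <= t < n) lowsq r (Y t x).
  have isl : L1 P (fun x => \sum_(0 <= t < n) lowsq r (Y t x)).
    by apply: (L1_sum_nat (X := fun t x => lowsq r (Y t x))) => t _; exact: ilow.
  have esl : Ex P (fun x => \sum_(0 <= t < n) lowsq r (Y t x)) = LS n.
    by rewrite (Ex_sum_nat (X := fun t x => lowsq r (Y t x)))// => t _; exact: ilow.
  have j1 := L1Z 2 i0.
  have j2 := L1Z `|beta ^+ 2 - 1| isl.
  have j3 := L1Z (2 * `|beta|) (L1_norm (iM n)).
  have iw1 : L1 P w1 by exact: (L1D (L1D (L1D (L1D j1 i1) j2) j3) (iN n)).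
  have iw2 : L1 P w2 by exact: (L1D i0 isl).
  have ew1 : Ex P w1 + (m0 + 2 * C) = W n.
    rewrite /w1 (ExD (L1D (L1D (L1D j1 i1) j2) j3) (iN n)).
    rewrite (ExD (L1D (L1D j1 i1) j2) j3) (ExD (L1D j1 i1) j2) (ExD j1 i1).
    by rewrite (ExZ 2 i0) (ExZ `|beta ^+ 2 - 1| isl) (ExZ (2 * `|beta|) (L1_norm (iM n))) esl.
  have ew2 : Ex P w2 = m0 + LS n by rewrite /w2 (ExD i0 isl) esl.
  have ns0 : 0 < n%:R * s2 by exact: mulr_gt0.
  have b1 x : `|er1 n x| <= (n%:R * s2)^-1 * w1 x.
    have hD : `|2 * (lse_num r Y n x - lse_den r Y n x) - (Y n x ^+ 2 - n%:R * s2)| <= w1 x.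
      exact: (@lse_num_error R beta r (fun t => Y t x) (fun t => xi t x)
        (fun t => YSE t x) n (n%:R * s2) n0).
    have -> : er1 n x = (n%:R * s2)^-1 *
        ((2 * (lse_num r Y n x - lse_den r Y n x) - (Y n x ^+ 2 - n%:R * s2)) / 2).
      by rewrite /er1 /u; field; rewrite nV sV.
    rewrite normrM (ger0_norm (x := (n%:R * s2)^-1)) ?invr_ge0 ?(ltW ns0)//.
    rewrite ler_wpM2l ?invr_ge0 ?(ltW ns0)// normrM (ger0_norm (x := 2^-1)) ?invr_ge0//.
    by apply: le_trans hD; rewrite ler_pdivrMr// ler_peMr// ler1n.
  have b2 x : `|er2 n x| <= (n%:R ^+ 2 * s2)^-1 * w2 x.
    have ns : 0 <= (n%:R ^+ 2 * s2)^-1 by rewrite invr_ge0 mulr_ge0 ?sqr_ge0// ltW.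
    rewrite /er2 /v -mulrBl mulrC normrM (ger0_norm ns) ler_wpM2l//.
    exact: (@lse_den_error R r (fun t => Y t x) n n0).
  apply: le_trans (_ : Ex P (fun x => (n%:R * s2)^-1 * w1 x + (n%:R ^+ 2 * s2)^-1 * w2 x) <= _).
    apply: Ex_le.
    - apply: (L1_bnd P (M := 1)).
        apply: measurable_minr => //; apply: measurable_funD; exact: measurableT_comp.
      by move=> x; rewrite ger0_norm ?ge_min ?lexx// le_min ler01 addr_ge0.
    - by apply: L1D; exact: L1Z.
    by move=> x; rewrite ge_min; apply/orP; right; apply: lerD.
  rewrite (ExD (L1Z _ iw1) (L1Z _ iw2)) (ExZ _ iw1) (ExZ _ iw2) -ew1 ew2.
  have -> : (n%:R ^+ 2 * s2)^-1 = (n%:R * s2)^-1 * n%:R^-1 by field; rewrite nV sV.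
  rewrite -mulrA -mulrDr [leRHS]mulrC ler_wpM2l ?invr_ge0 ?(ltW ns0)// lerD2l.
  rewrite ler_pdivrMl//; have hCn := hC n.
  have p1 : 0 <= (n%:R - 1) * m0 by rewrite mulr_ge0// subr_ge0.
  have p2 : 0 <= (n%:R - 1) * C by rewrite mulr_ge0// subr_ge0.
  by lra.
(* Since v + er2 is the denominator over n^2 s2, it is nonzero only if the least-squares denominator
   is, which is when [ahatE] applies. *)
have ZE n x : v n x + er2 n x != 0 -> n%:R * (ahat n x - 1) =
    ((u n x - 1) / 2 + er1 n x) / (v n x + er2 n x).
  rewrite /er1 /er2 [X in _ = X / _]addrC subrK [v n x + _]addrC subrK.
  rewrite mulf_eq0 invr_eq0 mulf_eq0 !negb_or expf_eq0 /= => /and3P[d0 nV sV].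
  by rewrite (ahatE n x d0) -/Y; field; rewrite nV sV d0.
move=> f cf [M fM].
have mf : measurable_fun setT f by exact: continuous_measurable_fun.
have rc := ratio_cvg mu mv me1 me2 mZ mU mV u0 v0' (fun w => sqr_ge0 (B 1 w))
  (bm_energy_ge0 B) (bm_energy_eq0 hB) lap err ZE cf fM.
have -> : (fun n => (\int[P]_x (f (n%:R * (ahat n x - 1)))%:E)%E) =
    fun n => (Ex P (fun x => f (n%:R * (ahat n x - 1))))%:E.
  apply/funext => n; apply: (EFin_Ex (X := fun x => f (n%:R * (ahat n x - 1)))).
  by apply: (L1_bnd P (M := M)) => //; exact: (measurableT_comp mf (mZ n)).
have mlim : measurable_fun setT (fun w => (B 1 w ^+ 2 - 1) / (2 * bm_energy B w)).
  apply: measurable_funM; first exact: measurable_funB.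
  by apply: (measurableT_comp measurable_invr); exact: measurable_funM.
have il : L1 Q (fun w => f ((B 1 w ^+ 2 - 1) / (2 * bm_energy B w))).
  by apply: (L1_bnd Q (M := M)) => //; exact: (measurableT_comp mf mlim).
have EQ := EFin_Ex il; rewrite [X in _ --> X]EQ.
by apply: cvg_EFin; [exact: nearW|exact: rc].
Unshelve. all: by end_near.
Qed.
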